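(* Let $(M,g)$ be a Riemannian manifold with Levi-Civita connection $\nabla$, and let $\bar\nabla$ be the Levi-Civita connection of a nondegenerate $g$-natural metric $G$ on $TM$ defined by functions $\alpha_i,\beta_i$, $i=1,2,3$. Let $(x,u)\in TM$ and let $X,Y$ be vector fields on $M$. Then $$(\bar\nabla_{X^h}Y^h)_{(x,u)}=(\nabla_XY)^h_{(x,u)}+h\{A(u;X_x,Y_x)\}+v\{B(u;X_x,Y_x)\},$$ $$(\bar\nabla_{X^h}Y^v)_{(x,u)}=(\nabla_XY)^v_{(x,u)}+h\{C(u;X_x,Y_x)\}+v\{D(u;X_x,Y_x)\},$$ $$(\bar\nabla_{X^v}Y^h)_{(x,u)}=h\{C(u;Y_x,X_x)\}+v\{D(u;Y_x,X_x)\},$$ $$(\bar\nabla_{X^v}Y^v)_{(x,u)}=h\{E(u;Y_x,X_x)\}+v\{F(u;Y_x,X_x)\},$$ where for $P=A,B,C,D,E,F$, $P(u;X_x,Y_x)=\sum_{i=1}^8 f_i^P(|u|^2)\,T^i(u;X_x,Y_x)$, $|u|^2=g_x(u,u)$, with the following coefficients (all functions evaluated at $t=|u|^2$, primes denoting derivatives in $t$). For $A$: $f_1^A=f_2^A=-\frac{\alpha_1\alpha_2}{2\alpha}$, $f_3^A=0$, $f_4^A=\alpha_2\psi_\lambda$, $f_5^A=f_6^A=\frac{\alpha_2(\beta_1+\beta_3)}{2\alpha}$, $f_7^A=(\alpha_1+\alpha_3)'\frac{\phi_2}{\phi}$, $f_8^A=(\beta_1+\beta_3)'\frac{\phi_2}{\phi}+(\beta_1+\beta_3)\psi_\theta$.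 For $B$: $f_1^B=\frac{\alpha_2^2}{\alpha}$, $f_2^B=0$, $f_3^B=-\frac{\alpha_1(\alpha_1+\alpha_3)}{2\alpha}$, $f_4^B=\alpha_2\psi_\theta$, $f_5^B=f_6^B=-\frac{(\alpha_1+\alpha_3)(\beta_1+\beta_3)}{2\alpha}$, $f_7^B=-(\alpha_1+\alpha_3)'\frac{\phi_1+\phi_3}{\phi}$, $f_8^B=-(\beta_1+\beta_3)'\frac{\phi_1+\phi_3}{\phi}+(\beta_1+\beta_3)\psi_\omega$. For $C$: $f_1^C=0$, $f_2^C=-\frac{\alpha_1^2}{2\alpha}$, $f_3^C=0$, $f_4^C=\frac{\alpha_1\psi_\lambda}{2}$, $f_5^C=\frac{\alpha_1(\beta_1+\beta_3)}{2\alpha}$, $f_6^C=(\alpha_1+\alpha_3)'\frac{\alpha_1}{\alpha}-\frac{\alpha_2}{2\alpha}(2\alpha_2'-\beta_2)$, $f_7^C=\frac{(\beta_1+\beta_3)\phi_1}{2\phi}+\frac12(2\alpha_2'-\beta_2)\frac{\phi_2}{\phi}$, $f_8^C=(\beta_1+\beta_3)'\frac{\phi_1}{\phi}-\psi_\lambda\left[(\alpha_1+\alpha_3)'+\frac{\beta_1+\beta_3}{2}\right]-\frac12(2\alpha_2'-\beta_2)\psi_\theta$. For $D$: $f_1^D=0$, $f_2^D=\frac{\alpha_1\alpha_2}{2\alpha}$, $f_3^D=0$, $f_4^D=\frac{\alpha_1}{2}\psi_\theta$, $f_5^D=-\frac{\alpha_2(\beta_1+\beta_3)}{2\alpha}$,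 $f_6^D=-(\alpha_1+\alpha_3)'\frac{\alpha_2}{\alpha}+\frac{(2\alpha_2'-\beta_2)(\alpha_1+\alpha_3)}{2\alpha}$, $f_7^D=-\frac{(\beta_1+\beta_3)\phi_2}{2\phi}-\frac12(2\alpha_2'-\beta_2)\frac{\phi_1+\phi_3}{\phi}$, $f_8^D=-(\beta_1+\beta_3)'\frac{\phi_2}{\phi}-\left[(\alpha_1+\alpha_3)'+\frac{\beta_1+\beta_3}{2}\right]\psi_\theta-\frac12(2\alpha_2'-\beta_2)\psi_\omega$. For $E$: $f_1^E=f_2^E=f_3^E=f_4^E=0$, $f_5^E=f_6^E=(\alpha_2'+\frac12\beta_2)\frac{\alpha_1}{\alpha}-\alpha_1'\frac{\alpha_2}{\alpha}$, $f_7^E=\beta_2\frac{\phi_1}{\phi}-(\beta_1-\alpha_1')\frac{\phi_2}{\phi}$, $f_8^E=2\beta_2'\frac{\phi_1}{\phi}-\beta_1'\frac{\phi_2}{\phi}-(2\alpha_2'+\beta_2)\psi_\lambda-2\alpha_1'\psi_\theta$. For $F$: $f_1^F=f_2^F=f_3^F=f_4^F=0$, $f_5^F=f_6^F=-(\alpha_2'+\frac12\beta_2)\frac{\alpha_2}{\alpha}+\alpha_1'\frac{\alpha_1+\alpha_3}{\alpha}$, $f_7^F=(\beta_1-\alpha_1')\frac{\phi_1+\phi_3}{\phi}-\frac{\beta_2\phi_2}{\phi}$, $f_8^F=\beta_1'\frac{\phi_1+\phi_3}{\phi}-2\beta_2'\frac{\phi_2}{\phi}-(2\alpha_2'+\b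eta_2)\psi_\theta-2\alpha_1'\psi_\omega$.
   Context: $\mathbb{R}^+=[0,\infty)$. Let $\pi:TM\to M$ be the projection. The tangent space splits as $T_{(x,u)}TM=H_{(x,u)}M\oplus V_{(x,u)}M$ into horizontal (with respect to $\nabla$) and vertical subspaces. For $X\in T_xM$, the horizontal lift $X^h\in H_{(x,u)}M$ is the unique horizontal vector with $\pi_*X^h=X$, and the vertical lift $X^v\in V_{(x,u)}M$ is the vertical vector with $X^v(df)=X(f)$ for all functions $f$ on $M$, where $df$ is viewed as the function $(x,u)\mapsto u(f)$ on $TM$; vector fields on $M$ are lifted pointwise. For $W\in T_xM$ (possibly depending on $u$), $h\{W\}$ and $v\{W\}$ denote the horizontal and vertical lifts of $W$ at $(x,u)$. A $g$-natural metric $G$ on $TM$ is a symmetric $(0,2)$-tensor field on $TM$ obtained from $g$ by a first order natural operator; equivalently, it is given by smooth functions $\alpha_i,\beta_i:\mathbb{R}^+\to\mathbb{R}$, $i=1,2,3$ (with $\beta_i=0$ if $\dim M=1$), such that for all $x\in M$ and $u,X,Y\in T_xM$, with $t=g_x(u,u)$, $$G_{(x,u)}(X^h,Y^h)=(\alpha_1+\alpha_3)(t)g_x(X,Y)+(\beta_1+\beta_3)(t)g_x(X,u)g_x(Y,u),$$ $$G_{(x,u)}(X^h,Y^v)=G_{(x,u)}(X^v,Y^h)=\alpha_2(t)g_x(X,Y)+\beta_2(t)g_x(X,u)g_x(Y,u),$$ $$G_{(x,u)}(X^v,Y^v)=\alpha_1(t)g_x(X,Y)+\beta_1(t)g_x(X,u)g_x(Y,u).$$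 Notation: $\phi_i(t)=\alpha_i(t)+t\beta_i(t)$, $\alpha(t)=\alpha_1(t)(\alpha_1+\alpha_3)(t)-\alpha_2(t)^2$, $\phi(t)=\phi_1(t)(\phi_1+\phi_3)(t)-\phi_2(t)^2$. $G$ is nondegenerate if and only if $\alpha(t)\phi(t)\neq0$ for all $t\in\mathbb{R}^+$ (known fact). Further, $$\psi_\lambda=\frac{\alpha_1[(\beta_1+\beta_3)\phi_1-\beta_2\phi_2]-\alpha_2(\alpha_1\beta_2-\alpha_2\beta_1)}{\alpha\phi},$$ $$\psi_\theta=\frac{-\alpha_2[(\beta_1+\beta_3)\phi_1-\beta_2\phi_2]+(\alpha_1+\alpha_3)(\alpha_1\beta_2-\alpha_2\beta_1)}{\alpha\phi},$$ $$\psi_\omega=\frac{(\alpha_1+\alpha_3)[\beta_1(\phi_1+\phi_3)-\beta_2\phi_2]+\alpha_2[\alpha_2(\beta_1+\beta_3)-\beta_2(\alpha_1+\alpha_3)]}{\alpha\phi}.$$ The curvature convention is $R(X,Y)=[\nabla_X,\nabla_Y]-\nabla_{[X,Y]}$. For $(x,u)\in TM$ and $X,Y\in T_xM$: $T^1(u;X,Y)=R(X,u)Y$, $T^2(u;X,Y)=R(Y,u)X$, $T^3(u;X,Y)=R(X,Y)u$, $T^4(u;X,Y)=g(R(X,u)Y,u)u$, $T^5(u;X,Y)=g(X,u)Y$, $T^6(u;X,Y)=g(Y,u)X$, $T^7(u;X,Y)=g(X,Y)u$, $T^8(u;X,Y)=g(X,u)g(Y,u)u$. *)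

(* Defs.v *)
From HB Require Import structures.
From mathcomp Require Import all_boot all_order all_algebra.
From mathcomp Require Import all_classical all_reals all_analysis.

Set Implicit Arguments.
Unset Strict Implicit.
Unset Printing Implicit Defensive.

Import Order.TTheory GRing.Theory Num.Theory.
Import numFieldNormedType.Exports.

Local Open Scope classical_set_scope.
Local Open Scope ring_scope.

(* C^k on an open set.  Meant for V finite-dimensional ('rV[R]_n or R); the
   inductive step is then "all first partial derivatives are C^k". *)
Fixpoint Ck_on (R : realType) (V W : normedModType R) (k : nat) (U : set V)
    (f : V -> W) : Prop :=
  match k with
  | 0%N => forall y, U y -> {for y, continuous f}
  | k'.+1 => (forall y, U y -> differentiable f y) /\
             forall v : V, Ck_on k' U (fun y => 'D_v f y)
  end.

Definition smooth_on (R : realType) (V W : normedModType R) (U : set V)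
    (f : V -> W) : Prop := forall k, Ck_on k U f.

(* Smoothness on the closed half-line R^+ = [0, +oo[ : existence of a smooth
   extension to R.  Values of f at negative arguments are irrelevant. *)
Definition smooth_Rplus (R : realType) (f : R -> R) : Prop :=
  exists2 F : R -> R, smooth_on setT F & forall t, 0 <= t -> F t = f t.

(* Derivative within R^+ (one-sided at t = 0). *)
Definition dRplus (R : realType) (f : R -> R) (t : R) : R :=
  lim ((fun h : R => h^-1 * (f (h + t) - f t)) @
         within [set h : R | 0 <= h + t] (0 : R)^').

(* An atlas of n-dimensional charts on M, together with the choice, for every
   point x, of a chart [at_pt x] around x.  Only the data are recorded here;
   the axioms of a manifold are in [smooth_manifold].

   The preferred charts serve to represent tangent vectors: T_x M is 'rV[R]_n,
   a vector being given by its components in the chart [at_pt x]. *)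
Record atlas (R : realType) (n : nat) (M : Type) := Atlas {
  idx : Type ;
  chart_dom : idx -> set M ;
  chart : idx -> M -> 'rV[R]_n ;
  at_pt : M -> idx }.

Section Atlas.
Variables (R : realType) (n : nat) (M : Type) (A : atlas R n M).

(* f o (chart i)^-1 on the image of chart i, and 0 elsewhere *)
Definition loc (W : normedModType R) (i : idx A) (f : M -> W)
    (y : 'rV[R]_n) : W :=
  xget 0 [set z | exists x, [/\ chart_dom i x, chart i x = y & f x = z]].

Definition vfield := M -> 'rV[R]_n.
Definition tensor02 := M -> 'rV[R]_n -> 'rV[R]_n -> R.

(* components in the chart i of the tangent vector v at x *)
Definition tcoord (i : idx A) (x : M) (v : 'rV[R]_n) : 'rV[R]_n :=
  'd (loc (at_pt A x) (chart i)) (chart (at_pt A x) x) v.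

Definition smooth_fun (f : M -> R) : Prop :=
  forall i : idx A, smooth_on (chart i @` chart_dom i) (loc i f).

Definition smooth_vfield (X : vfield) : Prop :=
  forall i : idx A,
    smooth_on (chart i @` chart_dom i) (loc i (fun x => tcoord i x (X x))).

(* v(f), for v in T_x M *)
Definition vderiv (x : M) (v : 'rV[R]_n) (f : M -> R) : R :=
  'D_v (loc (at_pt A x) f) (chart (at_pt A x) x).

(* [X, Y]^k = X^i d_i Y^k - Y^i d_i X^k in the chart at x *)
Definition lie_bracket (X Y : vfield) : vfield := fun x =>
  let i := at_pt A x in
  'D_(X x) (loc i (fun z => tcoord i z (Y z))) (chart i x)
  - 'D_(Y x) (loc i (fun z => tcoord i z (X z))) (chart i x).

Definition sym_tensor02 (g : tensor02) : Prop :=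
  [/\ forall x v w, g x v w = g x w v,
      forall x a v v' w, g x (a *: v + v') w = a * g x v w + g x v' w
    & forall X Y, smooth_vfield X -> smooth_vfield Y ->
        smooth_fun (fun x => g x (X x) (Y x))].

Definition riemannian (g : tensor02) : Prop :=
  sym_tensor02 g /\ forall x v, v != 0 -> 0 < g x v v.

Definition nondegenerate_metric (g : tensor02) : Prop :=
  forall x v, (forall w, g x v w = 0) -> v = 0.

(* Only the values of nabla on smooth vector fields are constrained. *)
Definition affine_connection (nabla : vfield -> vfield -> vfield) : Prop :=
  [/\ forall X Y, smooth_vfield X -> smooth_vfield Y ->
        smooth_vfield (nabla X Y),
      forall f X X' Y, smooth_fun f -> smooth_vfield X -> smooth_vfield X' ->
        smooth_vfield Y -> forall x,
        nabla (fun z => f z *: X z + X' z) Y x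
        = f x *: nabla X Y x + nabla X' Y x,
      forall X Y Y', smooth_vfield X -> smooth_vfield Y -> smooth_vfield Y' ->
        forall x, nabla X (fun z => Y z + Y' z) x = nabla X Y x + nabla X Y' x
    & forall f X Y, smooth_fun f -> smooth_vfield X -> smooth_vfield Y ->
        forall x, nabla X (fun z => f z *: Y z) x
        = vderiv x (X x) f *: Y x + f x *: nabla X Y x].

Definition levi_civita (g : tensor02)
    (nabla : vfield -> vfield -> vfield) : Prop :=
  [/\ affine_connection nabla,
      forall X Y, smooth_vfield X -> smooth_vfield Y -> forall x,
        nabla X Y x - nabla Y X x = lie_bracket X Y x
    & forall X Y Z, smooth_vfield X -> smooth_vfield Y -> smooth_vfield Z ->
        forall x, vderiv x (X x) (fun z => g z (Y z) (Z z))
        = g x (nabla X Y x) (Z x) + g x (Y x) (nabla X Z x)].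

Definition curvature (nabla : vfield -> vfield -> vfield) (X Y Z : vfield) :
    vfield := fun x =>
  nabla X (nabla Y Z) x - nabla Y (nabla X Z) x
  - nabla (lie_bracket X Y) Z x.

(* R_x(a, b)c, computed with arbitrary smooth extensions of a, b, c; the
   result does not depend on them when nabla is an affine connection. *)
Definition curvature_at (nabla : vfield -> vfield -> vfield) (x : M)
    (a b c : 'rV[R]_n) : 'rV[R]_n :=
  xget 0 [set w | exists X Y Z : vfield,
    [/\ smooth_vfield X, smooth_vfield Y & smooth_vfield Z] /\
    [/\ X x = a, Y x = b, Z x = c & w = curvature nabla X Y Z x]].

End Atlas.

(* Smooth n-manifold: Hausdorff, second countable, the charts are homeomorphisms
   from open sets onto open sets, and the changes of charts are smooth. *)
Definition smooth_manifold (R : realType) (n : nat) (M : topologicalType)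
    (A : atlas R n M) : Prop :=
  [/\ hausdorff_space M, @second_countable M,
      forall x, chart_dom (at_pt A x) x,
      forall i : idx A, [/\ open (chart_dom i), set_inj (chart_dom i) (chart i) &
        forall U : set M, U `<=` chart_dom i -> (open U <-> open (chart i @` U))]
    & forall i j : idx A,
        smooth_on (chart i @` (chart_dom i `&` chart_dom j)) (loc i (chart j))].

(* differential at x of a map F : M -> N *)
Definition tmap (R : realType) (n m : nat) (M N : Type) (A : atlas R n M)
    (B : atlas R m N) (F : M -> N) (x : M) (v : 'rV[R]_n) : 'rV[R]_m :=
  'd (loc (at_pt A x) (fun z => chart (at_pt B (F x)) (F z)))
     (chart (at_pt A x) x) v.

Section TangentBundle.
Variables (R : realType) (n : nat) (M : Type) (A : atlas R n M).
Local Notation TM := (M * 'rV[R]_n)%type.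

(* TM as a 2n-dimensional manifold: the chart i of M induces the chart
   (x, u) |-> (chart i x, components of u in the chart i) of TM. *)
Definition tangent_atlas : atlas R (n + n) TM :=
  {| idx := idx A ;
     chart_dom := fun i => [set p | chart_dom i p.1] ;
     chart := fun i p => row_mx (chart i p.1) (tcoord i p.1 p.2) ;
     at_pt := fun p => at_pt A p.1 |}.

Definition dproj (p : TM) : 'rV[R]_(n + n) -> 'rV[R]_n :=
  tmap tangent_atlas A fst p.

Definition vertical (p : TM) : set 'rV[R]_(n + n) :=
  [set a | dproj p a = 0].

(* H_(x,u) M: the images dY_x(X_x), for vector fields Y : M -> TM through
   (x, u) which are parallel at x in the direction X_x; this is the kernel of
   the connection map dY_x(X_x) |-> (nabla_X Y)_x. *)
Definition horizontal (nabla : vfield R n M -> vfield R n M -> vfield R n M)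
    (p : TM) : set 'rV[R]_(n + n) :=
  [set a | exists X Y : vfield R n M,
    [/\ smooth_vfield A X, smooth_vfield A Y, Y p.1 = p.2,
        nabla X Y p.1 = 0
      & a = tmap A tangent_atlas (fun z => (z, Y z)) p.1 (X p.1)]].

Definition hlift (nabla : vfield R n M -> vfield R n M -> vfield R n M)
    (p : TM) (X : 'rV[R]_n) : 'rV[R]_(n + n) :=
  xget 0 [set a | horizontal nabla p a /\ dproj p a = X].

Definition vlift (p : TM) (X : 'rV[R]_n) : 'rV[R]_(n + n) :=
  xget 0 [set a | vertical p a /\
    forall f : M -> R, smooth_fun A f ->
      vderiv tangent_atlas p a (fun q => vderiv A q.1 q.2 f)
      = vderiv A p.1 X f].

Definition hlift_vfield (nabla : vfield R n M -> vfield R n M -> vfield R n M)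
    (X : vfield R n M) : vfield R (n + n) TM := fun p => hlift nabla p (X p.1).

Definition vlift_vfield (X : vfield R n M) : vfield R (n + n) TM :=
  fun p => vlift p (X p.1).

End TangentBundle.

(* Only the values at t >= 0 are used. *)
Record gnat_coef (R : realType) := GnatCoef {
  alpha1 : R -> R ; alpha2 : R -> R ; alpha3 : R -> R ;
  beta1 : R -> R ; beta2 : R -> R ; beta3 : R -> R }.

Section GNatural.
Variables (R : realType) (n : nat) (M : Type) (A : atlas R n M).
Variables (g : tensor02 R n M).
Variables (nabla : vfield R n M -> vfield R n M -> vfield R n M).
Variables (c : gnat_coef R) (G : tensor02 R (n + n) (M * 'rV[R]_n)%type).

(* Symmetric tensor fields on TM obtained from g by a first order natural operator,
   in their classified form; the beta_i are taken to be 0 in dimension 1. *)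
Definition g_natural : Prop :=
  [/\ sym_tensor02 (tangent_atlas A) G,
      [/\ smooth_Rplus (alpha1 c), smooth_Rplus (alpha2 c)
        & smooth_Rplus (alpha3 c)],
      [/\ smooth_Rplus (beta1 c), smooth_Rplus (beta2 c)
        & smooth_Rplus (beta3 c)],
      n = 1%N -> forall t, 0 <= t ->
        [/\ beta1 c t = 0, beta2 c t = 0 & beta3 c t = 0]
    & forall (x : M) (u X Y : 'rV[R]_n),
        let t := g x u u in
        let Xh := hlift A nabla (x, u) X in
        let Yh := hlift A nabla (x, u) Y in
        let Xv := vlift A (x, u) X in
        let Yv := vlift A (x, u) Y in
        [/\ G (x, u) Xh Yh = (alpha1 c t + alpha3 c t) * g x X Y
              + (beta1 c t + beta3 c t) * g x X u * g x Y u,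
            G (x, u) Xh Yv = alpha2 c t * g x X Y
              + beta2 c t * g x X u * g x Y u,
            G (x, u) Xv Yh = alpha2 c t * g x X Y
              + beta2 c t * g x X u * g x Y u
          & G (x, u) Xv Yv = alpha1 c t * g x X Y
              + beta1 c t * g x X u * g x Y u]].

End GNatural.

Section Coefficients.
Variables (R : realType) (c : gnat_coef R) (t : R).

Definition phi1 : R := alpha1 c t + t * beta1 c t.
Definition phi2 : R := alpha2 c t + t * beta2 c t.
Definition phi3 : R := alpha3 c t + t * beta3 c t.
Definition alpha : R := alpha1 c t * (alpha1 c t + alpha3 c t) - alpha2 c t ^+ 2.
Definition phi : R := phi1 * (phi1 + phi3) - phi2 ^+ 2.

Local Notation a1 := (alpha1 c t).
Local Notation a2 := (alpha2 c t).
Local Notation a13 := (alpha1 c t + alpha3 c t).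
Local Notation b1 := (beta1 c t).
Local Notation b2 := (beta2 c t).
Local Notation b13 := (beta1 c t + beta3 c t).
Local Notation da1 := (dRplus (alpha1 c) t).
Local Notation da2 := (dRplus (alpha2 c) t).
Local Notation da13 := (dRplus (fun s => alpha1 c s + alpha3 c s) t).
Local Notation db1 := (dRplus (beta1 c) t).
Local Notation db2 := (dRplus (beta2 c) t).
Local Notation db13 := (dRplus (fun s => beta1 c s + beta3 c s) t).

Definition psi_lambda : R :=
  (a1 * (b13 * phi1 - b2 * phi2) - a2 * (a1 * b2 - a2 * b1)) / (alpha * phi).
Definition psi_theta : R :=
  (- a2 * (b13 * phi1 - b2 * phi2) + a13 * (a1 * b2 - a2 * b1)) / (alpha * phi).
Definition psi_omega : R :=
  (a13 * (b1 * (phi1 + phi3) - b2 * phi2) + a2 * (a2 * b13 - b2 * a13))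
  / (alpha * phi).

Definition fcoefA : seq R :=
  [:: - (a1 * a2 / (2 * alpha));
      - (a1 * a2 / (2 * alpha));
      0;
      a2 * psi_lambda;
      a2 * b13 / (2 * alpha);
      a2 * b13 / (2 * alpha);
      da13 * (phi2 / phi);
      db13 * (phi2 / phi) + b13 * psi_theta].

Definition fcoefB : seq R :=
  [:: a2 ^+ 2 / alpha;
      0;
      - (a1 * a13 / (2 * alpha));
      a2 * psi_theta;
      - (a13 * b13 / (2 * alpha));
      - (a13 * b13 / (2 * alpha));
      - (da13 * ((phi1 + phi3) / phi));
      - (db13 * ((phi1 + phi3) / phi)) + b13 * psi_omega].

Definition fcoefC : seq R :=
  [:: 0;
      - (a1 ^+ 2 / (2 * alpha));
      0;
      a1 * psi_lambda / 2;
      a1 * b13 / (2 * alpha);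
      da13 * (a1 / alpha) - a2 / (2 * alpha) * (2 * da2 - b2);
      b13 * phi1 / (2 * phi) + 2^-1 * (2 * da2 - b2) * (phi2 / phi);
      db13 * (phi1 / phi) - psi_lambda * (da13 + b13 / 2)
        - 2^-1 * (2 * da2 - b2) * psi_theta].

Definition fcoefD : seq R :=
  [:: 0;
      a1 * a2 / (2 * alpha);
      0;
      a1 / 2 * psi_theta;
      - (a2 * b13 / (2 * alpha));
      - (da13 * (a2 / alpha)) + (2 * da2 - b2) * a13 / (2 * alpha);
      - (b13 * phi2 / (2 * phi))
        - 2^-1 * (2 * da2 - b2) * ((phi1 + phi3) / phi);
      - (db13 * (phi2 / phi)) - (da13 + b13 / 2) * psi_theta
        - 2^-1 * (2 * da2 - b2) * psi_omega].

Definition fcoefE : seq R :=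
  [:: 0; 0; 0; 0;
      (da2 + 2^-1 * b2) * (a1 / alpha) - da1 * (a2 / alpha);
      (da2 + 2^-1 * b2) * (a1 / alpha) - da1 * (a2 / alpha);
      b2 * (phi1 / phi) - (b1 - da1) * (phi2 / phi);
      2 * db2 * (phi1 / phi) - db1 * (phi2 / phi)
        - (2 * da2 + b2) * psi_lambda - 2 * da1 * psi_theta].

Definition fcoefF : seq R :=
  [:: 0; 0; 0; 0;
      - ((da2 + 2^-1 * b2) * (a2 / alpha)) + da1 * (a13 / alpha);
      - ((da2 + 2^-1 * b2) * (a2 / alpha)) + da1 * (a13 / alpha);
      (b1 - da1) * ((phi1 + phi3) / phi) - b2 * phi2 / phi;
      db1 * ((phi1 + phi3) / phi) - 2 * db2 * (phi2 / phi)
        - (2 * da2 + b2) * psi_theta - 2 * da1 * psi_omega].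

End Coefficients.

Section Tensors.
Variables (R : realType) (n : nat) (M : Type) (A : atlas R n M).
Variables (g : tensor02 R n M).
Variables (nabla : vfield R n M -> vfield R n M -> vfield R n M).

Definition Tseq (x : M) (u X Y : 'rV[R]_n) : seq 'rV[R]_n :=
  let Rm := curvature_at A nabla x in
  [:: Rm X u Y;
      Rm Y u X;
      Rm X Y u;
      g x (Rm X u Y) u *: u;
      g x X u *: Y;
      g x Y u *: X;
      g x X Y *: u;
      (g x X u * g x Y u) *: u].

Definition Tcomb (f : R -> seq R) (x : M) (u X Y : 'rV[R]_n) : 'rV[R]_n :=
  \sum_(i < 8) nth 0 (f (g x u u)) i *: nth 0 (Tseq x u X Y) i.

End Tensors.

(* Main.v *)
From HB Require Import structures.
Require Import Defs.
From mathcomp Require Import all_boot all_order all_algebra.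
From mathcomp Require Import all_classical all_reals all_analysis.
From mathcomp Require Import ring lra.

Set Implicit Arguments.
Unset Strict Implicit.
Unset Printing Implicit Defensive.

Import Order.TTheory GRing.Theory Num.Theory.
Import numFieldNormedType.Exports.

Local Open Scope classical_set_scope.
Local Open Scope ring_scope.

(** The Koszul formula expresses [2 G (nabla_U V, W)] by derivatives of the functions
    [G (V, W)] and by brackets ([koszul]). Since [G] is nondegenerate and every tangent
    vector of [TM] is the sum of a horizontal and a vertical lift ([G_eq]), it is
    enough to evaluate it on lifts of fields of [M], where every term is known.

    - Brackets: the bracket of [X^h] and [Y^h] is [[X, Y]^h - (R (X, Y) u)^v], that of
      [X^h] and [Y^v] is [(nabla_X Y)^v], and vertical lifts commute ([bracket_hh],
      [bracket_hv], [bracket_vv]).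
    - Functions: the scalar product of two lifts is
      [a (|u|^2) g (Y, Z) + b (|u|^2) g (Y, u) g (Z, u)]. A horizontal derivative can be
      computed along a section which is parallel in the direction considered, so that
      [|u|^2] is stationary and only [Y] and [Z] are differentiated covariantly
      ([vderiv_Qfun_h]); a vertical derivative is a derivative on the fibre
      ([vderiv_Qfun_v]).

    In the sum the covariant derivatives cancel except for the expected one, and the
    curvature terms are gathered by the Bianchi identity and the pair symmetry
    ([nb_hh_h] to [nb_vv_v]). There remains a linear system for the horizontal and
    vertical parts [P] of the answer. Its equations only involve seven scalar
    invariants ([Qform_Tcomb]), so that the stated coefficients are right as soon as
    some identities between rational functions hold ([solves_AB_h] and the following
    ones). The denominators [alpha] and [phi] are the determinants of [G] on the planes
    spanned by the lifts of a vector orthogonal to [u] and by those of [u], and are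
    nonzero for this reason ([det_neq0]).

    The geometry is derived from an atlas, which takes most of the text. A calculus of
    smooth maps, with the symmetry of second derivatives, leads to the behaviour of
    vector fields under changes of charts. Bump functions extend local objects to the
    whole manifold; as connections are only defined on global fields, this is how they
    are shown to be local and to be given by Christoffel symbols ([nabla_chart]). In
    the chart of [TM] deduced from the one at [x], the horizontal lift of [v] at
    [(x, u)] is [(v, - Gam (v, u))] and the vertical lift is [(0, v)] ([hliftE],
    [vliftE]). Smoothness and brackets of lifts follow, the curvature appearing through
    its expression in the Christoffel symbols ([curvature_chart]), which also shows
    that it is a tensor. *)

(** * Differentials and directional derivatives *)

Section DiffScale.
Variables (R : realType) (V W : normedModType R).

(** The scalars are seen as the regular module, so that scaling is a bilinear map
    between normed modules and the differentiation rule for bilinear maps applies. *)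
Definition scale_reg (a : R^o) (w : W) : W := a *: w.

Lemma scale_reg_bilinear : bilinear_for
    (GRing.Scale.Law.clone _ _ *:%R _) (GRing.Scale.Law.clone _ _ *:%R _)
    scale_reg.
Proof.
rewrite /scale_reg; split=> [u|w] a b c /=; first by rewrite scalerDl scalerA.
by rewrite scalerDr !scalerA mulrC.
Qed.
HB.instance Definition _ := bilinear_isBilinear.Build R R^o W W _ _
  scale_reg scale_reg_bilinear.

Lemma is_diff_scale (k : V -> R) (f : V -> W) (y : V) :
  differentiable k y -> differentiable f y ->
  is_diff y (fun z => k z *: f z) (fun v => 'd k y v *: f y + k y *: 'd f y v).
Proof.
move=> dk df.
have cB : continuous (fun p : R^o * W => scale_reg p.1 p.2).
  exact: scale_continuous.
pose kf := fun z => (k z : R^o, f z).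
have dkf : differentiable kf y by exact: differentiable_pair.
have dB : differentiable (fun p : R^o * W => scale_reg p.1 p.2) (kf y).
  exact: differentiable_bilin.
apply: DiffDef; first exact: (differentiable_comp dkf dB).
apply/funext => v.
have -> : 'd (fun z => k z *: f z) y v
    = 'd (fun p : R^o * W => scale_reg p.1 p.2) (kf y) ('d kf y v).
  by rewrite -[LHS]/('d ((fun p : R^o * W => scale_reg p.1 p.2) \o kf) y v) diff_comp.
by rewrite diff_bilin // diff_pair //= addrC.
Qed.
End DiffScale.

Section Pointwise.
Variables (R : realType) (V W : normedModType R).
Implicit Types (f g : V -> W) (y v : V) (U : set V).

Lemma derive_near_eq U f g y v : open U -> U y ->
  (forall z, U z -> f z = g z) -> 'D_v f y = 'D_v g y.
Proof.
move=> oU Uy fg; apply: near_eq_derive.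
by apply: filterS (open_nbhs_nbhs (conj oU Uy)) => z; exact: fg.
Qed.

Lemma differentiable_near_eq U f g y : open U -> U y ->
  (forall z, U z -> f z = g z) -> differentiable f y -> differentiable g y.
Proof.
move=> oU Uy fg /diff_locallyP [cdf ef].
have eg : g \o shift y = cst (g y) + 'd f y +o_ 0 id.
  apply/eqaddoP => e e0.
  have := proj1 (eqaddoP _ _ _ _) ef e e0.
  have : \forall z \near (0 : V), U (z + y).
    have : \forall z \near y, U z by exact: (open_nbhs_nbhs (conj oU Uy)).
    by rewrite (near_shift 0); apply: filterS => z /=; rewrite subr0.
  apply: filterS2 => z Uz /=.
  by rewrite !fctE /= (fg y Uy) (fg _ Uz).
have dg : 'd g y = 'd f y :> (V -> W) by exact: diff_unique.
by apply/diff_locallyP; rewrite dg.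
Qed.

Lemma continuous_near_eq U f g y : open U -> U y ->
  (forall z, U z -> f z = g z) -> {for y, continuous f} -> {for y, continuous g}.
Proof.
move=> oU Uy fg cf; have {}cf : f z @[z --> y] --> g y by rewrite -fg.
apply: cvg_trans cf; apply: near_eq_cvg.
by apply: filterS (open_nbhs_nbhs (conj oU Uy)) => z; exact: fg.
Qed.

Lemma derive_scale (k : V -> R) f y v :
  differentiable k y -> differentiable f y ->
  'D_v (fun z => k z *: f z) y = 'D_v k y *: f y + k y *: 'D_v f y.
Proof.
move=> dk df; have H := is_diff_scale dk df.
by rewrite (deriveE v (@ex_diff _ _ _ _ _ _ _ H)) (deriveE v dk) (deriveE v df) diff_val.
Qed.

Lemma differentiable_scale (k : V -> R) f y :
  differentiable k y -> differentiable f y ->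
  differentiable (fun z => k z *: f z) y.
Proof. by move=> dk df; have H := is_diff_scale dk df. Qed.

Lemma differentiable_bigsum (I : Type) (r : seq I) (P : pred I) (f : I -> V -> W) y :
  (forall i, P i -> differentiable (f i) y) ->
  differentiable (fun z => \sum_(i <- r | P i) f i z) y.
Proof.
move=> df; elim: r => [|i r IH].
  rewrite (_ : (fun z => _) = cst 0); first exact: differentiable_cst.
  by apply/funext => z; rewrite big_nil.
rewrite (_ : (fun z => _) = (if P i then f i else cst 0) +
    (fun z => \sum_(j <- r | P j) f j z)); last first.
  by apply/funext => z; rewrite big_cons fctE; case: (P i); rewrite //= add0r.
apply: differentiableD => //; case: ifP => Pi; first exact: df.
exact: differentiable_cst.
Qed.

Lemma derive_bigsum (I : Type) (r : seq I) (P : pred I) (f : I -> V -> W) y v :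
  (forall i, P i -> differentiable (f i) y) ->
  'D_v (fun z => \sum_(i <- r | P i) f i z) y = \sum_(i <- r | P i) 'D_v (f i) y.
Proof.
move=> df; elim: r => [|i r IH].
  rewrite (_ : (fun z => _) = cst 0) ?derive_cst ?big_nil //.
  by apply/funext => z; rewrite big_nil.
have d2 : differentiable (fun z => \sum_(j <- r | P j) f j z) y.
  exact: differentiable_bigsum.
rewrite big_cons -IH; case: ifP => Pi; last first.
  by congr ('D_v _ y); apply/funext => z; rewrite big_cons Pi.
rewrite -deriveD; [|exact: diff_derivable (df i Pi)|exact: diff_derivable].
by congr ('D_v _ y); apply/funext => z; rewrite big_cons Pi.
Qed.

Lemma derive_comp (X : normedModType R) (f : X -> V) (h : V -> W) (y v : X) :
  differentiable f y -> differentiable h (f y) ->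
  'D_v (h \o f) y = 'D_('D_v f y) h (f y).
Proof.
move=> df dh; have dhf := differentiable_comp df dh.
by rewrite (deriveE v dhf) (diff_comp df dh) (deriveE _ dh) (deriveE _ df).
Qed.

Lemma derive_linear (f : {linear V -> W}) y v : continuous f -> 'D_v f y = f v.
Proof.
move=> cf; have df := linear_differentiable y cf.
by rewrite (deriveE v df) (diff_lin y cf).
Qed.

End Pointwise.

(** * Calculus of smooth maps *)

Section CkCalculus.
Variable R : realType.
Implicit Types V W X : normedModType R.

Lemma Ck_onW V W k (U : set V) (f : V -> W) : Ck_on k.+1 U f -> Ck_on k U f.
Proof.
elim: k f => [|k IH] f [df Df]; first by move=> y /df/differentiable_continuous.
by split=> // v; apply: IH; exact: Df.
Qed.

Lemma Ck_on_sub V W k (U U' : set V) (f : V -> W) :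
  U' `<=` U -> Ck_on k U f -> Ck_on k U' f.
Proof.
move=> sU; elim: k f => [|k IH] f /=; first by move=> cf y /sU/cf.
by move=> [df Df]; split=> [y /sU/df //|v]; exact: IH.
Qed.

(** [Ck_on] looks at its set one point at a time, so the induction on the order
    goes through for any set; every gluing argument below rests on this. *)
Lemma Ck_on_local V W k (U : set V) (f : V -> W) :
  (forall y, U y -> exists U', [/\ open U', U' y & Ck_on k U' f]) ->
  Ck_on k U f.
Proof.
elim: k f => [|k IH] f loc.
  by move=> y /loc[U' [_ U'y cf]]; exact: cf.
split=> [y /loc[U' [_ U'y [df _]]]|v]; first exact: df.
by apply: IH => y /loc[U' [oU' U'y [_ Df]]]; exists U'; split=> //; exact: Df.
Qed.

Lemma Ck_on_eq V W k (U : set V) (f g : V -> W) : open U ->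
  (forall y, U y -> f y = g y) -> Ck_on k U f -> Ck_on k U g.
Proof.
move=> oU; elim: k f g => [|k IH] f g fg.
  by move=> cf y Uy; apply: continuous_near_eq oU Uy fg (cf y Uy).
move=> [df Df]; split=> [y Uy|v]; first exact: (differentiable_near_eq oU Uy fg (df y Uy)).
by apply: IH (Df v) => y Uy; exact: derive_near_eq oU Uy fg.
Qed.

Lemma Ck_on_cst V W k (U : set V) (w : W) : Ck_on k U (fun=> w).
Proof.
elim: k w => [|k IH] w; first by move=> y _; exact: cst_continuous.
split=> [y _|v]; first exact: differentiable_cst.
rewrite [X in Ck_on _ _ X](_ : _ = fun=> 0); first exact: IH.
by apply/funext => y; exact: derive_cst.
Qed.

Lemma Ck_on_linear V W k (U : set V) (f : {linear V -> W}) :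
  continuous f -> Ck_on k U f.
Proof.
move=> cf; case: k => [y _|k]; first exact: cf.
split=> [y _|v]; first exact: linear_differentiable.
rewrite [X in Ck_on _ _ X](_ : _ = fun=> f v); first exact: Ck_on_cst.
by apply/funext => y; exact: derive_linear.
Qed.

Lemma Ck_onD V W k (U : set V) (f g : V -> W) : open U ->
  Ck_on k U f -> Ck_on k U g -> Ck_on k U (fun y => f y + g y).
Proof.
move=> oU; elim: k f g => [|k IH] f g.
  by move=> cf cg y Uy; apply: continuousD; [exact: cf|exact: cg].
move=> [df Df] [dg Dg]; split=> [y Uy|v].
  by apply: differentiableD; [exact: df|exact: dg].
apply: (Ck_on_eq oU _ (IH _ _ (Df v) (Dg v))) => y Uy.
rewrite -(@deriveD _ _ _ f g) //; apply: diff_derivable;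
  [exact: df|exact: dg].
Qed.

Lemma Ck_on_sum V W k (U : set V) (I : Type) (r : seq I) (P : pred I)
    (f : I -> V -> W) : open U ->
  (forall i, P i -> Ck_on k U (f i)) ->
  Ck_on k U (fun y => \sum_(i <- r | P i) f i y).
Proof.
move=> oU Cf; elim: r => [|i r IH].
  rewrite (_ : (fun y => _) = fun=> 0); first exact: Ck_on_cst.
  by apply/funext => y; rewrite big_nil.
rewrite (_ : (fun y => _) = fun y =>
    (if P i then f i else fun=> 0) y + \sum_(j <- r | P j) f j y); last first.
  by apply/funext => y; rewrite big_cons; case: (P i) => //; rewrite add0r.
apply: Ck_onD => //; case: ifP => Pi; [exact: Cf|exact: Ck_on_cst].
Qed.

Lemma Ck_onZ V W k (U : set V) (a : V -> R) (f : V -> W) : open U ->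
  Ck_on k U a -> Ck_on k U f -> Ck_on k U (fun y => a y *: f y).
Proof.
move=> oU; elim: k a f => [|k IH] a f.
  by move=> ca cf y Uy; apply: continuousZ; [exact: ca|exact: cf].
move=> Ca Cf; have [[da Da] [df Df]] := (Ca, Cf); split=> [y Uy|v].
  by apply: differentiable_scale; [exact: da|exact: df].
have H : Ck_on k U (fun y => 'D_v a y *: f y + a y *: 'D_v f y).
  apply: (Ck_onD oU); first exact: IH (Da v) (Ck_onW Cf).
  exact: IH (Ck_onW Ca) (Df v).
apply: (Ck_on_eq oU _ H) => y Uy.
by rewrite derive_scale //; [exact: da|exact: df].
Qed.

Lemma Ck_on_lincomp V W X k (U : set V) (L : {linear W -> X}) (f : V -> W) :
  open U -> continuous L -> Ck_on k U f -> Ck_on k U (fun y => L (f y)).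
Proof.
move=> oU cL; elim: k f => [|k IH] f.
  by move=> cf y Uy; apply: continuous_comp; [exact: cf|exact: cL].
move=> [df Df]; split=> [y Uy|v].
  apply: (differentiable_comp (df y Uy)); exact: linear_differentiable.
apply: (Ck_on_eq oU _ (IH _ (Df v))) => y Uy.
rewrite -[RHS]/('D_v (L \o f) y).
rewrite (derive_comp v (df y Uy) (linear_differentiable _ cL)).
by rewrite derive_linear.
Qed.

(** A basis with continuous coordinates. Scalars and row vectors are the two
    instances; the chain rule needs it because [Ck_on] only speaks of derivatives
    in one fixed direction at a time. *)
Definition fin_dim V := exists m (e : 'I_m -> V) (x : 'I_m -> {linear V -> R}),
  (forall k, continuous (x k)) /\ forall v, v = \sum_k x k v *: e k.

Lemma fin_dim_linear_continuous V W (f : {linear V -> W}) :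
  fin_dim V -> continuous f.
Proof.
move=> [m [e [x [cx ex]]]].
have -> : (f : V -> W) = fun v => \sum_k x k v *: f (e k).
  apply/funext => v; rewrite {1}(ex v) linear_sum.
  by apply: eq_bigr => k _; rewrite linearZ.
have H : Ck_on 0%N setT (fun v => \sum_k x k v *: f (e k)).
  apply: (@Ck_on_sum V W 0%N setT _ _ _ (fun k v => x k v *: f (e k)) openT).
  move=> k _; apply: (@Ck_onZ V W 0%N setT (x k) (fun=> f (e k)) openT).
    exact: (Ck_on_linear 0 setT (cx k)).
  exact: (@Ck_on_cst _ _ 0%N).
by move=> v; exact: H.
Qed.

(** The derivative of [h (f y)] is the sum, over a basis [e], of the coordinates of
    the derivative of [f] times the derivatives of [h] along [e i], taken at [f y]:
    these are again of the form covered by the induction hypothesis. *)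
Lemma Ck_on_comp V W X k (U : set V) (U' : set W) (f : V -> W) (h : W -> X) :
  fin_dim W -> open U -> (forall y, U y -> U' (f y)) ->
  Ck_on k U f -> Ck_on k U' h -> Ck_on k U (fun y => h (f y)).
Proof.
move=> [m [e [x [cx ex]]]] oU fU; elim: k h => [|k IH] h.
  move=> cf ch y Uy; apply: continuous_comp; [exact: cf|apply: ch; exact: fU].
move=> Cf [dh Dh]; have [df Df] := Cf; split=> [y Uy|v].
  apply: (differentiable_comp (df y Uy)); apply: dh; exact: fU.
have H : Ck_on k U (fun y => \sum_i x i ('D_v f y) *: 'D_(e i) h (f y)).
  apply: (@Ck_on_sum _ _ _ _ _ _ _
    (fun i y => x i ('D_v f y) *: 'D_(e i) h (f y)) oU) => i _.
  apply: (Ck_onZ oU).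
    by apply: (Ck_on_lincomp oU); [exact: cx|exact: Df].
  by apply: (IH (fun z => 'D_(e i) h z)); [exact: Ck_onW|exact: Dh].
apply: (Ck_on_eq oU _ H) => y Uy.
have dhf : differentiable h (f y) by apply: dh; exact: fU.
rewrite -[RHS]/('D_v (h \o f) y) (derive_comp v (df y Uy) dhf).
rewrite [in RHS](ex ('D_v f y)) (deriveE _ dhf) linear_sum.
by apply: eq_bigr => i _; rewrite linearZ (deriveE _ dhf).
Qed.

End CkCalculus.

Section Smooth.
Variable R : realType.
Implicit Types V W X : normedModType R.

Lemma smooth_differentiable V W (U : set V) (f : V -> W) y :
  smooth_on U f -> U y -> differentiable f y.
Proof. by move=> sf Uy; exact: (proj1 (sf 1%N)). Qed.

Lemma smooth_derive V W (U : set V) (f : V -> W) v :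
  smooth_on U f -> smooth_on U (fun y => 'D_v f y).
Proof. by move=> sf k; exact: (proj2 (sf k.+1)). Qed.

Lemma smooth_sub V W (U U' : set V) (f : V -> W) :
  U' `<=` U -> smooth_on U f -> smooth_on U' f.
Proof. by move=> sU sf k; exact: Ck_on_sub (sf k). Qed.

Lemma smooth_local V W (U : set V) (f : V -> W) :
  (forall y, U y -> exists U', [/\ open U', U' y & smooth_on U' f]) ->
  smooth_on U f.
Proof.
move=> H k; apply: Ck_on_local => y /H[U' [oU U'y sf]].
by exists U'; split=> //; exact: sf.
Qed.

Lemma smooth_eq V W (U : set V) (f g : V -> W) : open U ->
  (forall y, U y -> f y = g y) -> smooth_on U f -> smooth_on U g.
Proof. by move=> oU fg sf k; exact: Ck_on_eq (sf k). Qed.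

Lemma smooth_cst V W (U : set V) (w : W) : smooth_on U (fun=> w).
Proof. by move=> k; exact: Ck_on_cst. Qed.

Lemma smooth_linear V W (U : set V) (f : {linear V -> W}) :
  continuous f -> smooth_on U f.
Proof. by move=> cf k; exact: Ck_on_linear. Qed.

Lemma smooth_id V (U : set V) : smooth_on U (fun y => y).
Proof. by apply: (@smooth_linear _ _ _ idfun) => y; exact: cvg_id. Qed.

Lemma smoothD V W (U : set V) (f g : V -> W) : open U ->
  smooth_on U f -> smooth_on U g -> smooth_on U (fun y => f y + g y).
Proof. by move=> oU sf sg k; exact: Ck_onD. Qed.

Lemma smooth_sum V W (U : set V) (I : Type) (r : seq I) (P : pred I)
    (f : I -> V -> W) : open U ->
  (forall i, P i -> smooth_on U (f i)) ->
  smooth_on U (fun y => \sum_(i <- r | P i) f i y).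
Proof. by move=> oU sf k; apply: Ck_on_sum => // i Pi; exact: sf. Qed.

Lemma smoothZ V W (U : set V) (a : V -> R) (f : V -> W) : open U ->
  smooth_on U a -> smooth_on U f -> smooth_on U (fun y => a y *: f y).
Proof. by move=> oU sa sf k; exact: Ck_onZ. Qed.

Lemma smoothM V (U : set V) (a b : V -> R) : open U ->
  smooth_on U a -> smooth_on U b -> smooth_on U (fun y => a y * b y).
Proof. exact: smoothZ. Qed.

Lemma smoothN V W (U : set V) (f : V -> W) : open U ->
  smooth_on U f -> smooth_on U (fun y => - f y).
Proof.
move=> oU sf; rewrite (_ : (fun y => _) = fun y => (-1 : R) *: f y).
  by apply: smoothZ => //; exact: smooth_cst.
by apply/funext => y; rewrite scaleN1r.
Qed.

Lemma smoothB V W (U : set V) (f g : V -> W) : open U ->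
  smooth_on U f -> smooth_on U g -> smooth_on U (fun y => f y - g y).
Proof. by move=> oU sf sg; apply: smoothD => //; exact: smoothN. Qed.

Lemma smooth_prod V (U : set V) (I : Type) (r : seq I) (P : pred I)
    (f : I -> V -> R) : open U ->
  (forall i, P i -> smooth_on U (f i)) ->
  smooth_on U (fun y => \prod_(i <- r | P i) f i y).
Proof.
move=> oU sf; elim: r => [|i r IH].
  rewrite (_ : (fun y => _) = fun=> 1); first exact: smooth_cst.
  by apply/funext => y; rewrite big_nil.
rewrite (_ : (fun y => _) = fun y =>
    (if P i then f i else fun=> 1) y * \prod_(j <- r | P j) f j y); last first.
  by apply/funext => y; rewrite big_cons; case: (P i) => //; rewrite mul1r.
apply: smoothM => //; case: ifP => Pi; [exact: sf|exact: smooth_cst].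
Qed.

Lemma smooth_comp V W X (U : set V) (U' : set W) (f : V -> W) (h : W -> X) :
  fin_dim W -> open U -> (forall y, U y -> U' (f y)) ->
  smooth_on U f -> smooth_on U' h -> smooth_on U (fun y => h (f y)).
Proof. by move=> fW oU fU sf sh k; exact: (Ck_on_comp fW oU fU). Qed.

(** Changes of components of vector fields have this form, [h] being a transition
    map and [w] the local expression of the field. *)
Lemma smooth_diff V W X (U : set V) (U' : set W)
    (f : V -> W) (h : W -> X) (w : V -> W) :
  fin_dim W -> open U -> (forall y, U y -> U' (f y)) ->
  smooth_on U f -> smooth_on U w -> smooth_on U' h ->
  smooth_on U (fun y => 'd h (f y) (w y)).
Proof.
move=> fW oU fU sf sw sh; have [m [e [x [cx ex]]]] := fW.
have H : smooth_on U (fun y => \sum_i x i (w y) *: 'D_(e i) h (f y)).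
  apply: smooth_sum => // i _; apply: smoothZ => //.
    by move=> k; apply: Ck_on_lincomp => //; exact: cx.
  apply: (@smooth_comp _ _ _ U U' f (fun z => 'D_(e i) h z)) => //.
  exact: smooth_derive.
apply: (smooth_eq oU _ H) => y Uy.
have dh : differentiable h (f y) by apply: smooth_differentiable sh _; exact: fU.
rewrite [in RHS](ex (w y)) linear_sum.
by apply: eq_bigr => i _; rewrite linearZ (deriveE _ dh).
Qed.

Lemma fin_dim_R : fin_dim (R : normedModType R).
Proof.
exists 1%N, (fun=> 1), (fun=> idfun); split=> [k y|v]; first exact: cvg_id.
by rewrite big_ord1 /= [RHS]mulr1.
Qed.

Section RowVectors.
Variable n : nat.

Definition coord_fun (k : 'I_n) (v : 'rV[R]_n) : R := v 0 k.

Lemma coord_fun_linear k : linear_for ( *%R ) (coord_fun k).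
Proof. by move=> a v w; rewrite /coord_fun !mxE. Qed.
HB.instance Definition _ k := GRing.isLinear.Build R 'rV[R]_n R *%R
  (coord_fun k) (coord_fun_linear k).

Lemma coord_fun_continuous k : continuous (coord_fun k).
Proof. exact: coord_continuous. Qed.

Lemma fin_dim_rV : fin_dim ('rV[R]_n : normedModType R).
Proof.
exists n, (fun k => delta_mx 0 k), (fun k => (coord_fun k : {linear _ -> _})).
split; first exact: coord_fun_continuous.
by move=> v; rewrite {1}(row_sum_delta v).
Qed.

End RowVectors.
End Smooth.

(** * Bump functions *)

Section FlatExp.
Variable R : realType.

(** The functions [p (1/x) exp (- 1/x)], continued by [0], form a family which is
    stable under derivation: smoothness of all of them follows by induction. *)
Definition flat (p : {poly R}) (x : R) : R :=
  if 0 < x then p.[x^-1] * expR (- x^-1) else 0.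

(** This is [1 + s/m <= exp (s/m)], raised to the power [m]. *)
Lemma expR_ge_pow (m : nat) (s : R) : 0 < s ->
  s ^+ m * expR (- s) <= m%:R ^+ m.
Proof.
move=> s0; case: m => [|m].
  by rewrite !expr0 mul1r -expR0 ler_expR oppr_le0 ltW.
rewrite expRN ler_pdivrMr ?expR_gt0 //.
have -> : expR s = expR (s / m.+1%:R) ^+ m.+1.
  by rewrite -expRM_natl mulrC divfK // pnatr_eq0.
rewrite -exprMn ler_pXn2r //; last 2 first.
- by rewrite nnegrE ltW.
- by rewrite nnegrE mulr_ge0 // expR_ge0.
rewrite -ler_pdivrMl ?ltr0n // mulrC.
by apply: le_trans (expR_ge1Dx _); rewrite lerDr.
Qed.

(** The extra factor [1/x] is absorbed by applying [expR_ge_pow] with the exponent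
    [i + 1] to the monomial of degree [i]. The bound for ['X * p] is what makes the
    difference quotient of [flat p] at [0] tend to [0]. *)
Lemma flat_bound (p : {poly R}) : exists C : R, forall h, `|flat p h| <= C * `|h|.
Proof.
exists (\sum_(i < size p) `|p`_i| * i.+1%:R ^+ i.+1) => h.
rewrite /flat; case: ifPn => h0; last first.
  rewrite normr0; apply: mulr_ge0 => //; apply: sumr_ge0 => i _.
  by apply: mulr_ge0 => //; exact: exprn_ge0.
rewrite horner_coef mulr_suml (le_trans (ler_norm_sum _ _ _)) // mulr_suml.
apply: ler_sum => i _; rewrite -mulrA normrM -mulrA ler_wpM2l //.
have s0 : 0 < h^-1 by rewrite invr_gt0.
rewrite ger0_norm ?mulr_ge0 ?expR_ge0 ?exprn_ge0 ?(ltW s0) //.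
rewrite gtr0_norm // -ler_pdivrMr // mulrAC -exprSr.
exact: expR_ge_pow.
Qed.

Lemma flat_gt0_derive (p : {poly R}) (x : R) : 0 < x ->
  is_derive x 1 (flat p) (flat ('X^2 * (p - p^`())) x).
Proof.
move=> x0.
have xn0 : x != 0 by rewrite gt_eqF.
pose f y : R := p.[y^-1] * expR (- y^-1).
have : is_derive x 1 f (flat ('X^2 * (p - p^`())) x).
  have dV : is_derive x 1 (fun y : R => y^-1) (- x^-2).
    have dv : derivable (fun y : R => y^-1) x 1.
      exact: (@derivableV _ _ id x 1 xn0 (@derivable_id _ _ _ _)).
    apply: DeriveDef => //.
    by rewrite (@deriveV _ _ id x 1) // derive_id [LHS]mulr1.
  have dP : is_derive x 1 (fun y => p.[y^-1]) (p^`().[x^-1] * (- x^-2)).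
    exact: (is_derive1_comp (is_derive_poly p x^-1) dV).
  have dE : is_derive x 1 (fun y : R => expR (- y^-1)) (expR (- x^-1) * x^-2).
    have dN : is_derive x 1 (fun y : R => - y^-1) (x^-2).
      by have H := is_deriveN dV; rewrite opprK in H.
    exact: (@is_derive1_comp _ expR (fun y : R => - y^-1) x _ _
      (is_derive_expR (- x^-1)) dN).
  rewrite (_ : flat _ x = p.[x^-1] *: (expR (- x^-1) * x^-2)
      + expR (- x^-1) *: (p^`().[x^-1] * (- x^-2))); first exact: is_deriveM dP dE.
  rewrite /flat x0 !hornerE /= /GRing.scale /= exprVn.
  ring.
apply: near_eq_is_derive.
near=> y; rewrite /flat ifT //; near: y.
exact: lt_nbhsr.
Unshelve. all: by end_near. Qed.

Lemma flat_derive (p : {poly R}) (x : R) :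
  is_derive x 1 (flat p) (flat ('X^2 * (p - p^`())) x).
Proof.
have [x0|x0|->] := ltgtP x 0; [|exact: flat_gt0_derive|].
  have -> : flat ('X^2 * (p - p^`())) x = 0 by rewrite /flat ifF // ltNge ltW.
  apply: (@near_eq_is_derive _ _ _ (cst 0)).
  near=> y; rewrite /flat ifF //; apply/negbTE; rewrite -leNgt ltW //.
  by near: y; exact: lt_nbhsl.
have f0 q : flat q 0 = 0 by rewrite /flat ltxx.
rewrite f0.
have [C HC] := flat_bound ('X * p).
have id0 : h @[h --> (0 : R)^'] --> (0 : R) by exact: cvg_within.
have nC : C * `|h| @[h --> (0 : R)^'] --> (0 : R).
  have := cvgM (cvg_cst (C : R)) (cvg_norm id0).
  by rewrite normr0 mulr0; apply.
have cv : h^-1 *: (flat p (h *: 1 + 0) - flat p 0) @[h --> 0^'] --> (0 : R).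
  apply: (@squeeze_cvgr _ _ _ _ (fun h => - (C * `|h|)) (fun h => C * `|h|)).
  - near=> h; have hn0 : h != 0 by near: h; exact: nbhs_dnbhs_neq.
    rewrite -ler_norml f0 subr0 addr0 [h *: 1]mulr1.
    have -> : h^-1 *: flat p h = flat ('X * p) h.
      rewrite /flat; case: ifP => _; last exact: mulr0.
      by rewrite hornerM hornerX; exact: mulrA.
    exact: HC.
  - by have := cvgN nC; rewrite oppr0; apply.
  - exact: nC.
by apply: DeriveDef; [apply/cvg_ex; exists 0|exact: cvg_lim].
Unshelve. all: by end_near. Qed.

Lemma flat_smooth (p : {poly R}) (U : set R) : smooth_on U (flat p).
Proof.
have df q x : differentiable (flat q) x.
  by apply/derivable1_diffP; have [] := flat_derive q x.
move=> k; apply: (@Ck_on_sub _ _ _ k setT) => //; elim: k p => [|k IH] p.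
  by move=> y _; exact: differentiable_continuous.
split=> [y _|v]; first exact: df.
have -> : (fun y => 'D_v (flat p) y) = fun y => v *: flat ('X^2 * (p - p^`())) y.
  apply/funext => y; rewrite (deriveE _ (df p y)) -[v in LHS]mulr1.
  rewrite -[v * 1]/(v *: 1) linearZ -(deriveE _ (df p y)).
  by have [_ ->] := flat_derive p y.
exact: (Ck_onZ openT (Ck_on_cst _ _ _) (IH _)).
Qed.

End FlatExp.

Section Bump.
Variable R : realType.

(** A step from [1], on [x <= 1], to [0], on [x >= 2]: the argument of the outer
    [flat 1] is exactly [1] as long as [x - 1 <= 0], and has become negative or zero
    once [flat 1 (x - 1)] has reached [flat 1 1]. *)
Definition smooth_step (x : R) : R :=
  (flat 1 1)^-1 * flat 1 (1 - (flat 1 1)^-1 * flat 1 (x - 1)).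

Lemma flat1E (x : R) : 0 < x -> flat 1 x = expR (- x^-1).
Proof. by move=> x0; rewrite /flat x0 hornerC mul1r. Qed.

Lemma flat_npos p (x : R) : x <= 0 -> flat p x = 0.
Proof. by move=> x0; rewrite /flat ifF // ltNge x0. Qed.

Lemma smooth_step1 x : x <= 1 -> smooth_step x = 1.
Proof.
move=> x1; rewrite /smooth_step (@flat_npos _ (x - 1)) ?subr_le0 //.
by rewrite mulr0 subr0 mulVf // flat1E // gt_eqF // expR_gt0.
Qed.

Lemma smooth_step0 x : 2 <= x -> smooth_step x = 0.
Proof.
move=> x2; rewrite /smooth_step [X in _ * X]flat_npos ?mulr0 //.
have e1 : 0 < flat 1 (1 : R) by rewrite flat1E // expR_gt0.
rewrite subr_le0 -ler_pdivrMl ?invr_gt0 // invrK mulr1.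
have x1 : 1 <= x - 1 by rewrite lerBrDr.
rewrite !flat1E // ?ler_expR ?lerN2 ?lef_pV2 ?posrE //; exact: lt_le_trans x1.
Qed.

Lemma smooth_step_smooth (U : set R) : smooth_on U smooth_step.
Proof.
apply: (@smooth_sub _ _ _ setT) => //.
have sub1 (a : R) : smooth_on setT (fun x : R => x - a).
  apply: smoothD openT _ _; [exact: smooth_id|exact: smooth_cst].
apply: (smoothM openT); first exact: smooth_cst.
apply: (@smooth_comp _ _ _ _ setT setT (fun x : R => 1 - (flat 1 1)^-1 * flat 1 (x - 1))
  (flat 1) (fin_dim_R R) openT) => //; last exact: flat_smooth.
apply: (smoothB openT); first exact: smooth_cst.
apply: (smoothM openT); first exact: smooth_cst.
exact: (@smooth_comp _ _ _ _ setT setT (fun x : R => x - 1)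
  (flat 1) (fin_dim_R R) openT) (sub1 1) (flat_smooth _ _).
Qed.

(** Since the norm is the maximum of the coordinates, a product of one-variable steps
    is enough; squaring the coordinates keeps the factors smooth, and [2 * r] leaves
    room because the square of [2] exceeds [2]. *)
Lemma exists_bump n (p : 'rV[R]_n) (r : R) : 0 < r ->
  exists rho : 'rV[R]_n -> R, [/\ smooth_on setT rho,
    forall y, `|y - p| < r -> rho y = 1
  & forall y, ~~ (`|y - p| <= 2 * r) -> rho y = 0].
Proof.
move=> r0.
pose c (k : 'I_n) (y : 'rV[R]_n) : R := r^-2 * ((y - p) 0 k * (y - p) 0 k).
exists (fun y => \prod_k smooth_step (c k y)); split.
- have sc k : smooth_on setT (fun y : 'rV[R]_n => (y - p) 0 k).
    apply: (@smooth_comp _ _ _ _ setT setT (fun y => y - p) (coord_fun k)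
      (fin_dim_rV R n) openT) => //.
      by apply: (smoothB openT); [exact: smooth_id|exact: smooth_cst].
    by apply: smooth_linear; exact: coord_fun_continuous.
  apply: (@smooth_prod _ _ setT _ _ _ (fun k y => smooth_step (c k y)) openT) => k _.
  apply: (@smooth_comp _ _ _ _ setT setT (c k) smooth_step
      (fin_dim_R R) openT) => //; last exact: smooth_step_smooth.
  apply: (smoothM openT); first exact: smooth_cst.
  by apply: (smoothM openT).
- move=> y yp; apply: big1 => k _; apply: smooth_step1.
  have yk : `|(y - p) 0 k| <= r.
    apply: le_trans (ltW yp); rewrite [leRHS]/Num.Def.normr/= mx_normrE.
    exact: (le_bigmax _ (fun ij : 'I_1 * 'I_n => `|(y - p) ij.1 ij.2|) (0, k)).
  rewrite /c -ler_pdivlMl ?invr_gt0 ?exprn_gt0 // invrK mulr1 -expr2.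
  by rewrite -real_normK ?num_real // lerXn2r ?nnegrE ?(ltW r0).
- move=> y; rewrite [in X in ~~ X]/Num.Def.normr/= mx_normrE.
  rewrite -ltNge => /bigmax_gtP[|[[i k] _ /= yk]].
    by rewrite ltNge mulr_ge0 // ltW.
  rewrite (bigD1 k) //= smooth_step0 ?mul0r //.
  rewrite ord1 in yk.
  rewrite /c -ler_pdivrMl ?invr_gt0 ?exprn_gt0 // invrK -expr2.
  rewrite -[leRHS]real_normK ?num_real //.
  have : (2 * r) ^+ 2 <= `|(y - p) 0 k| ^+ 2.
    by rewrite lerXn2r ?nnegrE ?mulr_ge0 ?(ltW r0) ?(ltW yk).
  by apply: le_trans; rewrite exprMn mulrC ler_wpM2r ?sqr_ge0 //; lra.
Qed.

End Bump.

(** * Maps into a product of row vector spaces *)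

Section RowMx.
Variables (R : realType) (m n : nat).

Definition row_mx_l (v : 'rV[R]_m) : 'rV[R]_(m + n) := row_mx v 0.
Definition row_mx_r (v : 'rV[R]_n) : 'rV[R]_(m + n) := row_mx 0 v.

Lemma row_mx_l_linear : linear row_mx_l.
Proof. by move=> a v w; rewrite /row_mx_l scale_row_mx add_row_mx scaler0 addr0. Qed.
Lemma row_mx_r_linear : linear row_mx_r.
Proof. by move=> a v w; rewrite /row_mx_r scale_row_mx add_row_mx scaler0 addr0. Qed.
HB.instance Definition _ := GRing.isLinear.Build R _ _ _ row_mx_l row_mx_l_linear.
HB.instance Definition _ := GRing.isLinear.Build R _ _ _ row_mx_r row_mx_r_linear.

Lemma row_mxE2 (v : 'rV[R]_m) (w : 'rV[R]_n) : row_mx v w = row_mx_l v + row_mx_r w.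
Proof. by rewrite /row_mx_l /row_mx_r add_row_mx addr0 add0r. Qed.

Lemma row_mx_l_cont : continuous row_mx_l.
Proof. exact: fin_dim_linear_continuous (fin_dim_rV R m). Qed.
Lemma row_mx_r_cont : continuous row_mx_r.
Proof. exact: fin_dim_linear_continuous (fin_dim_rV R n). Qed.

Variable V : normedModType R.
Variables (f : V -> 'rV[R]_m) (g : V -> 'rV[R]_n).

Lemma row_mx_fun : (fun y => row_mx (f y) (g y))
  = (row_mx_l \o f) + (row_mx_r \o g).
Proof. by apply/funext => y; rewrite row_mxE2. Qed.

Lemma smooth_row_mx (U : set V) : open U -> smooth_on U f -> smooth_on U g ->
  smooth_on U (fun y => row_mx (f y) (g y)).
Proof.
move=> oU sf sg; rewrite row_mx_fun; apply: (smoothD oU) => k.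
  by apply: (@Ck_on_lincomp _ _ _ _ k U row_mx_l f oU) => //; exact: row_mx_l_cont.
by apply: (@Ck_on_lincomp _ _ _ _ k U row_mx_r g oU) => //; exact: row_mx_r_cont.
Qed.

Lemma differentiable_row_mx y : differentiable f y -> differentiable g y ->
  differentiable (fun y => row_mx (f y) (g y)) y.
Proof.
move=> df dg; rewrite row_mx_fun; apply: differentiableD.
  by apply: (differentiable_comp df); apply: linear_differentiable; exact: row_mx_l_cont.
by apply: (differentiable_comp dg); apply: linear_differentiable; exact: row_mx_r_cont.
Qed.

Lemma derive_row_mx y v : differentiable f y -> differentiable g y ->
  'D_v (fun y => row_mx (f y) (g y)) y = row_mx ('D_v f y) ('D_v g y).
Proof.
move=> df dg; rewrite row_mx_fun.
have dl x : differentiable row_mx_l x.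
  by apply: linear_differentiable; exact: row_mx_l_cont.
have dr x : differentiable row_mx_r x.
  by apply: linear_differentiable; exact: row_mx_r_cont.
have d1 : differentiable (row_mx_l \o f) y by exact: differentiable_comp.
have d2 : differentiable (row_mx_r \o g) y by exact: differentiable_comp.
rewrite deriveD; [|exact: diff_derivable|exact: diff_derivable].
rewrite (derive_comp v df (dl _)) (derive_comp v dg (dr _)).
rewrite (derive_linear _ _ row_mx_l_cont) (derive_linear _ _ row_mx_r_cont).
by rewrite row_mxE2.
Qed.

End RowMx.

(** * Symmetry of second derivatives *)

Section Schwarz.
Variables (R : realType) (V : normedModType R).

Lemma is_derive_line (W : normedModType R) (h : V -> W) (c v : V) (a : R) :
  differentiable h (c + a *: v) ->
  is_derive a 1 (fun b : R => h (c + b *: v)) ('D_v h (c + a *: v)).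
Proof.
move=> dh.
pose l (b : R) : V := c + b *: v.
have dl : is_diff a l (fun b => b *: v).
  have H := is_diffD (is_diff_cst c a) (is_diff_scalel a v).
  by apply: is_diff_eq H _; apply/funext => b; rewrite fctE add0r.
have dla : differentiable l a by [].
apply: DeriveDef; first exact/diff_derivable/(differentiable_comp dla).
rewrite -[LHS]/('D_1 (h \o l) a) (derive_comp _ dla dh) (deriveE _ dla) diff_val.
by rewrite scale1r.
Qed.

(** The mean value theorem is applied once along [v], to the difference of two
    parallel segments, and once along [w]. *)
Lemma second_difference (U : set V) (f : V -> R) (y v w : V) :
  (forall z, U z -> differentiable f z) ->
  (forall z, U z -> differentiable (fun z => 'D_v f z) z) ->
  nbhs y U ->
  exists2 s0 : R, 0 < s0 & forall s, 0 < s < s0 -> exists2 z, U z &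
    f (y + s *: v + s *: w) - f (y + s *: v) - f (y + s *: w) + f y
    = s ^+ 2 * 'D_w (fun z => 'D_v f z) z.
Proof.
move=> df dDf /nbhs_ballP[e /= e0 eU].
have d0 : 0 < `|v| + `|w| + 1 by rewrite ltr_wpDl ?addr_ge0.
exists (e / (`|v| + `|w| + 1)); first by rewrite divr_gt0.
move=> s /andP[s0 se].
have Uz a b : 0 <= a <= s -> 0 <= b <= s -> U (y + a *: v + b *: w).
  move=> /andP[a0 as_] /andP[b0 bs]; apply: eU.
  rewrite -ball_normE /= -addrA opprD addNKr normrN.
  apply: le_lt_trans (ler_normD _ _) _; rewrite !normrZ !ger0_norm //.
  rewrite ltr_pdivlMr // in se; apply: le_lt_trans se.
  rewrite mulrDr mulrDr mulr1 -[leLHS]addr0.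
  by rewrite !lerD ?ler_wpM2r // ltW.
pose phi a := f (y + s *: w + a *: v) - f (y + a *: v).
have U1 a : 0 <= a <= s -> U (y + s *: w + a *: v).
  by move=> ha; rewrite addrAC; apply: Uz => //; rewrite lexx ltW.
have U2 a : 0 <= a <= s -> U (y + a *: v).
  by move=> ha; rewrite -[y + _]addr0 -(scale0r w); apply: Uz => //; rewrite lexx ltW.
have dphi a : 0 <= a <= s -> is_derive a 1 phi
    ('D_v f (y + s *: w + a *: v) - 'D_v f (y + a *: v)).
  move=> ha; apply: is_deriveB; apply: is_derive_line; apply: df;
    [exact: U1|exact: U2].
have itvW (a b c : R) : a \in `]b, c[%R -> b <= a <= c.
  by rewrite in_itv /= => /andP[/ltW -> /ltW ->].
have [||a ain Ha] := @MVT _ phi (fun a => 'D_v f (y + s *: w + a *: v) - 'D_v f (y + a *: v)) 0 s s0.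
- by move=> a /itvW; exact: dphi.
- apply: derivable_within_continuous => a; rewrite in_itv /= => ha.
  by have [] := dphi a ha.
have has := itvW _ _ _ ain.
pose chi b := 'D_v f (y + a *: v + b *: w).
have dchi b : 0 <= b <= s ->
    is_derive b 1 chi ('D_w (fun z => 'D_v f z) (y + a *: v + b *: w)).
  by move=> hb; apply: (@is_derive_line _ (fun z => 'D_v f z)); apply: dDf; exact: Uz.
have [||b bin Hb] := @MVT _ chi (fun b => 'D_w (fun z => 'D_v f z) (y + a *: v + b *: w)) 0 s s0.
- by move=> b /itvW; exact: dchi.
- apply: derivable_within_continuous => b; rewrite in_itv /= => hb.
  by have [] := dchi b hb.
exists (y + a *: v + b *: w); first exact: Uz (itvW _ _ _ bin).
move: Ha Hb; rewrite /phi /chi !scale0r !addr0 subr0 => Ha Hb.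
rewrite [y + s *: w + a *: v]addrAC Hb [y + s *: w + s *: v]addrAC in Ha.
transitivity ('D_w (fun z => 'D_v f z) (y + a *: v + b *: w) * s * s); last by ring.
by rewrite -Ha; ring.
Qed.

(** The second difference is symmetric in the two directions, hence equals
    [s ^+ 2] times either mixed derivative, at points which tend to [y] with [s]. *)
Lemma derive_comm (U : set V) (f : V -> R) (y v w : V) : open U -> U y ->
  smooth_on U f ->
  'D_w (fun z => 'D_v f z) y = 'D_v (fun z => 'D_w f z) y.
Proof.
move=> oU Uy sf.
have dD a z : U z -> differentiable (fun z => 'D_a f z) z.
  exact: smooth_differentiable (smooth_derive a sf).
have df z : U z -> differentiable f z by exact: smooth_differentiable.
have swap (a b b' d p q : R) : a - b - b' + d = p -> a - b' - b + d = q -> p = q.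
  by move=> <- <-; ring.
have close (a b p q e : R) : `|a - p| < e / 2 -> `|b - q| < e / 2 -> p = q ->
    `|a - b| <= e.
  move=> ap bq pq; rewrite -(subrK p a) -addrA [leRHS]splitr.
  apply: le_trans (ler_normD _ _) _; apply: lerD; first exact: ltW.
  by rewrite pq distrC ltW.
apply/eqP; rewrite -subr_eq0 -normr_le0; apply/ler_addgt0Pr => e e0.
rewrite add0r.
have near_eps a b : \forall z \near y, U z /\
    `|'D_b (fun z => 'D_a f z) y - 'D_b (fun z => 'D_a f z) z| < e / 2.
  have cD : {for y, continuous (fun z => 'D_b (fun z => 'D_a f z) z)}.
    exact: (smooth_derive b (smooth_derive a sf) 0%N).
  have e2 : 0 < e / 2 by rewrite divr_gt0.
  by move/cvgrPdist_lt: cD => /(_ _ e2); apply: filterS2 (open_nbhs_nbhs (conj oU Uy)).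
have [s1 s10 H1] := second_difference w (fun z (h : _ /\ _) => df z h.1)
  (fun z (h : _ /\ _) => dD v z h.1) (near_eps v w).
have [s2 s20 H2] := second_difference v (fun z (h : _ /\ _) => df z h.1)
  (fun z (h : _ /\ _) => dD w z h.1) (near_eps w v).
(* a step for which both expressions of the second difference are available *)
pose s := Num.min s1 s2 / 2.
have m0 : 0 < Num.min s1 s2 by rewrite lt_min s10.
have s0 : 0 < s by rewrite divr_gt0.
have sm : s < Num.min s1 s2 by rewrite /s ltr_pdivrMr // ltr_pMr // ltr1n.
have [|z [_ zv] Hz] := H1 s; first by rewrite s0 (lt_le_trans sm) // ge_min lexx.
have [|z' [_ zw] Hz'] := H2 s.
  by rewrite s0 (lt_le_trans sm) // ge_min lexx orbT.
have E : 'D_w (fun z => 'D_v f z) z = 'D_v (fun z => 'D_w f z) z'.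
  apply: (@mulfI _ (s ^+ 2)); first by rewrite expf_neq0 // gt_eqF.
  rewrite [y + s *: w + s *: v]addrAC in Hz'; exact: swap Hz Hz'.
exact: close zv zw E.
Qed.

End Schwarz.

Section CoordDerive.
Variables (R : realType) (V : normedModType R) (n : nat).

Lemma derive_coord (f : V -> 'rV[R]_n) (y v : V) k : differentiable f y ->
  ('D_v f y) 0 k = 'D_v (fun z => f z 0 k) y.
Proof.
move=> df; rewrite -[RHS]/('D_v (coord_fun k \o f) y).
have dc : differentiable (coord_fun k : 'rV[R]_n -> R) (f y).
  by apply: linear_differentiable; exact: coord_fun_continuous.
by rewrite (derive_comp v df dc) derive_linear //; exact: coord_fun_continuous.
Qed.

Lemma smooth_coord (U : set V) (f : V -> 'rV[R]_n) k : open U ->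
  smooth_on U f -> smooth_on U (fun z => f z 0 k).
Proof.
move=> oU sf j.
apply: (@Ck_on_lincomp _ _ _ _ j U (coord_fun k) f oU) => //.
exact: coord_fun_continuous.
Qed.

Lemma derive_comm_rV (U : set V) (f : V -> 'rV[R]_n) (y v w : V) :
  open U -> U y -> smooth_on U f ->
  'D_w (fun z => 'D_v f z) y = 'D_v (fun z => 'D_w f z) y.
Proof.
move=> oU Uy sf; apply/rowP => k.
have df z : U z -> differentiable f z by exact: smooth_differentiable.
have dv := smooth_differentiable (smooth_derive v sf) Uy.
have dw := smooth_differentiable (smooth_derive w sf) Uy.
pose fk z := f z 0 k.
have Dk a z : U z -> ('D_a f z) 0 k = 'D_a fk z.
  by move=> Uz; exact: derive_coord (df z Uz).
transitivity ('D_w (fun z => ('D_v f z) 0 k) y); first exact: derive_coord dv.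
transitivity ('D_w (fun z => 'D_v fk z) y).
  by apply: derive_near_eq oU Uy _ => z; exact: Dk.
transitivity ('D_v (fun z => 'D_w fk z) y).
  by apply: (derive_comm v w oU Uy); exact: smooth_coord.
transitivity ('D_v (fun z => ('D_w f z) 0 k) y); last exact: (esym (derive_coord v k dw)).
by apply: derive_near_eq oU Uy _ => z Uz; rewrite -Dk.
Qed.

End CoordDerive.

(** * Charts and changes of components *)

Section Charts.
Variables (R : realType) (n : nat) (M : topologicalType) (A : atlas R n M).
Hypothesis hM : smooth_manifold A.
Implicit Types (i j k : idx A) (z x : M) (v w : 'rV[R]_n).

Local Notation dom := (@chart_dom R n M A).
Local Notation im i := (chart i @` dom i).

Lemma dom_at z : dom (at_pt A z) z. Proof. by case: hM. Qed.

Lemma dom_open i : open (dom i).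
Proof. by case: hM => _ _ _ /(_ i)[]. Qed.

Lemma chart_inj i : set_inj (dom i) (chart i).
Proof. by case: hM => _ _ _ /(_ i)[]. Qed.

Lemma chart_open i (S : set M) : open S -> S `<=` dom i -> open (chart i @` S).
Proof. by move=> oS Sd; case: hM => _ _ _ /(_ i)[_ _ /(_ S Sd)[H _]] _; exact: H. Qed.

Lemma im_open i : open (im i).
Proof. by apply: chart_open => //; exact: dom_open. Qed.

Lemma overlap_open i j : open (chart i @` (dom i `&` dom j)).
Proof. by apply: chart_open; [apply: openI; exact: dom_open|move=> z []]. Qed.

Lemma loc_chart (W : normedModType R) i (f : M -> W) z :
  dom i z -> loc i f (chart i z) = f z.
Proof.
move=> iz; rewrite /loc.
have := @xgetPex _ 0 [set w | exists x, [/\ dom i x, chart i x = chart i z & f x = w]].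
case; first by exists (f z), z.
move=> x [ix xz <-]; congr (f _).
by apply: (@chart_inj i) xz; rewrite inE.
Qed.

Definition trans i j : 'rV[R]_n -> 'rV[R]_n := loc i (chart j).

Lemma trans_chart i j z : dom i z -> trans i j (chart i z) = chart j z.
Proof. exact: loc_chart. Qed.

Lemma trans_smooth i j : smooth_on (chart i @` (dom i `&` dom j)) (trans i j).
Proof. by case: hM. Qed.

Lemma trans_diff i j z : dom i z -> dom j z -> differentiable (trans i j) (chart i z).
Proof.
move=> iz jz; apply: (smooth_differentiable (@trans_smooth i j)).
by exists z.
Qed.

(** Change of components of tangent vectors at [z], from the chart [i] to the
    chart [j]. *)
Definition dtrans i j z : 'rV[R]_n -> 'rV[R]_n := 'd (trans i j) (chart i z).

Lemma dtrans_linear i j z : linear (dtrans i j z).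
Proof. by move=> a v w; rewrite /dtrans linearP. Qed.
HB.instance Definition _ i j z := GRing.isLinear.Build R _ _ _
  (dtrans i j z) (@dtrans_linear i j z).

Lemma dtransE i j z v : dom i z -> dom j z ->
  dtrans i j z v = 'D_v (trans i j) (chart i z).
Proof. by move=> iz jz; exact: (esym (deriveE v (trans_diff iz jz))). Qed.

Lemma loc_trans (W : normedModType R) i j (f : M -> W) y :
  (chart i @` (dom i `&` dom j)) y -> loc i f y = loc j f (trans i j y).
Proof. by move=> [z [iz jz] <-]; rewrite trans_chart // !loc_chart. Qed.

Lemma derive_loc (W : normedModType R) i j (f : M -> W) z v :
  dom i z -> dom j z -> differentiable (loc j f) (chart j z) ->
  'D_v (loc i f) (chart i z) = 'D_(dtrans i j z v) (loc j f) (chart j z).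
Proof.
move=> iz jz df; have tz := trans_chart j iz.
have Uz : (chart i @` (dom i `&` dom j)) (chart i z) by exists z.
rewrite (derive_near_eq v (@overlap_open i j) Uz (@loc_trans W i j f)).
have dt := trans_diff iz jz.
rewrite -tz in df *.
by rewrite (derive_comp v dt df) (deriveE v dt).
Qed.

Lemma dtrans_comp i j k z v : dom i z -> dom j z -> dom k z ->
  dtrans j k z (dtrans i j z v) = dtrans i k z v.
Proof.
move=> iz jz kz; have dk := trans_diff jz kz.
rewrite (dtransE v iz kz) (dtransE _ jz kz).
exact: (esym (derive_loc v iz jz dk)).
Qed.

Lemma dtrans_id i z v : dom i z -> dtrans i i z v = v.
Proof.
move=> iz; rewrite (dtransE v iz iz).
transitivity ('D_v (fun y : 'rV[R]_n => y) (chart i z)).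
  apply: (derive_near_eq v (@im_open i)); first by exists z.
  by move=> y [x ix <-]; rewrite trans_chart.
exact: derive_id.
Qed.

Lemma tcoordE i z v : tcoord i z v = dtrans (at_pt A z) i z v.
Proof. by []. Qed.

Lemma tcoord_linear i z : linear (tcoord i z).
Proof. by move=> a v w; rewrite !tcoordE linearP. Qed.
HB.instance Definition _ i z := GRing.isLinear.Build R _ _ _
  (tcoord i z) (@tcoord_linear i z).

(** The tangent vector whose components in the chart [i] are given: the inverse of
    [tcoord i z]. *)
Definition tvec i z : 'rV[R]_n -> 'rV[R]_n := dtrans i (at_pt A z) z.

Lemma tvec_linear i z : linear (tvec i z).
Proof. by move=> a v w; rewrite /tvec linearP. Qed.
HB.instance Definition _ i z := GRing.isLinear.Build R _ _ _
  (tvec i z) (@tvec_linear i z).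

Lemma tcoord_at z v : tcoord (at_pt A z) z v = v.
Proof. by rewrite tcoordE dtrans_id //; exact: dom_at. Qed.

Lemma dtrans_tcoord i j z v : dom i z -> dom j z ->
  dtrans i j z (tcoord i z v) = tcoord j z v.
Proof. by move=> iz jz; rewrite !tcoordE dtrans_comp //; exact: dom_at. Qed.

Lemma tcoord_tvec i j z v : dom i z -> dom j z ->
  tcoord j z (tvec i z v) = dtrans i j z v.
Proof. by move=> iz jz; rewrite tcoordE dtrans_comp //; exact: dom_at. Qed.

Lemma tvecK i z v : dom i z -> tcoord i z (tvec i z v) = v.
Proof. by move=> iz; rewrite tcoord_tvec // dtrans_id. Qed.

Lemma tcoordK i z v : dom i z -> tvec i z (tcoord i z v) = v.
Proof. by move=> iz; rewrite /tvec dtrans_tcoord ?tcoord_at //; exact: dom_at. Qed.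

Lemma tcoord_inj i z : dom i z -> injective (tcoord i z).
Proof. by move=> iz; apply: can_inj (tvec i z) _ => v; exact: tcoordK. Qed.

Lemma vderivE i z v (f : M -> R) : dom i z ->
  differentiable (loc i f) (chart i z) ->
  vderiv A z v f = 'D_(tcoord i z v) (loc i f) (chart i z).
Proof. by move=> iz df; rewrite /vderiv (derive_loc v (@dom_at z) iz df). Qed.

Lemma smooth_fun_diff i z (f : M -> R) : smooth_fun A f -> dom i z ->
  differentiable (loc i f) (chart i z).
Proof. by move=> sf iz; apply: (smooth_differentiable (sf i)); exists z. Qed.

(** Components of [X] in the chart [i], as a function of the coordinates. *)
Definition vloc i (X : vfield R n M) : 'rV[R]_n -> 'rV[R]_n :=
  loc i (fun z => tcoord i z (X z)).

Lemma vloc_chart i X z : dom i z -> vloc i X (chart i z) = tcoord i z (X z).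
Proof. exact: loc_chart. Qed.

Lemma vloc_at X z : vloc (at_pt A z) X (chart (at_pt A z) z) = X z.
Proof. by rewrite vloc_chart ?tcoord_at //; exact: dom_at. Qed.

Lemma vloc_diff i z X : smooth_vfield A X -> dom i z ->
  differentiable (vloc i X) (chart i z).
Proof. by move=> sf iz; apply: (smooth_differentiable (sf i)); exists z. Qed.

Lemma vderiv_vloc i z (X : vfield R n M) (f : M -> R) : smooth_fun A f -> dom i z ->
  vderiv A z (X z) f = 'D_(vloc i X (chart i z)) (loc i f) (chart i z).
Proof. by move=> sf iz; rewrite (vderivE _ iz) ?vloc_chart //; exact: smooth_fun_diff. Qed.

(** Smoothness on the image of a chart may be checked near each point of [M]. *)
Lemma smooth_im_local (W : normedModType R) i (f : 'rV[R]_n -> W) :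
  (forall z, dom i z -> exists S : set M, [/\ open S, S z, S `<=` dom i &
     smooth_on (chart i @` S) f]) -> smooth_on (im i) f.
Proof.
move=> H; apply: smooth_local => _ [z iz <-].
have [S [oS Sz Si sf]] := H z iz.
by exists (chart i @` S); split; [exact: chart_open|exists z|exact: sf].
Qed.

(** * Smooth functions and fields *)

Lemma smooth_funZ_vfield f X : smooth_fun A f -> smooth_vfield A X ->
  smooth_vfield A (fun z => f z *: X z).
Proof.
move=> sf sX i; have H := smoothZ (@im_open i) (sf i) (sX i).
apply: (smooth_eq (@im_open i) _ H) => _ [z iz <-].
by rewrite !loc_chart // linearZ.
Qed.

Lemma smooth_vfieldD X Y : smooth_vfield A X -> smooth_vfield A Y ->
  smooth_vfield A (fun z => X z + Y z).
Proof.
move=> sX sY i; have H := smoothD (@im_open i) (sX i) (sY i).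
apply: (smooth_eq (@im_open i) _ H) => _ [z iz <-].
by rewrite !loc_chart // linearD.
Qed.

Lemma smooth_vfield0 : smooth_vfield A (fun=> 0).
Proof.
move=> i; have H := @smooth_cst R _ _ (im i) (0 : 'rV[R]_n).
apply: (smooth_eq (@im_open i) _ H) => _ [z iz <-].
by rewrite !loc_chart // linear0.
Qed.

Lemma smooth_vfield_sum (I : Type) (r : seq I) (X : I -> vfield R n M) :
  (forall a, smooth_vfield A (X a)) ->
  smooth_vfield A (fun z => \sum_(a <- r) X a z).
Proof.
move=> sX; elim: r => [|a r IH].
  rewrite (_ : (fun z => _) = fun=> 0); first exact: smooth_vfield0.
  by apply/funext => z; rewrite big_nil.
rewrite (_ : (fun z => _) = fun z => X a z + \sum_(b <- r) X b z).
  exact: smooth_vfieldD.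
by apply/funext => z; rewrite big_cons.
Qed.

Lemma smooth_funM f h : smooth_fun A f -> smooth_fun A h ->
  smooth_fun A (fun z => f z * h z).
Proof.
move=> sf sh i; have H := smoothM (@im_open i) (sf i) (sh i).
by apply: (smooth_eq (@im_open i) _ H) => _ [z iz <-]; rewrite !loc_chart.
Qed.

(** * Cut-offs *)

(** [rho] cuts off, around the set [N] of values of the chart [i], objects
    defined in this chart only *)
Definition cutoff i (rho : 'rV[R]_n -> R) (N : set 'rV[R]_n) : Prop :=
  [/\ smooth_on setT rho, [/\ open N, N `<=` im i & forall y, N y -> rho y = 1]
    & exists K : set M, [/\ closed K, K `<=` dom i &
        forall z, dom i z -> ~ K z -> rho (chart i z) = 0]].

(** The support of the cut-off is the inverse image of a closed box. It is compact,
    and closed in [M] because [M] is Hausdorff, which is what allows an extension by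
    zero. *)
Lemma cutoff_exists i z : dom i z ->
  exists rho N, cutoff i rho N /\ N (chart i z).
Proof.
move=> iz; have Uz : im i (chart i z) by exists z.
have /nbhs_ballP[e /= e0 eU] := open_nbhs_nbhs (conj (@im_open i) Uz).
(* the box of radius [2 * r] has to lie in the ball of radius [e] *)
pose r := e / 3.
have r0 : 0 < r by rewrite divr_gt0.
have [rho [srho rho1 rho0]] := exists_bump (chart i z) r0.
pose B := [set y : 'rV[R]_n | `|y - chart i z| <= 2 * r].
have BU : B `<=` im i.
  move=> y /= yB; apply: eU; rewrite -ball_normE /= distrC.
  by apply: le_lt_trans yB _; rewrite /r; lra.
exists rho, (ball (chart i z) r); split; last exact: ballxx.
split=> //.
  split; first exact: ball_open.
    move=> y; rewrite -ball_normE /= distrC => yr; apply: BU => /=.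
    by apply: ltW (lt_le_trans yr _); lra.
  by move=> y; rewrite -ball_normE /= distrC; exact: rho1.
pose K := [set x | dom i x /\ B (chart i x)].
exists K; split=> [|x []//|x ix Kx]; last first.
  by apply: rho0; apply/negP => xB; apply: Kx.
pose g (y : 'rV[R]_n) : M := xget z [set x | dom i x /\ chart i x = y].
have gK y : im i y -> dom i (g y) /\ chart i (g y) = y.
  move=> [x ix xy]; rewrite /g.
  by have := @xgetPex _ z [set x | dom i x /\ chart i x = y]; apply; exists x.
have -> : K = g @` B.
  apply/seteqP; split=> [x [ix Bx]|_ [y By <-]].
    exists (chart i x) => //; have [|d1 d2] := gK (chart i x); first by exists x.
    by apply: (@chart_inj i) d2; rewrite inE.
  by have [d1 d2] := gK y (BU y By); split=> //; rewrite d2.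
apply: compact_closed; first by case: hM.
apply: continuous_compact.
  apply: continuous_in_subspaceT => y; rewrite inE => By.
  have [d1 d2] := gK y (BU y By).
  move=> S; rewrite nbhsE => -[Q [oQ Qy] QS].
  have oOd : open (Q `&` dom i) by apply: openI => //; exact: dom_open.
  have := chart_open oOd (@subIsetr _ _ _).
  move=> oi; have : nbhs y (chart i @` (Q `&` dom i)).
    by apply: open_nbhs_nbhs; split=> //; exists (g y).
  apply: filterS => _ [x [Qx ix] <-]; apply: QS.
  have [|d3 d4] := gK (chart i x); first by exists x.
  by rewrite (_ : g (chart i x) = x) //; apply: (@chart_inj i) d4; rewrite inE.
apply: bounded_closed_compact.
  exists (`|chart i z| + 2 * r); split; first exact: num_real.
  move=> m hm y /= By; apply: le_trans (ltW hm).
  rewrite -(subrK (chart i z) y) addrC; apply: le_trans (ler_normD _ _) _.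
  by rewrite lerD2l.
have -> : B = closed_ball_ Num.norm (chart i z) (2 * r).
  by apply/seteqP; split=> y; rewrite /B /closed_ball_ /= distrC.
exact: closed_closed_ball_.
Qed.

Lemma cutoff_open i rho N : cutoff i rho N -> open N.
Proof. by case=> _ []. Qed.

Lemma cutoff_sub i rho N : cutoff i rho N -> N `<=` im i.
Proof. by case=> _ []. Qed.

Lemma cutoff_one i rho N y : cutoff i rho N -> N y -> rho y = 1.
Proof. by case=> _ [_ _ +] _; apply. Qed.

(** Around a point of the chart [j], either the chart [i] is available, and the
    object is given by [h], or the point is off the closed set [K], and the object
    vanishes nearby. *)
Lemma smooth_extend (W : normedModType R) i j (K : set M) (f : M -> W)
    (h : 'rV[R]_n -> W) :
  closed K -> K `<=` dom i ->
  (forall z, dom j z -> ~ K z -> f z = 0) ->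
  (forall z, dom i z -> dom j z -> f z = h (chart i z)) ->
  smooth_on (chart i @` (dom i `&` dom j)) h ->
  smooth_on (im j) (loc j f).
Proof.
move=> cK Ki f0 fh sh; apply: smooth_im_local => z jz.
have [iz|iz] := pselect (dom i z).
  exists (dom j `&` dom i); split=> //; first by apply: openI; exact: dom_open.
  have oji := @overlap_open j i.
  have H : smooth_on (chart j @` (dom j `&` dom i)) (fun y => h (trans j i y)).
    apply: (@smooth_comp _ _ _ _ _ _ (trans j i) h (fin_dim_rV R n) oji _ _ sh).
      by move=> _ [x [jx ix] <-]; exists x => //; rewrite trans_chart.
    exact: trans_smooth.
  apply: (smooth_eq oji _ H) => _ [x [jx ix] <-].
  by rewrite loc_chart // trans_chart // fh.
have oS : open (dom j `&` ~` K).
  by apply: openI; [exact: dom_open|exact: closed_openC].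
exists (dom j `&` ~` K); split=> //; first by split=> // /Ki.
have oS' := chart_open oS (@subIsetl _ _ _).
apply: (smooth_eq oS' _ (@smooth_cst R _ _ _ (0 : W))) => _ [x [jx Kx] <-].
by rewrite loc_chart // f0.
Qed.

Definition ext_fun i (rho phi : 'rV[R]_n -> R) (z : M) : R :=
  if pselect (dom i z) then rho (chart i z) * phi (chart i z) else 0.

Definition ext_vfield i (rho : 'rV[R]_n -> R) (eta : 'rV[R]_n -> 'rV[R]_n) :
    vfield R n M := fun z =>
  if pselect (dom i z) then tvec i z (rho (chart i z) *: eta (chart i z)) else 0.

Lemma ext_funE i rho phi z : dom i z ->
  ext_fun i rho phi z = rho (chart i z) * phi (chart i z).
Proof. by rewrite /ext_fun; case: pselect. Qed.

Lemma ext_fun_out i rho phi z : ~ dom i z -> ext_fun i rho phi z = 0.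
Proof. by rewrite /ext_fun; case: pselect. Qed.

Lemma ext_vfieldE i rho eta z : dom i z ->
  ext_vfield i rho eta z = tvec i z (rho (chart i z) *: eta (chart i z)).
Proof. by rewrite /ext_vfield; case: pselect. Qed.

Lemma ext_vfield_out i rho eta z : ~ dom i z -> ext_vfield i rho eta z = 0.
Proof. by rewrite /ext_vfield; case: pselect. Qed.

Lemma tcoord_ext_vfield i rho N eta z : cutoff i rho N -> dom i z ->
  N (chart i z) -> tcoord i z (ext_vfield i rho eta z) = eta (chart i z).
Proof.
by move=> co iz Nz; rewrite ext_vfieldE // tvecK // (cutoff_one co Nz) scale1r.
Qed.

Lemma vloc_ext_vfield i rho N eta y : cutoff i rho N -> N y ->
  vloc i (ext_vfield i rho eta) y = eta y.
Proof.
move=> co Ny; have [z iz zy] := cutoff_sub co Ny.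
by rewrite -zy vloc_chart // (tcoord_ext_vfield _ co iz) // zy.
Qed.

Lemma ext_fun_smooth i rho N phi : cutoff i rho N -> smooth_on (im i) phi ->
  smooth_fun A (ext_fun i rho phi).
Proof.
move=> [srho _ [K [cK Ki K0]]] sphi j.
apply: (@smooth_extend R i j K _ (fun y => rho y * phi y) cK Ki).
- move=> z jz Kz; have [iz|iz] := pselect (dom i z).
    by rewrite ext_funE // (K0 z iz Kz) mul0r.
  exact: ext_fun_out.
- by move=> z iz jz; rewrite ext_funE.
- have sub : chart i @` (dom i `&` dom j) `<=` im i by move=> _ [z [iz _] <-]; exists z.
  apply: (smoothM (@overlap_open i j)); first exact: smooth_sub srho.
  exact: smooth_sub sphi.
Qed.

Lemma ext_vfield_smooth i rho N eta : cutoff i rho N -> smooth_on (im i) eta ->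
  smooth_vfield A (ext_vfield i rho eta).
Proof.
move=> [srho _ [K [cK Ki K0]]] seta j.
apply: (@smooth_extend _ i j K _
  (fun y => 'd (trans i j) y (rho y *: eta y)) cK Ki).
- move=> z jz Kz; have [iz|iz] := pselect (dom i z).
    by rewrite ext_vfieldE // (K0 z iz Kz) scale0r !linear0.
  by rewrite ext_vfield_out // linear0.
- by move=> z iz jz; rewrite ext_vfieldE // tcoord_tvec.
- have sub : chart i @` (dom i `&` dom j) `<=` im i by move=> _ [z [iz _] <-]; exists z.
  have oij := @overlap_open i j.
  apply: (@smooth_diff _ _ _ _ _ _ (fun y => y) (trans i j) (fun y => rho y *: eta y)
    (fin_dim_rV R n) oij _ _ _ (@trans_smooth i j)) => //.
    exact: smooth_id.
  by apply: (smoothZ oij); [exact: smooth_sub srho|exact: smooth_sub seta].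
Qed.

(** Connections only act on globally defined fields; with this lemma identities
    between tangent vectors can be proved on fields. *)
Lemma extend_vector z v : exists2 X, smooth_vfield A X & X z = v.
Proof.
have [rho [N [co Nz]]] := cutoff_exists (@dom_at z).
exists (ext_vfield (at_pt A z) rho (fun=> v)).
  by apply: (ext_vfield_smooth co); exact: smooth_cst.
rewrite ext_vfieldE; last exact: dom_at.
by rewrite (cutoff_one co Nz) scale1r -[X in tvec _ _ X](tcoord_at z) tcoordK //; exact: dom_at.
Qed.

End Charts.

(** * Christoffel symbols *)

Section BilinearCombination.
Variables (R : realType) (n : nat).

Definition bil (G : 'I_n -> 'I_n -> 'rV[R]_n) (v w : 'rV[R]_n) : 'rV[R]_n :=
  \sum_k \sum_l (v 0 k * w 0 l) *: G k l.

Lemma bil_linearl G w : linear (fun v => bil G v w).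
Proof.
move=> a v v'; rewrite /bil scaler_sumr -big_split; apply: eq_bigr => k _ /=.
rewrite scaler_sumr -big_split; apply: eq_bigr => l _ /=.
by rewrite !mxE scalerA -scalerDl mulrDl mulrA.
Qed.

Lemma bil_linearr G v : linear (bil G v).
Proof.
move=> a w w'; rewrite /bil scaler_sumr -big_split; apply: eq_bigr => k _ /=.
rewrite scaler_sumr -big_split; apply: eq_bigr => l _ /=.
by rewrite !mxE scalerA -scalerDl mulrDr mulrCA.
Qed.

Lemma bilDl G v v' w : bil G (v + v') w = bil G v w + bil G v' w.
Proof. by have := bil_linearl G w 1 v v'; rewrite !scale1r. Qed.
Lemma bilDr G v w w' : bil G v (w + w') = bil G v w + bil G v w'.
Proof. by have := bil_linearr G v 1 w w'; rewrite !scale1r. Qed.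
Lemma bil0r G v : bil G v 0 = 0.
Proof. by rewrite /bil big1 // => k _; rewrite big1 // => l _; rewrite mxE mulr0 scale0r. Qed.
Lemma bil0l G w : bil G 0 w = 0.
Proof. by rewrite /bil big1 // => k _; rewrite big1 // => l _; rewrite mxE mul0r scale0r. Qed.
Lemma bilNl G v w : bil G (- v) w = - bil G v w.
Proof. by apply/eqP; rewrite -addr_eq0 -bilDl addNr bil0l. Qed.
Lemma bilNr G v w : bil G v (- w) = - bil G v w.
Proof. by apply/eqP; rewrite -addr_eq0 -bilDr addNr bil0r. Qed.

Lemma bil_sym G v w : (forall k l, G k l = G l k) -> bil G v w = bil G w v.
Proof.
move=> Gs; rewrite /bil exchange_big /=; apply: eq_bigr => k _.
by apply: eq_bigr => l _; rewrite mulrC Gs.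
Qed.

Variable V : normedModType R.
Variables (G : 'I_n -> 'I_n -> V -> 'rV[R]_n) (v w : V -> 'rV[R]_n).

Let term k l q := (v q 0 k * w q 0 l) *: G k l q.

Lemma bil_fun : (fun q => bil (fun k l => G k l q) (v q) (w q))
  = fun q => \sum_k \sum_l term k l q.
Proof. by []. Qed.

Lemma smooth_bil (U : set V) : open U -> (forall k l, smooth_on U (G k l)) ->
  smooth_on U v -> smooth_on U w ->
  smooth_on U (fun q => bil (fun k l => G k l q) (v q) (w q)).
Proof.
move=> oU sG sv sw; rewrite bil_fun.
apply: (@smooth_sum _ _ _ U _ _ _ (fun k q => \sum_l term k l q) oU) => k _.
apply: (@smooth_sum _ _ _ U _ _ _ (fun l q => term k l q) oU) => l _.
apply: (smoothZ oU) => //.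
by apply: (smoothM oU); exact: smooth_coord.
Qed.

Lemma derive_bil (p a : V) : (forall k l, differentiable (G k l) p) ->
  differentiable v p -> differentiable w p ->
  'D_a (fun q => bil (fun k l => G k l q) (v q) (w q)) p
  = bil (fun k l => 'D_a (G k l) p) (v p) (w p)
    + bil (fun k l => G k l p) ('D_a v p) (w p)
    + bil (fun k l => G k l p) (v p) ('D_a w p).
Proof.
move=> dG dv dw; rewrite bil_fun.
have dc (f : V -> 'rV[R]_n) k : differentiable f p -> differentiable (fun q => f q 0 k) p.
  by move=> df; apply: (@differentiable_comp _ _ _ _ f (@coord_fun R n k)) => //; exact: differentiable_coord.
have dvw k l : differentiable (fun q => v q 0 k * w q 0 l) p.
  by apply: (@differentiable_scale _ _ _ (fun q => v q 0 k) (fun q => w q 0 l)); exact: dc.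
have dterm k l : differentiable (term k l) p by exact: differentiable_scale.
have dsum k : differentiable (fun q => \sum_l term k l q) p.
  by apply: (@differentiable_bigsum _ _ _ _ _ _ (fun l q => term k l q)).
rewrite (@derive_bigsum _ _ _ _ _ _ (fun k q => \sum_l term k l q)) //.
rewrite /bil -!big_split; apply: eq_bigr => k _ /=.
rewrite (@derive_bigsum _ _ _ _ _ _ (fun l q => term k l q)) //.
rewrite -!big_split; apply: eq_bigr => l _ /=.
transitivity ('D_a (fun q => v q 0 k * w q 0 l) p *: G k l p
    + (v p 0 k * w p 0 l) *: 'D_a (G k l) p).
  exact: derive_scale (dvw k l) (dG k l).
have -> : 'D_a (fun q => v q 0 k * w q 0 l) p
    = ('D_a v p) 0 k * w p 0 l + v p 0 k * ('D_a w p) 0 l.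
  transitivity ('D_a (fun q => v q 0 k) p * w p 0 l + v p 0 k * 'D_a (fun q => w q 0 l) p).
    exact: (@derive_scale _ _ _ (fun q => v q 0 k) (fun q => w q 0 l) p a (dc v k dv) (dc w l dw)).
  by congr (_ * _ + _ * _); apply: esym; exact: derive_coord.
by rewrite scalerDl [LHS]addrC addrA.
Qed.

End BilinearCombination.

Section Christoffel.
Variables (R : realType) (n : nat) (M : topologicalType) (A : atlas R n M).
Hypothesis hM : smooth_manifold A.
Variable nabla : vfield R n M -> vfield R n M -> vfield R n M.
Hypothesis hn : affine_connection A nabla.
Implicit Types (X Y : vfield R n M) (i : idx A) (z : M).

Local Notation dom := (@chart_dom R n M A).
Local Notation im i := (chart i @` dom i).

Lemma nabla_smooth X Y : smooth_vfield A X -> smooth_vfield A Y ->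
  smooth_vfield A (nabla X Y).
Proof. by case: hn => H _ _ _; exact: H. Qed.

Lemma smooth_fun_cst (a : R) : smooth_fun A (fun=> a).
Proof.
move=> i; apply: (smooth_eq (@im_open _ _ _ _ hM i) _ (@smooth_cst R _ _ _ a)).
by move=> _ [z iz <-]; rewrite (loc_chart hM).
Qed.

Lemma nabla0l Y z : smooth_vfield A Y -> nabla (fun=> 0) Y z = 0.
Proof.
move=> sY; case: hn => _ H _ _; have s0 := smooth_vfield0 hM.
have := H (fun=> -1) _ _ Y (smooth_fun_cst (-1)) s0 s0 sY z.
have -> : (fun z : M => -1 *: (0 : 'rV[R]_n) + 0) = fun=> 0.
  by apply/funext => y; rewrite scaler0 addr0.
by rewrite scaleN1r addNr.
Qed.

Lemma nablaZl f X Y z : smooth_fun A f -> smooth_vfield A X -> smooth_vfield A Y ->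
  nabla (fun z => f z *: X z) Y z = f z *: nabla X Y z.
Proof.
move=> sf sX sY; case: hn => _ H _ _; have s0 := smooth_vfield0 hM.
have := H f X _ Y sf sX s0 sY z; rewrite nabla0l // addr0 => <-.
by congr (nabla _ Y z); apply/funext => y; rewrite addr0.
Qed.

Lemma nablaDr X Y Y' z : smooth_vfield A X -> smooth_vfield A Y ->
  smooth_vfield A Y' ->
  nabla X (fun z => Y z + Y' z) z = nabla X Y z + nabla X Y' z.
Proof. by case: hn => _ _ H _ *; exact: H. Qed.

Lemma nabla0r X z : smooth_vfield A X -> nabla X (fun=> 0) z = 0.
Proof.
move=> sX; have s0 := smooth_vfield0 hM.
have := nablaDr z sX s0 s0; rewrite (_ : (fun z => _) = fun=> 0); last first.
  by apply/funext => y; rewrite addr0.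
by move/eqP; rewrite -subr_eq subrr => /eqP <-.
Qed.

Lemma nablaZr f X Y z : smooth_fun A f -> smooth_vfield A X -> smooth_vfield A Y ->
  nabla X (fun z => f z *: Y z) z
  = vderiv A z (X z) f *: Y z + f z *: nabla X Y z.
Proof. by case: hn => _ _ _ H *; exact: H. Qed.

Lemma nabla_suml (I : Type) (r : seq I) (f : I -> M -> R) (X : I -> vfield R n M) Y z :
  (forall a, smooth_fun A (f a)) -> (forall a, smooth_vfield A (X a)) ->
  smooth_vfield A Y ->
  nabla (fun z => \sum_(a <- r) f a z *: X a z) Y z
  = \sum_(a <- r) f a z *: nabla (X a) Y z.
Proof.
move=> sf sX sY; elim: r => [|a r IH].
  rewrite big_nil (_ : (fun z => _) = fun=> 0) ?nabla0l //.
  by apply/funext => y; rewrite big_nil.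
rewrite big_cons -IH; case: hn => _ H _ _.
have s : smooth_vfield A (fun z => \sum_(b <- r) f b z *: X b z).
  apply: (@smooth_vfield_sum _ _ _ _ hM _ _ (fun b z => f b z *: X b z)) => b.
  exact: smooth_funZ_vfield.
rewrite -(H (f a) (X a) _ Y (sf a) (sX a) s sY z).
by congr (nabla _ Y z); apply/funext => y; rewrite big_cons.
Qed.

Lemma nabla_sumr (I : Type) (r : seq I) (f : I -> M -> R) X (Y : I -> vfield R n M) z :
  (forall a, smooth_fun A (f a)) -> (forall a, smooth_vfield A (Y a)) ->
  smooth_vfield A X ->
  nabla X (fun z => \sum_(a <- r) f a z *: Y a z) z
  = \sum_(a <- r) (vderiv A z (X z) (f a) *: Y a z + f a z *: nabla X (Y a) z).
Proof.
move=> sf sY sX; elim: r => [|a r IH].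
  rewrite big_nil (_ : (fun z => _) = fun=> 0) ?nabla0r //.
  by apply/funext => y; rewrite big_nil.
have sfY b : smooth_vfield A (fun z => f b z *: Y b z) by exact: smooth_funZ_vfield.
have s : smooth_vfield A (fun z => \sum_(b <- r) f b z *: Y b z).
  exact: (@smooth_vfield_sum _ _ _ _ hM _ _ (fun b z => f b z *: Y b z)).
rewrite big_cons -IH -nablaZr // -nablaDr //.
by congr (nabla X _ z); apply/funext => y; rewrite big_cons.
Qed.

Section Frame.
Variables (i : idx A) (rho : 'rV[R]_n -> R) (N : set 'rV[R]_n).
Hypothesis co : cutoff i rho N.

Definition frame (k : 'I_n) : vfield R n M :=
  @ext_vfield R n M A i rho (fun=> delta_mx 0 k).

Definition comp_fun (X : vfield R n M) (k : 'I_n) : M -> R :=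
  @ext_fun R n M A i rho (fun y => vloc i X y 0 k).

Definition cutfun : M -> R := @ext_fun R n M A i rho (fun=> 1).

Lemma frame_smooth k : smooth_vfield A (frame k).
Proof. by apply: (ext_vfield_smooth hM co); exact: smooth_cst. Qed.

Lemma cutfun_smooth : smooth_fun A cutfun.
Proof. by apply: (ext_fun_smooth hM co); exact: smooth_cst. Qed.

Lemma comp_fun_smooth X k : smooth_vfield A X -> smooth_fun A (comp_fun X k).
Proof.
move=> sX; apply: (ext_fun_smooth hM co); apply: smooth_coord; last exact: sX.
exact: (@im_open _ _ _ _ hM).
Qed.

(** A field has no global decomposition along the frame, but its product with the
    square of the cut-off has one: one factor goes to the components, the other one
    to the frame. *)
Lemma frame_decomp X : (fun z => cutfun z *: (cutfun z *: X z))
  = fun z => \sum_k comp_fun X k z *: frame k z.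
Proof.
apply/funext => z; have [iz|iz] := pselect (dom i z); last first.
  rewrite /cutfun ext_fun_out // scale0r big1 // => k _.
  by rewrite /comp_fun ext_fun_out // scale0r.
rewrite /cutfun ext_funE // mulr1.
transitivity (\sum_k (rho (chart i z) * (tcoord i z (X z)) 0 k) *:
    tvec i z (rho (chart i z) *: delta_mx 0 k)); last first.
  apply: eq_bigr => k _.
  by rewrite /frame ext_vfieldE // /comp_fun ext_funE // (vloc_chart hM).
rewrite -[in LHS](tcoordK hM (X z) iz) [in LHS](row_sum_delta (tcoord i z (X z))).
rewrite linear_sum !scaler_sumr; apply: eq_bigr => k _.
by rewrite !linearZ /= !scalerA; congr (_ *: _); ring.
Qed.

Lemma cutfun1 z : dom i z -> N (chart i z) -> cutfun z = 1.
Proof. by move=> iz Nz; rewrite /cutfun ext_funE // (cutoff_one co Nz) mulr1. Qed.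

Lemma comp_funE X k z : dom i z -> N (chart i z) ->
  comp_fun X k z = (tcoord i z (X z)) 0 k.
Proof.
move=> iz Nz; rewrite /comp_fun ext_funE // (cutoff_one co Nz) mul1r.
by rewrite (vloc_chart hM).
Qed.

Lemma tcoord_frame k z : dom i z -> N (chart i z) ->
  tcoord i z (frame k z) = delta_mx 0 k.
Proof. by move=> iz Nz; rewrite (tcoord_ext_vfield hM _ co). Qed.

Lemma vderiv_cutfun z v : dom i z -> N (chart i z) -> vderiv A z v cutfun = 0.
Proof.
move=> iz Nz; have sf := cutfun_smooth.
rewrite (vderivE hM v iz (smooth_fun_diff sf iz)).
transitivity ('D_(tcoord i z v) (cst 1 : 'rV[R]_n -> R) (chart i z)); last exact: derive_cst.
apply: derive_near_eq (cutoff_open co) Nz _ => y Ny.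
have [x ix xy] := cutoff_sub co Ny.
by rewrite -xy (loc_chart hM) // cutfun1 // xy.
Qed.

Lemma vderiv_comp_fun Y k z v : smooth_vfield A Y -> dom i z -> N (chart i z) ->
  vderiv A z v (comp_fun Y k) = ('D_(tcoord i z v) (vloc i Y) (chart i z)) 0 k.
Proof.
move=> sY iz Nz; have sf := comp_fun_smooth k sY.
rewrite (vderivE hM v iz (smooth_fun_diff sf iz)).
transitivity ('D_(tcoord i z v) (fun y => vloc i Y y 0 k) (chart i z)).
  apply: derive_near_eq (cutoff_open co) Nz _ => y Ny.
  have [x ix xy] := cutoff_sub co Ny.
  rewrite -xy in Ny *.
  by rewrite (loc_chart hM) // comp_funE // (vloc_chart hM).
exact: (esym (derive_coord _ _ (vloc_diff sY iz))).
Qed.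

(** The vector of Christoffel symbols with lower indices [k] and [l]; it has this
    meaning on [N], where the frame has constant components. *)
Definition chris (k l : 'I_n) : 'rV[R]_n -> 'rV[R]_n :=
  vloc i (nabla (frame k) (frame l)).

Definition Gam (y v w : 'rV[R]_n) : 'rV[R]_n := bil (fun k l => chris k l y) v w.

Lemma chris_smooth k l : smooth_on (im i) (chris k l).
Proof. by apply: nabla_smooth; exact: frame_smooth. Qed.

(** Multiplying [X] and [Y] by the square of [cutfun] changes nothing at [z], where
    this function is [1] and stationary. By [frame_decomp] the connection is then
    evaluated on combinations of the frame, where linearity and the Leibniz rule give
    the classical formula. *)
Lemma nabla_chart X Y z : smooth_vfield A X -> smooth_vfield A Y ->
  dom i z -> N (chart i z) ->
  tcoord i z (nabla X Y z) = 'D_(tcoord i z (X z)) (vloc i Y) (chart i z)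
    + Gam (chart i z) (tcoord i z (X z)) (tcoord i z (Y z)).
Proof.
move=> sX sY iz Nz.
have sc := cutfun_smooth; have c1 := cutfun1 iz Nz.
have scY : smooth_vfield A (fun z => cutfun z *: Y z) by exact: smooth_funZ_vfield.
have scX : smooth_vfield A (fun z => cutfun z *: X z) by exact: smooth_funZ_vfield.
have E1 Z : smooth_vfield A Z ->
    nabla X Z z = \sum_k (tcoord i z (X z)) 0 k *: nabla (frame k) Z z.
  move=> sZ; transitivity (nabla (fun z => cutfun z *: (cutfun z *: X z)) Z z).
    rewrite (@nablaZl cutfun (fun z => cutfun z *: X z)) //.
    by rewrite (@nablaZl cutfun X) // c1 !scale1r.
  rewrite frame_decomp nabla_suml //.
  - by apply: eq_bigr => k _; rewrite comp_funE.
  - by move=> k; exact: comp_fun_smooth.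
  - exact: frame_smooth.
have -> : nabla X Y z = \sum_l (vderiv A z (X z) (comp_fun Y l) *: frame l z
    + comp_fun Y l z *: nabla X (frame l) z).
  transitivity (nabla X (fun z => cutfun z *: (cutfun z *: Y z)) z).
    rewrite (@nablaZr cutfun X (fun z => cutfun z *: Y z)) //.
    rewrite (@nablaZr cutfun X Y) //.
    by rewrite c1 vderiv_cutfun // !scale0r !add0r !scale1r.
  rewrite frame_decomp nabla_sumr //.
  - by move=> k; exact: comp_fun_smooth.
  - exact: frame_smooth.
rewrite linear_sum.
under eq_bigr => l _ do rewrite linearD !linearZ /= tcoord_frame //.
rewrite big_split /=; congr (_ + _).
  rewrite [RHS]row_sum_delta; apply: eq_bigr => l _.
  by rewrite vderiv_comp_fun.
rewrite /Gam /bil exchange_big /=; apply: eq_bigr => l _.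
rewrite (E1 (frame l)); last exact: frame_smooth.
rewrite linear_sum scaler_sumr; apply: eq_bigr => k _.
rewrite linearZ /= scalerA comp_funE // mulrC.
by rewrite /chris (vloc_chart hM).
Qed.

Lemma nabla_vloc X Y y : smooth_vfield A X -> smooth_vfield A Y -> N y ->
  vloc i (nabla X Y) y = 'D_(vloc i X y) (vloc i Y) y
    + Gam y (vloc i X y) (vloc i Y y).
Proof.
move=> sX sY Ny; have [z iz zy] := cutoff_sub co Ny; rewrite -zy in Ny *.
by rewrite !(vloc_chart hM) // nabla_chart.
Qed.

End Frame.
End Christoffel.

(** * Curvature *)

Section RowIdentities.
Variables (R : realType) (n : nat).
Implicit Types p q r s : 'rV[R]_n.

Lemma rV_sum_antisym p q r s : p - q + r - s = - (q - p + s - r).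
Proof. by apply/rowP => k; rewrite !mxE; ring. Qed.

Lemma rV_sum_cyclic p1 p2 p3 q1 q2 q3 : (p1 - p2 + q1 - q2)
  + (p2 - p3 + q2 - q3) + (p3 - p1 + q3 - q1) = 0 :> 'rV[R]_n.
Proof. by apply/rowP => k; rewrite !mxE; ring. Qed.

Lemma rV_sum_curvature d zp zq g1 g2 pz qz ydx xdy xyz yxz :
  d + zp + (g1 + pz + ydx) + (xdy + xyz)
  - (d + zq + (g2 + qz + xdy) + (ydx + yxz)) - (zp - zq + (pz - qz))
  = g1 - g2 + xyz - yxz :> 'rV[R]_n.
Proof. by apply/rowP => k; rewrite !mxE; ring. Qed.

Lemma rV_sum_bracket g1 g2 ga gb yxu xyu :
  - (g1 + ga + - yxu) + - - (g2 + gb + - xyu)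
  = - (ga - gb) - (g1 - g2 + xyu - yxu) :> 'rV[R]_n.
Proof. by apply/rowP => k; rewrite !mxE; ring. Qed.

End RowIdentities.

Section DeriveField.
Variables (R : realType) (n : nat) (W : normedModType R).

(** Expanding [eta] along the canonical basis, the Leibniz rule gives one term in
    which [eta] is frozen at [y] and one in which it is differentiated. *)
Lemma derive_along (U : set 'rV[R]_n) (f : 'rV[R]_n -> W)
    (eta : 'rV[R]_n -> 'rV[R]_n) y a : open U -> U y ->
  smooth_on U f -> smooth_on U eta ->
  'D_a (fun z => 'D_(eta z) f z) y
  = 'D_a (fun z => 'D_(eta y) f z) y + 'D_('D_a eta y) f y.
Proof.
move=> oU Uy sf se.
have df z : U z -> differentiable f z by exact: smooth_differentiable.
have de : differentiable eta y by exact: smooth_differentiable Uy.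
have expand z v : U z -> 'D_v f z = \sum_k v 0 k *: 'D_(delta_mx 0 k) f z.
  move=> Uz; have dz := df z Uz.
  rewrite (deriveE v dz) [in LHS](row_sum_delta v) linear_sum.
  by apply: eq_bigr => k _; rewrite linearZ (deriveE _ dz).
have dDk k : differentiable (fun z => 'D_(delta_mx 0 k) f z) y.
  exact: (smooth_differentiable (smooth_derive (delta_mx 0 k) sf) Uy).
have dek k : differentiable (fun z => eta z 0 k) y.
  by apply: (@differentiable_comp _ _ _ _ eta (@coord_fun R n k)) => //;
    exact: differentiable_coord.
pose t k z := eta z 0 k *: 'D_(delta_mx 0 k) f z.
transitivity ('D_a (fun z => \sum_k t k z) y).
  by apply: derive_near_eq oU Uy _ => z Uz; exact: expand.
have dt k : differentiable (t k) y by exact: differentiable_scale.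
rewrite (@derive_bigsum _ _ _ _ _ _ t) //.
have -> : 'D_a (fun z => 'D_(eta y) f z) y
    = \sum_k eta y 0 k *: 'D_a (fun z => 'D_(delta_mx 0 k) f z) y.
  pose s k z := eta y 0 k *: 'D_(delta_mx 0 k) f z.
  transitivity ('D_a (fun z => \sum_k s k z) y).
    by apply: derive_near_eq oU Uy _ => z Uz; exact: expand.
  have ds k : differentiable (s k) y by exact: differentiableZ.
  rewrite (@derive_bigsum _ _ _ _ _ _ s) //.
  apply: eq_bigr => k _.
  exact: (deriveZ (eta y 0 k) (diff_derivable (dDk k))).
rewrite (expand y ('D_a eta y) Uy) -big_split; apply: eq_bigr => k _ /=.
transitivity ('D_a (fun z => eta z 0 k) y *: 'D_(delta_mx 0 k) f y
   + eta y 0 k *: 'D_a (fun z => 'D_(delta_mx 0 k) f z) y).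
  exact: derive_scale.
rewrite [LHS]addrC; congr (_ + _ *: _); apply: esym; exact: derive_coord.
Qed.

End DeriveField.

Section Brackets.
Variables (R : realType) (n : nat) (M : topologicalType) (A : atlas R n M).
Hypothesis hM : smooth_manifold A.
Implicit Types (X Y Z : vfield R n M) (f : M -> R) (x z : M).

Local Notation dom := (@chart_dom R n M A).
Local Notation im i := (chart i @` dom i).

(** The function usually written [X f]. *)
Definition deriv_fun X f : M -> R := fun z => vderiv A z (X z) f.

Lemma loc_deriv_fun i X f y : smooth_fun A f -> im i y ->
  loc i (deriv_fun X f) y = 'D_(vloc i X y) (loc i f) y.
Proof. by move=> sf [z iz <-]; rewrite (loc_chart hM) // /deriv_fun (vderiv_vloc hM _ sf iz). Qed.

Lemma deriv_fun_smooth X f : smooth_vfield A X -> smooth_fun A f -> smooth_fun A (deriv_fun X f).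
Proof.
move=> sX sf i; have oi := @im_open _ _ _ _ hM i.
have H : smooth_on (im i) (fun y => 'd (loc i f) y (vloc i X y)).
  exact: (@smooth_diff _ _ _ _ (im i) (im i) (fun y => y) (loc i f) (vloc i X)
    (fin_dim_rV R n) oi (fun y Uy => Uy) (smooth_id _) (sX i) (sf i)).
apply: (smooth_eq oi _ H) => y Uy; rewrite loc_deriv_fun //.
by rewrite deriveE //; exact: (smooth_differentiable (sf i) Uy).
Qed.

Lemma vderivD z v f h : smooth_fun A f -> smooth_fun A h ->
  vderiv A z v (fun z => f z + h z) = vderiv A z v f + vderiv A z v h.
Proof.
move=> sf sh; have dz := dom_at hM z.
have df := smooth_fun_diff sf dz; have dh := smooth_fun_diff sh dz.
rewrite /vderiv; set i := at_pt A z; set y := chart i z.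
transitivity ('D_v (loc i f + loc i h) y).
  apply: (derive_near_eq v (@im_open _ _ _ _ hM i)); first by exists z.
  by move=> _ [x ix <-]; rewrite fctE !(loc_chart hM).
by rewrite deriveD //; exact: diff_derivable.
Qed.

Lemma vderivB_dir z v w f : smooth_fun A f ->
  vderiv A z (v - w) f = vderiv A z v f - vderiv A z w f.
Proof.
move=> sf; have df := smooth_fun_diff sf (dom_at hM z).
by rewrite /vderiv !(deriveE _ df) linearB.
Qed.

(** Both sides are computed in the chart at [z] by [derive_along]; the second
    derivatives of [f] along frozen directions cancel by [derive_comm]. *)
Lemma vderiv_bracket X Y f z : smooth_vfield A X -> smooth_vfield A Y ->
  smooth_fun A f ->
  vderiv A z (lie_bracket A X Y z) f
  = vderiv A z (X z) (deriv_fun Y f) - vderiv A z (Y z) (deriv_fun X f).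
Proof.
move=> sX sY sf; have dz := dom_at hM z.
have df := smooth_fun_diff sf dz.
rewrite vderivB_dir // /vderiv; set i := at_pt A z; set y := chart i z.
have oi := @im_open _ _ _ _ hM i.
have Uy : im i y by exists z.
have along X' Y' : smooth_vfield A X' -> smooth_vfield A Y' ->
    'D_(X' z) (loc i (deriv_fun Y' f)) y =
    'D_(X' z) (fun u => 'D_(Y' z) (loc i f) u) y
    + 'D_('D_(X' z) (vloc i Y') y) (loc i f) y.
  move=> sX' sY'.
  transitivity ('D_(X' z) (fun u => 'D_(vloc i Y' u) (loc i f) u) y).
    by apply: derive_near_eq oi Uy _ => u Uu; exact: loc_deriv_fun.
  have vY : vloc i Y' y = Y' z by exact: (vloc_at hM).
  rewrite -{1}vY.
  exact: (@derive_along _ _ _ (im i) (loc i f) (vloc i Y') y (X' z) oi Uy (sf i) (sY' i)).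
have C := derive_comm (X z) (Y z) oi Uy (sf i).
have comb (p p' q q' b b' : R) : p = q + b -> p' = q' + b' -> q' = q ->
    b - b' = p - p'.
  by move=> -> -> ->; ring.
exact: comb (along X Y sX sY) (along Y X sY sX) C.
Qed.

End Brackets.

Section Curvature.
Variables (R : realType) (n : nat) (M : topologicalType) (A : atlas R n M).
Hypothesis hM : smooth_manifold A.
Variables (g : tensor02 R n M) (nabla : vfield R n M -> vfield R n M -> vfield R n M).
Hypothesis hg : sym_tensor02 A g.
Hypothesis hLC : levi_civita A g nabla.
Implicit Types (X Y Z W : vfield R n M) (x z : M).

Local Notation dom := (@chart_dom R n M A).
Local Notation im i := (chart i @` dom i).

Lemma lc_affine : affine_connection A nabla. Proof. by case: hLC. Qed.

Lemma lc_torsion X Y : smooth_vfield A X -> smooth_vfield A Y ->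
  lie_bracket A X Y = fun z => nabla X Y z + - nabla Y X z.
Proof. by move=> sX sY; apply/funext => z; case: hLC => _ H _; rewrite H. Qed.

Lemma lc_metric X Y Z z : smooth_vfield A X -> smooth_vfield A Y ->
  smooth_vfield A Z ->
  vderiv A z (X z) (fun z => g z (Y z) (Z z))
  = g z (nabla X Y z) (Z z) + g z (Y z) (nabla X Z z).
Proof. by case: hLC => _ _ H *; exact: H. Qed.

Lemma g_sym x v w : g x v w = g x w v. Proof. by case: hg. Qed.
Lemma g_linl x a v v' w : g x (a *: v + v') w = a * g x v w + g x v' w.
Proof. by case: hg. Qed.
Lemma gDl x v v' w : g x (v + v') w = g x v w + g x v' w.
Proof. by rewrite -[v]scale1r g_linl mul1r scale1r. Qed.
Lemma gDr x v w w' : g x v (w + w') = g x v w + g x v w'.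
Proof. by rewrite g_sym gDl !(g_sym x v). Qed.
Lemma g0l x w : g x 0 w = 0.
Proof. by apply: (addrI (g x 0 w)); rewrite -gDl !addr0. Qed.
Lemma gZl x a v w : g x (a *: v) w = a * g x v w.
Proof. by rewrite -[a *: v]addr0 g_linl g0l addr0. Qed.
Lemma gZr x a v w : g x v (a *: w) = a * g x v w.
Proof. by rewrite g_sym gZl g_sym. Qed.
Lemma gNl x v w : g x (- v) w = - g x v w.
Proof. by rewrite -scaleN1r gZl mulN1r. Qed.
Lemma gNr x v w : g x v (- w) = - g x v w.
Proof. by rewrite g_sym gNl g_sym. Qed.

Lemma g_smooth X Y : smooth_vfield A X -> smooth_vfield A Y ->
  smooth_fun A (fun z => g z (X z) (Y z)).
Proof. by case: hg => _ _ H; exact: H. Qed.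

Let nsm := @nabla_smooth _ _ _ _ _ lc_affine.

Lemma smooth_vfieldN X : smooth_vfield A X -> smooth_vfield A (fun z => - X z).
Proof.
move=> sX; rewrite (_ : (fun z => _) = fun z => -1 *: X z).
  exact: (smooth_funZ_vfield hM (smooth_fun_cst hM (-1))).
by apply/funext => z; rewrite scaleN1r.
Qed.

Lemma lie_bracket_smooth X Y : smooth_vfield A X -> smooth_vfield A Y ->
  smooth_vfield A (lie_bracket A X Y).
Proof.
move=> sX sY; rewrite lc_torsion //; apply: (smooth_vfieldD hM); first exact: nsm.
by apply: smooth_vfieldN; exact: nsm.
Qed.

(** Compatibility with the metric, used twice, expresses [X (Y f)] for the function
    [f = g (Z, W)]. In [X (Y f) - Y (X f) - [X, Y] f], which vanishes by
    [vderiv_bracket], the products of first covariant derivatives cancel. *)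
Lemma curvature_antisym_g X Y Z W x : smooth_vfield A X -> smooth_vfield A Y ->
  smooth_vfield A Z -> smooth_vfield A W ->
  g x (curvature A nabla X Y Z x) (W x) = - g x (Z x) (curvature A nabla X Y W x).
Proof.
move=> sX sY sZ sW; pose f z := g z (Z z) (W z).
have sf : smooth_fun A f by exact: g_smooth.
have B := vderiv_bracket hM x sX sY sf.
have sB := lie_bracket_smooth sX sY.
rewrite (lc_metric x sB sZ sW) in B.
have second X' Y' : smooth_vfield A X' -> smooth_vfield A Y' ->
    vderiv A x (X' x) (deriv_fun A Y' f) =
    (g x (nabla X' (nabla Y' Z) x) (W x) + g x (nabla Y' Z x) (nabla X' W x))
    + (g x (nabla X' Z x) (nabla Y' W x) + g x (Z x) (nabla X' (nabla Y' W) x)).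
  move=> sX' sY'.
  have -> : deriv_fun A Y' f
      = fun z => g z (nabla Y' Z z) (W z) + g z (Z z) (nabla Y' W z).
    by apply/funext => z; exact: lc_metric.
  have s1 := nsm sY' sZ; have s2 := nsm sY' sW.
  rewrite (vderivD hM); [|exact: g_smooth|exact: g_smooth].
  by rewrite !lc_metric.
rewrite (second X Y) // (second Y X) // in B.
rewrite /curvature !gDl !gDr !gNl !gNr.
by move: B; lra.
Qed.

Section AtPoint.
Variables (i : idx A) (rho : 'rV[R]_n -> R) (N : set 'rV[R]_n).
Hypothesis co : cutoff i rho N.

Local Notation E := (@frame R n M A i rho).
Local Notation Ga := (@Gam R n M A nabla i rho).
Local Notation ch := (@chris R n M A nabla i rho).

(** The torsion vanishes, so the two symbols differ by the bracket of two frame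
    fields. It is zero because it annihilates the coordinate functions, whose
    derivatives along the frame are constant near [z]. *)
Lemma chris_sym k l y : N y -> ch k l y = ch l k y.
Proof.
move=> Ny; have [z iz zy] := cutoff_sub co Ny; rewrite -zy in Ny *.
rewrite /chris !(vloc_chart hM) //; apply/eqP; rewrite -subr_eq0 -linearB.
have sE a := frame_smooth hM co a.
have -> : nabla (E k) (E l) z - nabla (E l) (E k) z = lie_bracket A (E k) (E l) z.
  by rewrite lc_torsion.
apply/eqP/rowP => m; rewrite [RHS]mxE.
have sid : smooth_on (im i) (fun y : 'rV[R]_n => y 0 m).
  apply: smooth_coord; first exact: (@im_open _ _ _ _ hM).
  exact: smooth_id.
pose f := @ext_fun R n M A i rho (fun y => y 0 m).
have sf : smooth_fun A f by exact: (ext_fun_smooth hM co).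
have fN x : dom i x -> N (chart i x) -> f x = chart i x 0 m.
  by move=> ix Nx; rewrite /f ext_funE // (cutoff_one co Nx) mul1r.
have vf x v : dom i x -> N (chart i x) -> vderiv A x v f = tcoord i x v 0 m.
  move=> ix Nx; rewrite (vderivE hM v ix (smooth_fun_diff sf ix)).
  transitivity ('D_(tcoord i x v) (coord_fun m) (chart i x)); last first.
    by apply: derive_linear; exact: coord_fun_continuous.
  apply: derive_near_eq (cutoff_open co) Nx _ => u Nu.
  have [t it tu] := cutoff_sub co Nu; rewrite -tu in Nu *.
  by rewrite (loc_chart hM) // fN.
have DD0 a b : vderiv A z (E a z) (deriv_fun A (E b) f) = 0.
  have sD := deriv_fun_smooth hM (sE b) sf.
  rewrite (vderivE hM _ iz (smooth_fun_diff sD iz)).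
  transitivity ('D_(tcoord i z (E a z)) (cst ((delta_mx 0 b : 'rV[R]_n) 0 m : R)
     : 'rV[R]_n -> R) (chart i z)); last exact: derive_cst.
  apply: derive_near_eq (cutoff_open co) Ny _ => u Nu.
  have [t it tu] := cutoff_sub co Nu; rewrite -tu in Nu *.
  rewrite (loc_chart hM) // /deriv_fun vf //.
  by rewrite (tcoord_frame hM co).
have := vderiv_bracket hM z (sE k) (sE l) sf.
by rewrite vf // !DD0 subr0.
Qed.

Lemma Gam_sym y v w : N y -> Ga y v w = Ga y w v.
Proof. by move=> Ny; apply: bil_sym => k l; exact: chris_sym. Qed.

(** The bilinear map of the Christoffel symbols, differentiated in the direction [a]. *)
Definition dGam (y a v w : 'rV[R]_n) : 'rV[R]_n :=
  bil (fun k l => 'D_a (ch k l) y) v w.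

Lemma dGam_sym y a v w : N y -> dGam y a v w = dGam y a w v.
Proof.
move=> Ny; apply: bil_sym => k l.
by apply: derive_near_eq (cutoff_open co) Ny _ => u Nu; exact: chris_sym.
Qed.

Definition curv_chart (y a b c : 'rV[R]_n) : 'rV[R]_n :=
  dGam y a b c - dGam y b a c + Ga y a (Ga y b c) - Ga y b (Ga y a c).

Lemma curv_chart_antisym y a b c : curv_chart y a b c = - curv_chart y b a c.
Proof.
by rewrite /curv_chart rV_sum_antisym.
Qed.

Lemma curv_chart_bianchi y a b c : N y ->
  curv_chart y a b c + curv_chart y b c a + curv_chart y c a b = 0.
Proof.
move=> Ny; rewrite /curv_chart.
rewrite (dGam_sym c b a Ny) (dGam_sym b c a Ny) (dGam_sym a c b Ny).
rewrite (Gam_sym c a Ny) (Gam_sym b a Ny) (Gam_sym c b Ny).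
exact: rV_sum_cyclic.
Qed.

Lemma chris_diff k l y : N y -> differentiable (ch k l) y.
Proof.
move=> Ny; apply: (smooth_differentiable (chris_smooth hM lc_affine co k l)).
exact: (cutoff_sub co).
Qed.

(** The second derivatives of [Z] cancel by symmetry, its first derivatives cancel
    against the ones coming from the bracket. Only the values of the three fields at
    [x] remain, so the curvature is a tensor. *)
Lemma curvature_chart X Y Z x : smooth_vfield A X -> smooth_vfield A Y ->
  smooth_vfield A Z -> i = at_pt A x -> N (chart i x) ->
  curvature A nabla X Y Z x = curv_chart (chart i x) (X x) (Y x) (Z x).
Proof.
move=> sX sY sZ ix Nx.
have dx : dom i x by rewrite ix; exact: (dom_at hM).
have tx v : tcoord i x v = v by rewrite ix (tcoord_at hM).
have na X' Y' : smooth_vfield A X' -> smooth_vfield A Y' ->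
    nabla X' Y' x = 'D_(X' x) (vloc i Y') (chart i x) + Ga (chart i x) (X' x) (Y' x).
  move=> sX' sY'; have := nabla_chart hM lc_affine co sX' sY' dx Nx.
  by rewrite !tx.
have va X' : vloc i X' (chart i x) = X' x by rewrite (vloc_chart hM) // tx.
set y := chart i x in Nx na va *.
have oi := @im_open _ _ _ _ hM i; have Uy : im i y by exists x.
pose DZ v := 'D_v (vloc i Z) y.
pose D2 a b := 'D_a (fun u => 'D_b (vloc i Z) u) y.
have second X' Y' : smooth_vfield A X' -> smooth_vfield A Y' ->
    nabla X' (nabla Y' Z) x =
    (D2 (X' x) (Y' x) + DZ ('D_(X' x) (vloc i Y') y))
    + (dGam y (X' x) (Y' x) (Z x) + Ga y ('D_(X' x) (vloc i Y') y) (Z x)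
       + Ga y (Y' x) (DZ (X' x)))
    + Ga y (X' x) (DZ (Y' x) + Ga y (Y' x) (Z x)).
  move=> sX' sY'; rewrite na //; last exact: nsm.
  rewrite (na Y' Z) //; congr (_ + _).
  pose F1 u := 'D_(vloc i Y' u) (vloc i Z) u.
  pose F2 u := Ga u (vloc i Y' u) (vloc i Z u).
  have dY := smooth_differentiable (sY' i) Uy.
  have dZ := smooth_differentiable (sZ i) Uy.
  have dF2 : differentiable F2 y.
    apply: (@smooth_differentiable _ _ _ (im i)) => //.
    apply: (smooth_bil oi); [|exact: sY'|exact: sZ].
    by move=> k l; exact: (chris_smooth hM lc_affine co).
  have dF1 : differentiable F1 y.
    apply: (@differentiable_near_eq _ _ _ (im i) (fun u => 'd (vloc i Z) u (vloc i Y' u)) F1 y oi Uy).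
      move=> u Uu; have dZu := smooth_differentiable (sZ i) Uu.
      exact: (esym (deriveE _ dZu)).
    apply: (@smooth_differentiable _ _ _ (im i)) => //.
    exact: (@smooth_diff _ _ _ _ (im i) (im i) (fun y => y) (vloc i Z) (vloc i Y')
      (fin_dim_rV R n) oi (fun y Uy => Uy) (smooth_id _) (sY' i) (sZ i)).
  transitivity ('D_(X' x) (F1 + F2) y).
    apply: derive_near_eq (cutoff_open co) Nx _ => u Nu.
    exact: (nabla_vloc hM lc_affine co sY' sZ Nu).
  transitivity ('D_(X' x) F1 y + 'D_(X' x) F2 y).
    by apply: deriveD; exact: diff_derivable.
  congr (_ + _).
    rewrite /D2 -{1}(va Y').
    exact: (@derive_along _ _ _ (im i) (vloc i Z) (vloc i Y') y (X' x) oi Uy (sZ i) (sY' i)).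
  have := @derive_bil _ _ _ (fun k l => ch k l) (vloc i Y') (vloc i Z) y (X' x)
    (fun k l => chris_diff k l Nx) dY dZ.
  by rewrite (va Y') (va Z).
have sB := lie_bracket_smooth sX sY.
have D2C : D2 (X x) (Y x) = D2 (Y x) (X x).
  exact: (derive_comm_rV (Y x) (X x) oi Uy (sZ i)).
have dZ := smooth_differentiable (sZ i) Uy.
have DZB v w : DZ (v - w) = DZ v - DZ w by rewrite /DZ !(deriveE _ dZ) linearB.
have GaDl v v' w : Ga y (v + v') w = Ga y v w + Ga y v' w by exact: bilDl.
have GaDr v w w' : Ga y v (w + w') = Ga y v w + Ga y v w' by exact: bilDr.
have GaNl v w : Ga y (- v) w = - Ga y v w by exact: bilNl.
have LB : lie_bracket A X Y x = 'D_(X x) (vloc i Y) y - 'D_(Y x) (vloc i X) y.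
  by rewrite /y ix.
have E3 : nabla (lie_bracket A X Y) Z x
    = DZ (lie_bracket A X Y x) + Ga y (lie_bracket A X Y x) (Z x).
  exact: na.
rewrite /curvature (second X Y sX sY) (second Y X sY sX) E3 LB D2C.
move: ('D_(X x) (vloc i Y) y) ('D_(Y x) (vloc i X) y) => p q.
rewrite DZB !GaDl !GaDr !GaNl /curv_chart.
exact: rV_sum_curvature.
Qed.

Lemma curvature_atE x a b c : i = at_pt A x -> N (chart i x) ->
  curvature_at A nabla x a b c = curv_chart (chart i x) a b c.
Proof.
move=> ix Nx; rewrite /curvature_at.
set P := [set w | _]; have [|X [Y [Z [[sX sY sZ] [Xa Yb Zc ->]]]]] := @xgetPex _ 0 P.
  have [X sX Xa] := extend_vector hM x a.
  have [Y sY Yb] := extend_vector hM x b.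
  have [Z sZ Zc] := extend_vector hM x c.
  by exists (curvature A nabla X Y Z x), X, Y, Z.
by rewrite curvature_chart // Xa Yb Zc.
Qed.

End AtPoint.

Lemma curvature_at_field X Y Z x : smooth_vfield A X -> smooth_vfield A Y ->
  smooth_vfield A Z ->
  curvature_at A nabla x (X x) (Y x) (Z x) = curvature A nabla X Y Z x.
Proof.
move=> sX sY sZ; have [rho [N [co Nx]]] := cutoff_exists hM (dom_at hM x).
by rewrite (curvature_atE co) // (curvature_chart co).
Qed.

Definition Riem x a b c d : R := g x (curvature_at A nabla x a b c) d.

Lemma Riem_anti12 x a b c d : Riem x a b c d = - Riem x b a c d.
Proof.
have [rho [N [co Nx]]] := cutoff_exists hM (dom_at hM x).
by rewrite /Riem !(curvature_atE co) // curv_chart_antisym gNl.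
Qed.

Lemma Riem_anti34 x a b c d : Riem x a b c d = - Riem x a b d c.
Proof.
have [X sX <-] := extend_vector hM x a; have [Y sY <-] := extend_vector hM x b.
have [Z sZ <-] := extend_vector hM x c; have [W sW <-] := extend_vector hM x d.
by rewrite /Riem !curvature_at_field // curvature_antisym_g // g_sym.
Qed.

Lemma Riem_bianchi x a b c d :
  Riem x a b c d + Riem x b c a d + Riem x c a b d = 0.
Proof.
have [rho [N [co Nx]]] := cutoff_exists hM (dom_at hM x).
by rewrite /Riem !(curvature_atE co) // -!gDl (curv_chart_bianchi co) // g0l.
Qed.

(** The usual combination of the four cyclic identities obtained by rotating
    [(a, b, c, d)]. *)
Lemma Riem_pair x a b c d : Riem x a b c d = Riem x c d a b.
Proof.
have B1 := Riem_bianchi x a b c d; have B2 := Riem_bianchi x b c d a.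
have B3 := Riem_bianchi x c d a b; have B4 := Riem_bianchi x d a b c.
have := (Riem_anti34 x b c a d, Riem_anti34 x c a b d, Riem_anti34 x c d b a,
  Riem_anti34 x d b c a, Riem_anti34 x d a c b, Riem_anti34 x a c d b,
  Riem_anti34 x a b d c, Riem_anti34 x b d a c, Riem_anti34 x d a b c).
have := (Riem_anti12 x b d a c, Riem_anti12 x c a b d, Riem_anti12 x a d b c, Riem_anti12 x c a d b).
move=> [[[]]] ? ? ? ? [[[[[[[[]]]]]]]] ? ? ? ? ? ? ? ? ?; lra.
Qed.

End Curvature.

(** * The tangent bundle in charts *)

Section DeriveExtra.
Variables (R : realType).

Lemma diff_near (V W : normedModType R) (U : set V) (f h : V -> W) y v :
  open U -> U y -> (forall z, U z -> f z = h z) -> differentiable h y ->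
  'd f y v = 'D_v h y.
Proof.
move=> oU Uy fh dh.
have df : differentiable f y.
  by apply: (differentiable_near_eq oU Uy _ dh) => z Uz; rewrite fh.
transitivity ('D_v f y); first exact: (esym (deriveE v df)).
exact: derive_near_eq oU Uy fh.
Qed.

(** Along a fibre of the tangent bundle everything is affine, so directional
    derivatives are obtained there with no differentiability argument. *)
Lemma derive_affine (V W : normedModType R) (f : V -> W) y v c :
  (forall h : R, f (h *: v + y) = f y + h *: c) -> 'D_v f y = c.
Proof.
move=> fa.
have H : h^-1 *: (f (h *: v + y) - f y) @[h --> (0 : R)^'] --> c.
  apply: (@cvg_trans _ (c @[h --> (0 : R)^'])); last exact: cvg_cst.
  apply: near_eq_cvg; near=> h.
  have h0 : h != 0 by near: h; exact: nbhs_dnbhs_neq.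
  by rewrite fa addrAC subrr add0r scalerA mulVf // scale1r.
exact: cvg_lim H.
Unshelve. all: by end_near. Qed.

Lemma derive_lsubmx m n (W : normedModType R) (f : 'rV[R]_m -> W)
    (q c : 'rV[R]_(m + n)) : differentiable f (lsubmx q) ->
  'D_c (fun q => f (lsubmx q)) q = 'D_(lsubmx c) f (lsubmx q).
Proof.
move=> df; have dl := differentiable_lsubmx q.
transitivity ('D_('D_c lsubmx q) f (lsubmx q)); first exact: (derive_comp c dl df).
congr ('D_ _ f _); apply: (@derive_linear _ _ _ lsubmx); exact: continuous_lsubmx.
Qed.

Lemma derive_rsubmx m n (q c : 'rV[R]_(m + n)) :
  'D_c (fun q : 'rV[R]_(m + n) => rsubmx q) q = rsubmx c.
Proof. apply: (@derive_linear _ _ _ rsubmx); exact: continuous_rsubmx. Qed.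

Lemma smooth_lsubmx m n (U : set 'rV[R]_(m + n)) : smooth_on U (fun q => lsubmx q).
Proof. apply: (@smooth_linear _ _ _ U lsubmx); exact: continuous_lsubmx. Qed.

Lemma smooth_rsubmx m n (U : set 'rV[R]_(m + n)) : smooth_on U (fun q => rsubmx q).
Proof. apply: (@smooth_linear _ _ _ U rsubmx); exact: continuous_rsubmx. Qed.

Lemma open_lsubmx m n (U : set 'rV[R]_m) : open U ->
  open [set q : 'rV[R]_(m + n) | U (lsubmx q)].
Proof.
move=> oU; apply: (@open_comp _ _ (fun q : 'rV[R]_(m + n) => lsubmx q)) => // q _.
exact: continuous_lsubmx.
Qed.

Lemma smooth_comp_lsubmx m n (W : normedModType R) (U : set 'rV[R]_m)
    (f : 'rV[R]_m -> W) : open U -> smooth_on U f ->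
  smooth_on [set q : 'rV[R]_(m + n) | U (lsubmx q)] (fun q => f (lsubmx q)).
Proof.
move=> oU sf; apply: (@smooth_comp _ _ _ _ _ U (fun q : 'rV[R]_(m + n) => lsubmx q) f
  (fin_dim_rV R m) (open_lsubmx oU)) => //; exact: smooth_lsubmx.
Qed.

End DeriveExtra.

Section TangentBundle.
Variables (R : realType) (n : nat) (M : topologicalType) (A : atlas R n M).
Hypothesis hM : smooth_manifold A.
Variable nabla : vfield R n M -> vfield R n M -> vfield R n M.
Hypothesis hn : affine_connection A nabla.
Implicit Types (X Y : vfield R n M) (i j : idx A) (x z : M) (u v w : 'rV[R]_n).

Local Notation TM := (M * 'rV[R]_n)%type.
Local Notation TA := (tangent_atlas A).
Local Notation dom := (@chart_dom R n M A).
Local Notation im i := (chart i @` dom i).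
Local Notation ov i j := (chart i @` (dom i `&` dom j)).
Local Notation at_ := (at_pt A).

Definition tch i (p : TM) : 'rV[R]_(n + n) := row_mx (chart i p.1) (tcoord i p.1 p.2).
Definition tloc (W : normedModType R) i (F : TM -> W) : 'rV[R]_(n + n) -> W :=
  @loc R (n + n) TM TA W i F.
Definition tdom i : set 'rV[R]_(n + n) := [set q | im i (lsubmx q)].

Lemma tdom_open i : open (tdom i).
Proof. by apply: open_lsubmx; exact: (@im_open _ _ _ _ hM). Qed.

Lemma tch_tdom i p : dom i p.1 -> tdom i (tch i p).
Proof. by move=> ip; rewrite /tdom /tch /= row_mxKl; exists p.1. Qed.

Lemma tdomP i q : tdom i q -> exists z u, dom i z /\ q = tch i (z, u).
Proof.
move=> [z iz zq]; exists z, (tvec i z (rsubmx q)); split=> //.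
by rewrite /tch /= (tvecK hM) // zq hsubmxK.
Qed.

Lemma tdomE i : @chart R (n + n) TM TA i @` (@chart_dom R (n + n) TM TA i) = tdom i.
Proof.
apply/seteqP; split=> [_ [p ip <-]|q /tdomP[z [u [iz ->]]]]; first exact: tch_tdom.
by exists (z, u).
Qed.

Lemma tloc_chart (W : normedModType R) i (F : TM -> W) p : dom i p.1 ->
  tloc i F (tch i p) = F p.
Proof.
move=> ip; rewrite /tloc /loc.
have := @xgetPex _ 0 [set w | exists x : TM, [/\ @chart_dom R (n + n) TM TA i x,
  @chart R (n + n) TM TA i x = tch i p & F x = w]].
case; first by exists (F p), p.
move=> [z v] [/= iz zp <-]; case: p ip zp => z' v' /= iz' /eq_row_mx[zz vv].
have E : z = z' by apply: (chart_inj hM _ _ zz); rewrite inE.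
by subst z'; rewrite (tcoord_inj hM iz' vv).
Qed.

Lemma tch_at x u : tch (at_ x) (x, u) = row_mx (chart (at_ x) x) u.
Proof. by rewrite /tch /= (tcoord_at hM). Qed.

Lemma tdom_at x u : tdom (at_ x) (tch (at_ x) (x, u)).
Proof. by apply: tch_tdom; exact: (dom_at hM). Qed.

(** The transition map of the tangent bundle. *)
Definition ttrans i j (q : 'rV[R]_(n + n)) : 'rV[R]_(n + n) :=
  row_mx (trans i j (lsubmx q)) ('d (trans i j) (lsubmx q) (rsubmx q)).

Lemma tov_open i j : open [set q : 'rV[R]_(n + n) | ov i j (lsubmx q)].
Proof. by apply: open_lsubmx; exact: (@overlap_open _ _ _ _ hM). Qed.

Lemma tloc_tch i j q : ov i j (lsubmx q) -> tloc i (tch j) q = ttrans i j q.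
Proof.
move=> [z [iz jz] zq].
have [z' [v [iz' qE]]] : exists z u, dom i z /\ q = tch i (z, u).
  by apply: tdomP; exists z.
have E : z = z'.
  have : chart i z = chart i z' by rewrite zq qE /tch row_mxKl.
  by apply: (chart_inj hM); rewrite inE.
subst z'; rewrite qE; transitivity (tch j (z, v)); first exact: tloc_chart.
have l : lsubmx (tch i (z, v)) = chart i z by exact: row_mxKl.
have r : rsubmx (tch i (z, v)) = tcoord i z v by exact: row_mxKr.
rewrite /ttrans l r (trans_chart hM j iz).
congr row_mx; exact: (esym (dtrans_tcoord hM v iz jz)).
Qed.

Lemma ttrans_smooth i j :
  smooth_on [set q : 'rV[R]_(n + n) | ov i j (lsubmx q)] (ttrans i j).
Proof.
have oo := @tov_open i j; have st := @trans_smooth _ _ _ _ hM i j.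
have oij := @overlap_open _ _ _ _ hM i j.
apply: (smooth_row_mx oo); first exact: smooth_comp_lsubmx.
exact: (@smooth_diff _ _ _ _ _ (ov i j) (fun q : 'rV[R]_(n + n) => lsubmx q)
  (trans i j) (fun q => rsubmx q) (fin_dim_rV R n) oo (fun q Hq => Hq)
  (smooth_lsubmx _) (smooth_rsubmx _) st).
Qed.

Lemma tcoord_ttrans j x u a : dom j x ->
  @tcoord R (n + n) TM TA j (x, u) a
  = 'D_a (ttrans (at_ x) j) (tch (at_ x) (x, u)).
Proof.
move=> jx; have dx := dom_at hM x.
have Oq : [set q : 'rV[R]_(n + n) | ov (at_ x) j (lsubmx q)] (tch (at_ x) (x, u)).
  by rewrite /= /tch row_mxKl; exists x.
have dt := smooth_differentiable (@ttrans_smooth (at_ x) j) Oq.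
apply: (diff_near a (@tov_open (at_ x) j) Oq _ dt) => q Hq.
exact: tloc_tch.
Qed.

(** * Sections *)

Lemma section_diff i Y x : smooth_vfield A Y -> dom i x ->
  differentiable (fun y => row_mx y (vloc i Y y)) (chart i x).
Proof.
move=> sY ix; apply: differentiable_row_mx; last exact: vloc_diff.
have [] := @is_diff_id _ _ (chart i x).
by [].
Qed.

Lemma derive_section i Y x v : smooth_vfield A Y -> dom i x ->
  'D_v (fun y => row_mx y (vloc i Y y)) (chart i x)
  = row_mx v ('D_v (vloc i Y) (chart i x)).
Proof.
move=> sY ix.
have did : differentiable (fun y : 'rV[R]_n => y) (chart i x).
  by have [] := @is_diff_id _ _ (chart i x).
transitivity (row_mx ('D_v (fun y : 'rV[R]_n => y) (chart i x)) ('D_v (vloc i Y) (chart i x))).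
  by apply: derive_row_mx => //; exact: vloc_diff.
by congr row_mx; exact: derive_id.
Qed.

Lemma loc_section i j Y y : ov i j y ->
  loc i (fun z => tch j (z, Y z)) y = ttrans i j (row_mx y (vloc i Y y)).
Proof.
move=> [z [iz jz] <-]; rewrite (loc_chart hM) // (vloc_chart hM) //.
have -> : row_mx (chart i z) (tcoord i z (Y z)) = tch i (z, Y z) by [].
by rewrite -tloc_tch ?tloc_chart // /tch row_mxKl; exists z.
Qed.

Lemma loc_section_id j Y y : im j y ->
  loc j (fun z => tch j (z, Y z)) y = row_mx y (vloc j Y y).
Proof. by move=> [z jz <-]; rewrite (loc_chart hM) // (vloc_chart hM). Qed.

(** The vector tangent to the section [Y] has the derivative of its local expression
    as vertical component: this is the link between horizontal lifts and covariant
    derivatives. *)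
Lemma tmap_section Y x v : smooth_vfield A Y ->
  tmap A TA (fun z => (z, Y z)) x v
  = row_mx v ('D_v (vloc (at_ x) Y) (chart (at_ x) x)).
Proof.
move=> sY; have dx := dom_at hM x.
rewrite -derive_section //.
apply: (diff_near v (@im_open _ _ _ _ hM (at_ x)) _ _ (section_diff sY dx)).
  by exists x.
by move=> y; exact: loc_section_id.
Qed.

(** The chain rule is applied along the section, on [M], which spares the derivative
    of [ttrans]. *)
Lemma tcoord_section j Y x v : smooth_vfield A Y -> dom j x ->
  @tcoord R (n + n) TM TA j (x, Y x) (tmap A TA (fun z => (z, Y z)) x v)
  = row_mx (tcoord j x v) ('D_(tcoord j x v) (vloc j Y) (chart j x)).
Proof.
move=> sY jx; have dx := dom_at hM x; set i := at_ x in dx *.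
have ds := section_diff sY dx.
rewrite tcoord_ttrans // tmap_section // -/i.
rewrite -derive_section //.
have E : tch i (x, Y x) = row_mx (chart i x) (vloc i Y (chart i x)).
  by rewrite (vloc_chart hM).
have Oq : [set q : 'rV[R]_(n + n) | ov i j (lsubmx q)] (row_mx (chart i x) (vloc i Y (chart i x))).
  by rewrite /= row_mxKl; exists x.
have dt := smooth_differentiable (@ttrans_smooth i j) Oq.
rewrite E.
transitivity ('D_v (loc i (fun z => tch j (z, Y z))) (chart i x)).
  transitivity ('D_v (ttrans i j \o (fun y => row_mx y (vloc i Y y))) (chart i x)).
    exact: (esym (derive_comp v ds dt)).
  apply: (derive_near_eq v (@overlap_open _ _ _ _ hM i j)); first by exists x.
  by move=> y Oy; rewrite loc_section.
have dj : differentiable (loc j (fun z => tch j (z, Y z))) (chart j x).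
  apply: (@differentiable_near_eq _ _ _ (im j) _ _ _ (@im_open _ _ _ _ hM j) _ _
    (section_diff sY jx)); first by exists x.
  by move=> y Uy; exact: (esym (@loc_section_id j Y y Uy)).
transitivity ('D_(dtrans i j x v) (loc j (fun z => tch j (z, Y z))) (chart j x)).
  exact: (derive_loc hM v dx jx dj).
rewrite -derive_section //.
apply: (derive_near_eq _ (@im_open _ _ _ _ hM j)); first by exists x.
by move=> y Uy; exact: loc_section_id.
Qed.

Lemma dprojE x u a : dproj A (x, u) a = lsubmx a.
Proof.
have dx := dom_at hM x.
have dl := differentiable_lsubmx (tch (at_ x) (x, u)).
transitivity ('D_a (fun q : 'rV[R]_(n + n) => lsubmx q) (tch (at_ x) (x, u))); last first.
  by apply: (@derive_linear _ _ _ lsubmx); exact: continuous_lsubmx.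
apply: (diff_near a (@tdom_open (at_ x)) (@tdom_at x u) _ dl).
move=> _ /tdomP[z [w [iz ->]]].
transitivity (tloc (at_ x) (fun q => chart (at_ x) q.1) (tch (at_ x) (z, w))) => //.
by rewrite tloc_chart // /tch row_mxKl.
Qed.

(** * Horizontal lifts *)

Section AtPoint.
Variables (x : M).
Let i := at_ x.
Variables (rho : 'rV[R]_n -> R) (N : set 'rV[R]_n).
Hypothesis co : cutoff i rho N.
Hypothesis Nx : N (chart i x).

Local Notation Ga := (@Gam R n M A nabla i rho).

Lemma nabla_at X Y : smooth_vfield A X -> smooth_vfield A Y ->
  nabla X Y x = 'D_(X x) (vloc i Y) (chart i x) + Ga (chart i x) (X x) (Y x).
Proof.
move=> sX sY; have := nabla_chart hM hn co sX sY (dom_at hM x) Nx.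
by rewrite !(tcoord_at hM).
Qed.

(** In the chart at [x] the field may be chosen affine, with linear part opposite to
    the Christoffel term. *)
Lemma parallel_section u v : exists Y, [/\ smooth_vfield A Y, Y x = u &
  forall X, smooth_vfield A X -> X x = v -> nabla X Y x = 0].
Proof.
have dx := dom_at hM x; pose y0 := chart i x.
(* the value at [y0] is [u], and the derivative along [v] is [- Ga y0 v u] *)
pose eta y := u - (Ga y0 y u - Ga y0 y0 u).
have seta : smooth_on (im i) eta.
  have oi := @im_open _ _ _ _ hM i.
  apply: (smoothB oi); first exact: smooth_cst.
  apply: (smoothB oi); last exact: smooth_cst.
  apply: (smooth_bil oi); [|exact: smooth_id|exact: smooth_cst].
  by move=> k l; exact: smooth_cst.
have vE y : N y -> vloc i (@ext_vfield R n M A i rho eta) y = eta y.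
  exact: (vloc_ext_vfield hM _ co).
have Yx : @ext_vfield R n M A i rho eta x = u.
  have := vE _ Nx; rewrite (vloc_at hM) => ->.
  by rewrite /eta subrr subr0.
have sY : smooth_vfield A (@ext_vfield R n M A i rho eta).
  exact: (ext_vfield_smooth hM co).
exists (@ext_vfield R n M A i rho eta); split=> // X sX Xx.
rewrite nabla_at // Xx Yx.
have -> : 'D_v (vloc i (@ext_vfield R n M A i rho eta)) (chart i x) = - Ga y0 v u.
  transitivity ('D_v eta y0).
    by apply: derive_near_eq (cutoff_open co) Nx _ => y; exact: vE.
  apply: derive_affine => h; rewrite /eta.
  have -> : Ga y0 (h *: v + y0) u = h *: Ga y0 v u + Ga y0 y0 u.
    exact: bil_linearl.
  by rewrite addrK subrr subr0 scalerN.
by rewrite addNr.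
Qed.

Lemma horizontalE u a : horizontal A nabla (x, u) a ->
  a = row_mx (lsubmx a) (- Ga (chart i x) (lsubmx a) u).
Proof.
move=> [X [Y [sX sY /= Yx nXY ->]]].
rewrite tmap_section // row_mxKl; congr row_mx.
have := nabla_at sX sY; rewrite nXY Yx => /esym/eqP.
by rewrite addr_eq0 => /eqP.
Qed.

(** By [nabla_at], the condition that the covariant derivative vanishes prescribes
    the vertical component of a horizontal vector in terms of its projection; hence
    uniqueness. Existence is [parallel_section]. *)
Lemma hliftE u v : hlift A nabla (x, u) v = row_mx v (- Ga (chart i x) v u).
Proof.
have [Y [sY Yx pY]] := parallel_section u v.
have [X sX Xx] := extend_vector hM x v.
rewrite /hlift; set P := [set a | _].
have [|/= hz] := @xgetPex _ 0 P.
  exists (tmap A TA (fun z => (z, Y z)) x v); split.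
    by exists X, Y; split=> //; [exact: pY|rewrite Xx].
  by rewrite dprojE tmap_section // row_mxKl.
by rewrite dprojE => lv; rewrite [LHS](horizontalE hz) lv.
Qed.

Lemma hlift_section u v Y : smooth_vfield A Y -> Y x = u ->
  (forall X, smooth_vfield A X -> X x = v -> nabla X Y x = 0) ->
  hlift A nabla (x, u) v = tmap A TA (fun z => (z, Y z)) x v.
Proof.
move=> sY Yx pY; have [X sX Xx] := extend_vector hM x v.
rewrite hliftE tmap_section //; congr row_mx.
have := nabla_at sX sY; rewrite (pY X sX Xx) Yx Xx => /esym/eqP.
by rewrite addr_eq0 => /eqP ->.
Qed.

End AtPoint.

Lemma hlift_tmap x u v : exists Y, [/\ smooth_vfield A Y, Y x = u,
  forall X, smooth_vfield A X -> X x = v -> nabla X Y x = 0 &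
  hlift A nabla (x, u) v = tmap A TA (fun z => (z, Y z)) x v].
Proof.
have [rho [N [co Nx]]] := cutoff_exists hM (dom_at hM x).
have [Y [sY Yx pY]] := parallel_section co Nx u v.
by exists Y; split=> //; exact: (hlift_section co).
Qed.

Lemma tcoord_hlift j rho N x u v : cutoff j rho N -> dom j x -> N (chart j x) ->
  @tcoord R (n + n) TM TA j (x, u) (hlift A nabla (x, u) v)
  = row_mx (tcoord j x v)
      (- @Gam R n M A nabla j rho (chart j x) (tcoord j x v) (tcoord j x u)).
Proof.
move=> co jx Nx; have [Y [sY Yx pY ->]] := hlift_tmap x u v.
have [X sX Xx] := extend_vector hM x v.
rewrite -Yx tcoord_section //; congr row_mx.
have := nabla_chart hM hn co sX sY jx Nx.
rewrite (pY X sX Xx) linear0 Xx => /esym/eqP.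
by rewrite addr_eq0 => /eqP.
Qed.

Lemma hlift_linear x u : linear (hlift A nabla (x, u)).
Proof.
have [rho [N [co Nx]]] := cutoff_exists hM (dom_at hM x).
move=> a v w; rewrite !(hliftE co) // scale_row_mx add_row_mx; congr row_mx.
rewrite scalerN -opprD; congr (- _); exact: bil_linearl.
Qed.

(** * Vertical lifts *)

(** In a chart the function [df] is linear on the fibres, with the partial
    derivatives of [f] as coefficients. *)
Lemma vderiv_df x u w (f : M -> R) : smooth_fun A f ->
  vderiv TA (x, u) (row_mx 0 w) (fun q => vderiv A q.1 q.2 f)
  = vderiv A x w f.
Proof.
move=> sf; have dx := dom_at hM x; set i := at_ x in dx *.
have df y : im i y -> differentiable (loc i f) y.
  by apply: smooth_differentiable; exact: sf.
have Ux : im i (chart i x) by exists x.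
transitivity ('D_(row_mx 0 w) (fun q : 'rV[R]_(n + n) =>
    'd (loc i f) (lsubmx q) (rsubmx q)) (tch i (x, u))).
  apply: (derive_near_eq _ (@tdom_open i) (@tdom_at x u)) => _ /tdomP[z [v [iz ->]]].
  transitivity (vderiv A z v f).
    by rewrite -[LHS]/(tloc i (fun q => vderiv A q.1 q.2 f) (tch i (z, v))) tloc_chart.
  have dz : differentiable (loc i f) (chart i z) by apply: df; exists z.
  rewrite /tch row_mxKl row_mxKr /= (vderivE hM v iz dz).
  exact: deriveE.
transitivity ('d (loc i f) (chart i x) w).
  apply: derive_affine => h.
  rewrite tch_at scale_row_mx add_row_mx scaler0 add0r !row_mxKl !row_mxKr.
  by rewrite linearP addrC.
exact: (esym (deriveE w (df _ Ux))).
Qed.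

(** The coordinate functions, cut off, separate tangent vectors. *)
Lemma vderiv_inj x v w : (forall f, smooth_fun A f -> vderiv A x v f = vderiv A x w f) ->
  v = w.
Proof.
move=> H; have dx := dom_at hM x.
have [rho [N [co Nx]]] := cutoff_exists hM dx; set i := at_ x in dx co Nx.
apply/rowP => m.
have sid : smooth_on (im i) (fun y : 'rV[R]_n => y 0 m).
  apply: smooth_coord; first exact: (@im_open _ _ _ _ hM).
  exact: smooth_id.
pose f := @ext_fun R n M A i rho (fun y => y 0 m).
have sf : smooth_fun A f by exact: (ext_fun_smooth hM co).
have vf a : vderiv A x a f = a 0 m.
  transitivity ('D_a (coord_fun m) (chart i x)); last first.
    by apply: derive_linear; exact: coord_fun_continuous.
  apply: derive_near_eq (cutoff_open co) Nx _ => y Ny.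
  have [z iz zy] := cutoff_sub co Ny; rewrite -zy in Ny *.
  by rewrite (loc_chart hM) // /f ext_funE // (cutoff_one co Ny) mul1r.
by rewrite -!vf H.
Qed.

Lemma vliftE x u v : vlift A (x, u) v = row_mx 0 v.
Proof.
rewrite /vlift; set P := [set a | _].
have [|/= va Ha] := @xgetPex _ 0 P.
  exists (row_mx 0 v); split=> [|f sf]; first by rewrite /vertical /= dprojE row_mxKl.
  exact: vderiv_df.
move: (xget 0 P) va Ha => a va Ha.
have aE : a = row_mx 0 (rsubmx a).
  by move: va; rewrite /vertical /= dprojE => l0; rewrite -{1}[a]hsubmxK l0.
rewrite aE; congr row_mx; apply: (@vderiv_inj x) => f sf.
transitivity (vderiv TA (x, u) (row_mx 0 (rsubmx a)) (fun q => vderiv A q.1 q.2 f)).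
  exact: (esym (vderiv_df x u (rsubmx a) sf)).
by rewrite -aE; exact: Ha.
Qed.

Lemma tcoord_vlift j x u v : dom j x ->
  @tcoord R (n + n) TM TA j (x, u) (vlift A (x, u) v) = row_mx 0 (tcoord j x v).
Proof.
move=> jx; rewrite tcoord_ttrans // vliftE tch_at.
apply: derive_affine => h.
rewrite /ttrans scale_row_mx add_row_mx scaler0 add0r !row_mxKl !row_mxKr.
rewrite scale_row_mx add_row_mx scaler0 addr0; congr row_mx.
by rewrite linearP addrC.
Qed.

(** * The lifts of a smooth field are smooth *)

(** Components of the horizontal lift of [X] in a chart of the tangent bundle. *)
Definition hloc i (rho : 'rV[R]_n -> R) X (q : 'rV[R]_(n + n)) : 'rV[R]_(n + n) :=
  row_mx (vloc i X (lsubmx q))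
    (- @Gam R n M A nabla i rho (lsubmx q) (vloc i X (lsubmx q)) (rsubmx q)).

(** Components of the vertical lift of [X]. *)
Definition wloc i X (q : 'rV[R]_(n + n)) : 'rV[R]_(n + n) :=
  row_mx 0 (vloc i X (lsubmx q)).

Local Notation Xh X := (hlift_vfield A nabla X).
Local Notation Xv X := (vlift_vfield A X).
Local Notation tvloc i Z := (tloc i (fun p => @tcoord R (n + n) TM TA i p (Z p))).

Lemma tvloc_hlift i rho N X q : cutoff i rho N -> N (lsubmx q) ->
  tvloc i (Xh X) q = hloc i rho X q.
Proof.
move=> co Nq; have [z [u [iz qE]]] := tdomP (cutoff_sub co Nq).
rewrite qE in Nq *; rewrite tloc_chart // /hloc.
rewrite /tch row_mxKl in Nq; rewrite /tch row_mxKl row_mxKr.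
by rewrite (tcoord_hlift _ _ co iz Nq) (vloc_chart hM).
Qed.

Lemma tvloc_vlift i X q : tdom i q -> tvloc i (Xv X) q = wloc i X q.
Proof.
move=> /tdomP[z [u [iz ->]]]; rewrite tloc_chart // /wloc /tch row_mxKl /=.
by rewrite tcoord_vlift // (vloc_chart hM).
Qed.

Lemma wloc_smooth i X : smooth_vfield A X -> smooth_on (tdom i) (wloc i X).
Proof.
move=> sX; apply: (smooth_row_mx (@tdom_open i)); first exact: smooth_cst.
by apply: smooth_comp_lsubmx; [exact: (@im_open _ _ _ _ hM)|exact: sX].
Qed.

Lemma hloc_smooth i rho N X : cutoff i rho N -> smooth_vfield A X ->
  smooth_on (tdom i) (hloc i rho X).
Proof.
move=> co sX; have oi := @im_open _ _ _ _ hM i; have ot := @tdom_open i.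
have sX' : smooth_on (tdom i) (fun q => vloc i X (lsubmx q)).
  by apply: smooth_comp_lsubmx => //; exact: sX.
apply: (smooth_row_mx ot) => //; apply: (smoothN ot).
apply: (@smooth_bil _ _ _
  (fun k l q => @chris R n M A nabla i rho k l (lsubmx q))
  (fun q => vloc i X (lsubmx q)) (fun q => rsubmx q) _ ot) => //.
  move=> k l; apply: (@smooth_comp_lsubmx _ _ _ _ (im i)) => //.
  exact: (chris_smooth hM hn co).
exact: smooth_rsubmx.
Qed.

Lemma vlift_smooth X : smooth_vfield A X -> smooth_vfield TA (Xv X).
Proof.
move=> sX i; rewrite tdomE.
apply: (smooth_eq (@tdom_open i) _ (@wloc_smooth i X sX)) => q qd.
exact: (esym (@tvloc_vlift i X q qd)).
Qed.

Lemma hlift_smooth X : smooth_vfield A X -> smooth_vfield TA (Xh X).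
Proof.
move=> sX i; rewrite tdomE; apply: smooth_local => q0 /tdomP[z [u [iz ->]]].
have [rho [N [co Nz]]] := cutoff_exists hM iz.
have oN := open_lsubmx (n := n) (cutoff_open co).
exists [set q : 'rV[R]_(n + n) | N (lsubmx q)]; split=> //.
  by rewrite /= /tch row_mxKl.
apply: (smooth_eq oN _ (smooth_sub _ (hloc_smooth co sX))) => q Nq.
  exact: (esym (tvloc_hlift X co Nq)).
exact: (cutoff_sub co).
Qed.

(** * Brackets of lifts *)

Section BracketsAt.
Variables (x : M) (u : 'rV[R]_n).
Let i := at_ x.
Variables (rho : 'rV[R]_n -> R) (N : set 'rV[R]_n).
Hypothesis co : cutoff i rho N.
Hypothesis Nx : N (chart i x).
Let y := chart i x.
Let q0 := tch i (x, u).

Local Notation Ga := (@Gam R n M A nabla i rho).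
Local Notation dGa := (@dGam R n M A nabla i rho).

Lemma tch_pt : q0 = row_mx y u. Proof. exact: tch_at. Qed.
Lemma lsubmx_tch_pt : lsubmx q0 = y. Proof. by rewrite tch_pt row_mxKl. Qed.
Lemma rsubmx_tch_pt : rsubmx q0 = u. Proof. by rewrite tch_pt row_mxKr. Qed.
Lemma im_chart_pt : im i y. Proof. by exists x => //; exact: (dom_at hM). Qed.
Lemma vloc_pt X : vloc i X y = X x. Proof. exact: (vloc_at hM). Qed.

Lemma derive_tvloc_vlift X c : smooth_vfield A X ->
  'D_c (tvloc i (Xv X)) q0 = row_mx 0 ('D_(lsubmx c) (vloc i X) y).
Proof.
move=> sX; have dX := smooth_differentiable (sX i) im_chart_pt.
transitivity ('D_c (wloc i X) q0).
  apply: (derive_near_eq c (@tdom_open i)); first exact: tdom_at.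
  by move=> q; exact: tvloc_vlift.
have dX' : differentiable (vloc i X) (lsubmx q0) by rewrite lsubmx_tch_pt.
have dl : differentiable (fun q : 'rV[R]_(n + n) => vloc i X (lsubmx q)) q0.
  by apply: (@differentiable_comp _ _ _ _ lsubmx (vloc i X)) => //; exact: differentiable_lsubmx.
transitivity (row_mx ('D_c (cst (0 : 'rV[R]_n)) q0)
    ('D_c (fun q : 'rV[R]_(n + n) => vloc i X (lsubmx q)) q0)).
  by apply: derive_row_mx => //; exact: differentiable_cst.
congr row_mx; first exact: derive_cst.
by rewrite -lsubmx_tch_pt; exact: derive_lsubmx.
Qed.

Lemma derive_tvloc_hlift X c : smooth_vfield A X ->
  'D_c (tvloc i (Xh X)) q0 = row_mx ('D_(lsubmx c) (vloc i X) y)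
    (- (dGa y (lsubmx c) (X x) u + Ga y ('D_(lsubmx c) (vloc i X) y) u
        + Ga y (X x) (rsubmx c))).
Proof.
move=> sX; have dX := smooth_differentiable (sX i) im_chart_pt.
transitivity ('D_c (hloc i rho X) q0).
  apply: (derive_near_eq c (open_lsubmx (n := n) (cutoff_open co))).
    by rewrite /= lsubmx_tch_pt.
  by move=> q Nq; exact: tvloc_hlift Nq.
have dX' : differentiable (vloc i X) (lsubmx q0) by rewrite lsubmx_tch_pt.
have dlsub := differentiable_lsubmx q0.
have dl : differentiable (fun q : 'rV[R]_(n + n) => vloc i X (lsubmx q)) q0.
  exact: (@differentiable_comp _ _ _ _ lsubmx (vloc i X)).
have dr : differentiable (fun q : 'rV[R]_(n + n) => rsubmx q) q0.
  exact: differentiable_rsubmx.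
have dch k l : differentiable (@chris R n M A nabla i rho k l) (lsubmx q0).
  rewrite lsubmx_tch_pt; apply: (smooth_differentiable (chris_smooth hM hn co k l)).
  exact: im_chart_pt.
have dchl k l : differentiable (fun q : 'rV[R]_(n + n) =>
    @chris R n M A nabla i rho k l (lsubmx q)) q0.
  exact: (@differentiable_comp _ _ _ _ lsubmx (@chris R n M A nabla i rho k l)).
have Dl : 'D_c (fun q : 'rV[R]_(n + n) => vloc i X (lsubmx q)) q0
    = 'D_(lsubmx c) (vloc i X) y.
  transitivity ('D_(lsubmx c) (vloc i X) (lsubmx q0)); first exact: derive_lsubmx.
  by rewrite lsubmx_tch_pt.
have vx : vloc i X (lsubmx q0) = X x by rewrite lsubmx_tch_pt (vloc_pt X).
pose F (q : 'rV[R]_(n + n)) := Ga (lsubmx q) (vloc i X (lsubmx q)) (rsubmx q).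
have dF : differentiable F q0.
  have sXl : smooth_on (tdom i) (fun q => vloc i X (lsubmx q)).
    by apply: smooth_comp_lsubmx; [exact: (@im_open _ _ _ _ hM)|exact: sX].
  have sF : smooth_on (tdom i) F.
    apply: (@smooth_bil _ _ _
      (fun k l q => @chris R n M A nabla i rho k l (lsubmx q))
      (fun q => vloc i X (lsubmx q)) (fun q => rsubmx q) _ (@tdom_open i)) => //.
      move=> k l; apply: (@smooth_comp_lsubmx _ _ _ _ (im i)).
        exact: (@im_open _ _ _ _ hM).
      exact: (chris_smooth hM hn co).
    exact: smooth_rsubmx.
  by apply: (smooth_differentiable sF); exact: tdom_at.
have dNF : differentiable (fun q => - F q) q0 by exact: differentiableN.
have Dch : (fun k l => 'D_c (fun q : 'rV[R]_(n + n) =>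
    @chris R n M A nabla i rho k l (lsubmx q)) q0)
    = fun k l => 'D_(lsubmx c) (@chris R n M A nabla i rho k l) y.
  apply/funext => k; apply/funext => l.
  transitivity ('D_(lsubmx c) (@chris R n M A nabla i rho k l) (lsubmx q0)).
    exact: derive_lsubmx.
  by rewrite lsubmx_tch_pt.
have Dr : 'D_c (fun q : 'rV[R]_(n + n) => rsubmx q) q0 = rsubmx c by exact: derive_rsubmx.
have B := @derive_bil _ _ _
  (fun k l (q : 'rV[R]_(n + n)) => @chris R n M A nabla i rho k l (lsubmx q))
  (fun q => vloc i X (lsubmx q)) (fun q => rsubmx q) q0 c dchl dl dr.
rewrite Dch Dl vx Dr rsubmx_tch_pt lsubmx_tch_pt in B.
have E2 : 'D_c (fun q => - F q) q0
    = - (dGa y (lsubmx c) (X x) u + Ga y ('D_(lsubmx c) (vloc i X) y) u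
        + Ga y (X x) (rsubmx c)).
  transitivity (- 'D_c F q0); first exact: (deriveN (diff_derivable dF)).
  exact: (f_equal -%R B).
transitivity (row_mx ('D_c (fun q : 'rV[R]_(n + n) => vloc i X (lsubmx q)) q0)
    ('D_c (fun q => - F q) q0)).
  exact: derive_row_mx.
by rewrite Dl E2.
Qed.

Lemma dGam0l v w : dGa y 0 v w = 0.
Proof.
rewrite /dGam /bil big1 // => k _; rewrite big1 // => l _.
by rewrite derive0 scaler0.
Qed.

Lemma Gam0l w : Ga y 0 w = 0.
Proof. exact: bil0l. Qed.

Lemma bracket_vv X Y : smooth_vfield A X -> smooth_vfield A Y ->
  lie_bracket TA (Xv X) (Xv Y) (x, u) = 0.
Proof.
move=> sX sY.
have E1 : 'D_(Xv X (x, u)) (tvloc i (Xv Y)) q0 = 0.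
  apply: etrans (derive_tvloc_vlift (Xv X (x, u)) sY) _.
  have l : lsubmx (Xv X (x, u)) = 0 by rewrite /vlift_vfield /= vliftE row_mxKl.
  by rewrite l derive0; exact: row_mx0.
have E2 : 'D_(Xv Y (x, u)) (tvloc i (Xv X)) q0 = 0.
  apply: etrans (derive_tvloc_vlift (Xv Y (x, u)) sX) _.
  have l : lsubmx (Xv Y (x, u)) = 0 by rewrite /vlift_vfield /= vliftE row_mxKl.
  by rewrite l derive0; exact: row_mx0.
apply: etrans (f_equal2 (fun a b => a - b) E1 E2) _; exact: subrr.
Qed.

Lemma bracket_hv X Y : smooth_vfield A X -> smooth_vfield A Y ->
  lie_bracket TA (Xh X) (Xv Y) (x, u) = vlift A (x, u) (nabla X Y x).
Proof.
move=> sX sY.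
have E1 : 'D_(Xh X (x, u)) (tvloc i (Xv Y)) q0 = row_mx 0 ('D_(X x) (vloc i Y) y).
  apply: etrans (derive_tvloc_vlift (Xh X (x, u)) sY) _.
  have l : lsubmx (Xh X (x, u)) = X x by rewrite /hlift_vfield /= (hliftE co) // row_mxKl.
  by rewrite l.
have E2 : 'D_(Xv Y (x, u)) (tvloc i (Xh X)) q0 = row_mx 0 (- Ga y (X x) (Y x)).
  apply: etrans (derive_tvloc_hlift (Xv Y (x, u)) sX) _.
  have l : lsubmx (Xv Y (x, u)) = 0 by rewrite /vlift_vfield /= vliftE row_mxKl.
  have r : rsubmx (Xv Y (x, u)) = Y x by rewrite /vlift_vfield /= vliftE row_mxKr.
  by rewrite l r derive0 dGam0l Gam0l !add0r.
apply: etrans (f_equal2 (fun a b => a - b) E1 E2) _.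
rewrite vliftE (nabla_at co Nx) //.
by rewrite opp_row_mx add_row_mx oppr0 addr0 opprK.
Qed.

(** The vertical component of the bracket consists of derivatives of the Christoffel
    map, of quadratic terms in it, which together make up the curvature, and of its
    value on the bracket of [X] and [Y], which completes the horizontal lift. *)
Lemma bracket_hh X Y : smooth_vfield A X -> smooth_vfield A Y ->
  lie_bracket TA (Xh X) (Xh Y) (x, u)
  = hlift A nabla (x, u) (lie_bracket A X Y x)
    - vlift A (x, u) (@curv_chart R n M A nabla i rho y (X x) (Y x) u).
Proof.
move=> sX sY.
have E X' Y' : smooth_vfield A Y' -> 'D_(Xh X' (x, u)) (tvloc i (Xh Y')) q0
    = row_mx ('D_(X' x) (vloc i Y') y)
    (- (dGa y (X' x) (Y' x) u + Ga y ('D_(X' x) (vloc i Y') y) u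
        + Ga y (Y' x) (- Ga y (X' x) u))).
  move=> sY'; apply: etrans (derive_tvloc_hlift (Xh X' (x, u)) sY') _.
  have l : lsubmx (Xh X' (x, u)) = X' x.
    by rewrite /hlift_vfield /= (hliftE co) // row_mxKl.
  have r : rsubmx (Xh X' (x, u)) = - Ga y (X' x) u.
    by rewrite /hlift_vfield /= (hliftE co) // row_mxKr.
  by rewrite l r.
apply: etrans (f_equal2 (fun a b => a - b) (E X Y sY) (E Y X sX)) _.
rewrite vliftE (hliftE co) //.
rewrite !opp_row_mx !add_row_mx oppr0 addr0.
have LB : lie_bracket A X Y x = 'D_(X x) (vloc i Y) y - 'D_(Y x) (vloc i X) y by [].
rewrite LB; congr row_mx; rewrite -/i -/y.
move: ('D_(X x) (vloc i Y) y) ('D_(Y x) (vloc i X) y) => a b.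
have GDl v v' w : Ga y (v - v') w = Ga y v w - Ga y v' w.
  by apply: etrans (bilDl _ _ _ _) _; congr (_ + _); exact: bilNl.
have GNr v w : Ga y v (- w) = - Ga y v w by exact: bilNr.
rewrite GDl !GNr /curv_chart.
exact: rV_sum_bracket.
Qed.

End BracketsAt.

(** * Derivatives of functions along lifts *)

Lemma vderiv_vlift x u v (F : TM -> R) :
  vderiv TA (x, u) (vlift A (x, u) v) F = 'D_v (fun w => F (x, w)) u.
Proof.
have dx := dom_at hM x.
rewrite vliftE -[LHS]/('D_(row_mx 0 v) (tloc (at_ x) F) (tch (at_ x) (x, u))).
have E w : tloc (at_ x) F (row_mx (chart (at_ x) x) w) = F (x, w).
  by rewrite -tch_at tloc_chart.
apply: (f_equal (fun k : R -> R => lim (k h @[h --> (0 : R)^']))).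
apply/funext => h /=; rewrite tch_at E.
by rewrite scale_row_mx add_row_mx scaler0 add0r E.
Qed.

(** Along a vector tangent to the section [Y], a function on the tangent bundle may be
    replaced by its restriction to this section. *)
Lemma vderiv_hlift x v Y (F : TM -> R) : smooth_vfield A Y ->
  differentiable (tloc (at_ x) F) (tch (at_ x) (x, Y x)) ->
  vderiv TA (x, Y x) (tmap A TA (fun z => (z, Y z)) x v) F
  = vderiv A x v (fun z => F (z, Y z)).
Proof.
move=> sY dF; have dx := dom_at hM x; set i := at_ x in dx dF *.
have ds := section_diff sY dx.
have E : tch i (x, Y x) = row_mx (chart i x) (vloc i Y (chart i x)).
  by rewrite (vloc_chart hM).
rewrite -[LHS]/('D_(tmap A TA (fun z => (z, Y z)) x v) (tloc i F) (tch i (x, Y x))).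
rewrite tmap_section // -derive_section //.
rewrite E in dF *.
transitivity ('D_v (tloc i F \o (fun y => row_mx y (vloc i Y y))) (chart i x)).
  exact: (esym (derive_comp v ds dF)).
apply: (derive_near_eq v (@im_open _ _ _ _ hM i)); first by exists x.
move=> _ [z iz <-]; rewrite (loc_chart hM) //= (vloc_chart hM) //.
by rewrite -[row_mx _ _]/(tch i (z, Y z)) tloc_chart.
Qed.

End TangentBundle.

(** * Functions on the tangent bundle *)

Section HalfLine.
Variable R : realType.

(** At [t = 0] only positive increments are allowed, but they accumulate at [0], so the
    one-sided limit is still the derivative of any extension. *)
Lemma dRplusE (f F : R -> R) (t : R) : differentiable F t ->
  (forall s, 0 <= s -> F s = f s) -> 0 <= t -> dRplus f t = 'D_1 F t.
Proof.
move=> dF Ff t0.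
have dF1 : derivable F t 1 by exact: diff_derivable.
pose D := [set h : R | 0 <= h + t].
have PF : ProperFilter (within D (0 : R)^').
  apply: Build_ProperFilter_ex => P; rewrite /within /= => H.
  have : \forall h \near (0 : R), h != 0 -> D h -> P h by exact: H.
  move=> /nbhs_ballP[e /= e0 He]; exists (e / 2); apply: He.
  - by rewrite -ball_normE /= sub0r normrN gtr0_norm ?divr_gt0 // ltr_pdivrMr // ltr_pMr // ltr1n.
  - by rewrite gt_eqF // divr_gt0.
  - by rewrite /D /= addr_ge0 // ltW // divr_gt0.
have cF : h^-1 *: (F (h *: 1 + t) - F t) @[h --> (0 : R)^'] --> 'D_1 F t by exact: dF1.
apply: cvg_lim => //.
have cF' : h^-1 *: (F (h *: 1 + t) - F t) @[h --> within D (0 : R)^'] --> 'D_1 F t.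
  by apply: cvg_trans cF; apply: cvg_app; exact: cvg_within.
apply: cvg_trans cF'; apply: near_eq_cvg.
apply: (@nearW _ ((0 : R)^')) => h Dh.
have -> : h *: (1 : R) = h by exact: mulr1.
by rewrite !Ff.
Qed.

Lemma smooth_RplusD (f h : R -> R) : smooth_Rplus f -> smooth_Rplus h ->
  smooth_Rplus (fun s => f s + h s).
Proof.
move=> [F sF Ff] [H sH Hh]; exists (fun s => F s + H s); first exact: smoothD openT sF sH.
by move=> t t0; rewrite Ff // Hh.
Qed.

End HalfLine.

Section FunctionRules.
Variables (R : realType) (n : nat) (M : topologicalType) (A : atlas R n M).
Hypothesis hM : smooth_manifold A.
Implicit Types (f h : M -> R).

Lemma vderivM x v f h : smooth_fun A f -> smooth_fun A h ->
  vderiv A x v (fun z => f z * h z) = vderiv A x v f * h x + f x * vderiv A x v h.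
Proof.
move=> sf sh; have dx := dom_at hM x.
have df := smooth_fun_diff sf dx; have dh := smooth_fun_diff sh dx.
have oi := @im_open _ _ _ _ hM (at_pt A x).
rewrite -{1}(loc_chart hM h dx) -{1}(loc_chart hM f dx) /vderiv.
transitivity ('D_v (fun y => loc (at_pt A x) f y *: loc (at_pt A x) h y) (chart (at_pt A x) x)).
  apply: (derive_near_eq v oi); first by exists x.
  by move=> _ [z iz <-]; rewrite !(loc_chart hM).
exact: derive_scale.
Qed.

Lemma smooth_fun_comp (F : R -> R) f : smooth_on setT F -> smooth_fun A f ->
  smooth_fun A (fun z => F (f z)).
Proof.
move=> sF sf i; have oi := @im_open _ _ _ _ hM i.
have H := @smooth_comp _ _ _ _ _ setT (loc i f) F (fin_dim_R R) oi (fun _ _ => I) (sf i) sF.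
by apply: (smooth_eq oi _ H) => _ [z iz <-]; rewrite !(loc_chart hM).
Qed.

Lemma vderiv_comp (F : R -> R) x v f : smooth_on setT F -> smooth_fun A f ->
  vderiv A x v (fun z => F (f z)) = vderiv A x v f * 'D_1 F (f x).
Proof.
move=> sF sf; have dx := dom_at hM x; have df := smooth_fun_diff sf dx.
have oi := @im_open _ _ _ _ hM (at_pt A x).
have fx := loc_chart hM f dx.
have dF s : differentiable F s by exact: (smooth_differentiable sF).
rewrite -fx /vderiv.
transitivity ('D_v (F \o loc (at_pt A x) f) (chart (at_pt A x) x)).
  apply: (derive_near_eq v oi); first by exists x.
  by move=> _ [z iz <-]; rewrite /= !(loc_chart hM).
apply: etrans (derive_comp v df (dF _)) _.
rewrite !(deriveE _ (dF _)) -[X in 'd F _ X]mulr1.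
exact: linearZ.
Qed.

End FunctionRules.

Section TangentFunctions.
Variables (R : realType) (n : nat) (M : topologicalType) (A : atlas R n M).
Hypothesis hM : smooth_manifold A.
Variables (g : tensor02 R n M) (nabla : vfield R n M -> vfield R n M -> vfield R n M).
Hypothesis hg : riemannian A g.
Hypothesis hLC : levi_civita A g nabla.
Implicit Types (X Y Z : vfield R n M) (x z : M) (u v w : 'rV[R]_n).

Local Notation TM := (M * 'rV[R]_n)%type.
Local Notation TA := (tangent_atlas A).
Local Notation at_ := (at_pt A).
Let hs : sym_tensor02 A g := proj1 hg.
Let hn := lc_affine hLC.

Lemma g_ge0 x v : 0 <= g x v v.
Proof.
have [->|v0] := eqVneq v 0; first by rewrite (g0l hs).
by apply: ltW; case: hg => _; exact.
Qed.

(** Differentiability at [p], expressed in the chart at [p]. *)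
Definition tdiff (p : TM) (F : TM -> R) : Prop :=
  differentiable (tloc (at_ p.1) F) (tch (at_ p.1) p).

Lemma tdiff_near p (F : TM -> R) (h : 'rV[R]_(n + n) -> R) (U : set 'rV[R]_(n + n)) :
  open U -> U (tch (at_ p.1) p) ->
  (forall q, U q -> h q = tloc (at_ p.1) F q) ->
  differentiable h (tch (at_ p.1) p) -> tdiff p F.
Proof. by move=> oU Up hF; exact: differentiable_near_eq oU Up hF. Qed.

Lemma tch_at_dom p : tdom (at_ p.1) (tch (at_ p.1) p).
Proof. by apply: tch_tdom; exact: (dom_at hM). Qed.

Lemma tdiffD p F H : tdiff p F -> tdiff p H -> tdiff p (fun q => F q + H q).
Proof.
move=> dF dH; apply: (tdiff_near (tdom_open hM (i := at_ p.1)) (tch_at_dom p) _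
  (differentiableD dF dH)) => _ /(tdomP hM)[z [v [iz ->]]].
by rewrite fctE !(tloc_chart hM).
Qed.

Lemma tdiffM p F H : tdiff p F -> tdiff p H -> tdiff p (fun q => F q * H q).
Proof.
move=> dF dH; apply: (tdiff_near (tdom_open hM (i := at_ p.1)) (tch_at_dom p) _
  (differentiable_scale dF dH)) => _ /(tdomP hM)[z [v [iz ->]]].
by rewrite !(tloc_chart hM).
Qed.

Lemma tdiff_comp p (k : R -> R) F : smooth_on setT k -> tdiff p F ->
  tdiff p (fun q => k (F q)).
Proof.
move=> sk dF.
have dk : differentiable k (tloc (at_ p.1) F (tch (at_ p.1) p)).
  exact: (smooth_differentiable sk).
apply: (tdiff_near (tdom_open hM (i := at_ p.1)) (tch_at_dom p) _
  (differentiable_comp dF dk)) => _ /(tdomP hM)[z [v [iz ->]]].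
by rewrite /= !(tloc_chart hM).
Qed.

Lemma tdiff_fst p f : smooth_fun A f -> tdiff p (fun q => f q.1).
Proof.
move=> sf; set i := at_ p.1.
have st : smooth_on (tdom i) (fun q => loc i f (lsubmx q)).
  by apply: smooth_comp_lsubmx; [exact: (@im_open _ _ _ _ hM)|exact: sf].
apply: (tdiff_near (tdom_open hM (i := i)) (tch_at_dom p) _
  (smooth_differentiable st (tch_at_dom p))) => _ /(tdomP hM)[z [v [iz ->]]].
by rewrite (tloc_chart hM) // /tch row_mxKl (loc_chart hM).
Qed.

Lemma tdiff_sum p (F : 'I_n -> TM -> R) : (forall k, tdiff p (F k)) ->
  tdiff p (fun q => \sum_k F k q).
Proof.
move=> dF.
have ds : differentiable (fun q => \sum_k tloc (at_ p.1) (F k) q) (tch (at_ p.1) p).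
  apply: (@differentiable_bigsum _ _ _ _ _ _ (fun k q => tloc (at_ p.1) (F k) q)) => k _.
  exact: dF.
apply: (tdiff_near (tdom_open hM (i := at_ p.1)) (tch_at_dom p) _ ds) => _ /(tdomP hM)[z [v [iz ->]]].
by rewrite (tloc_chart hM) //; apply: eq_bigr => k _; rewrite (tloc_chart hM).
Qed.

Lemma tdiff_comp_fibre p k : tdiff p (fun q => tcoord (at_ p.1) q.1 q.2 0 k).
Proof.
have dk : differentiable (fun q : 'rV[R]_(n + n) => rsubmx q 0 k) (tch (at_ p.1) p).
  apply: (@differentiable_comp _ _ _ _ rsubmx (coord_fun k)).
    exact: differentiable_rsubmx.
  exact: differentiable_coord.
apply: (tdiff_near (tdom_open hM (i := at_ p.1)) (tch_at_dom p) _ dk) => _ /(tdomP hM)[z [v [iz ->]]].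
by rewrite (tloc_chart hM) // /tch row_mxKr.
Qed.

Lemma g_sumr x v (r : seq 'I_n) (f : 'I_n -> R) (w : 'I_n -> 'rV[R]_n) :
  g x v (\sum_(k <- r) f k *: w k) = \sum_(k <- r) f k * g x v (w k).
Proof.
elim: r => [|k r IH]; first by rewrite !big_nil (g_sym hs) (g0l hs).
by rewrite !big_cons (gDr hs) (gZr hs) IH.
Qed.

Lemma frame_expand i rho N z v : cutoff i rho N -> chart_dom i z -> N (chart i z) ->
  v = \sum_k (tcoord i z v) 0 k *: @frame R n M A i rho k z.
Proof.
move=> co iz Nz; apply: (tcoord_inj hM iz).
rewrite linear_sum {1}(row_sum_delta (tcoord i z v)); apply: eq_bigr => k _.
by rewrite linearZ /= (tcoord_frame hM co).
Qed.

(** In a local frame the function is linear in the fibre coordinates, with smooth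
    coefficients. *)
Lemma tdiff_g1 p Y : smooth_vfield A Y -> tdiff p (fun q => g q.1 (Y q.1) q.2).
Proof.
move=> sY; set i := at_ p.1.
have [rho [N [co Nx]]] := cutoff_exists hM (dom_at hM p.1).
have d : tdiff p (fun q => \sum_k tcoord i q.1 q.2 0 k *
    g q.1 (Y q.1) (@frame R n M A i rho k q.1)).
  apply: (@tdiff_sum p (fun k q => tcoord i q.1 q.2 0 k *
    g q.1 (Y q.1) (@frame R n M A i rho k q.1))) => k.
  apply: tdiffM; first exact: tdiff_comp_fibre.
  apply: (@tdiff_fst p (fun z => g z (Y z) (@frame R n M A i rho k z))).
  by apply: (g_smooth hs) => //; exact: (frame_smooth hM co).
apply: (@tdiff_near p _ _ [set q : 'rV[R]_(n + n) | N (lsubmx q)] _ _ _ d).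
- by apply: open_lsubmx; exact: cutoff_open co.
- by rewrite /= /tch row_mxKl.
move=> q Nq; have [z [v [iz qE]]] := tdomP hM (cutoff_sub co Nq).
rewrite qE /= /tch row_mxKl in Nq; rewrite qE !(tloc_chart hM) //=.
by rewrite [in RHS](frame_expand v co iz Nq) g_sumr.
Qed.

Lemma tdiff_g2 p : tdiff p (fun q => g q.1 q.2 q.2).
Proof.
set i := at_ p.1.
have [rho [N [co Nx]]] := cutoff_exists hM (dom_at hM p.1).
have d : tdiff p (fun q => \sum_k tcoord i q.1 q.2 0 k *
    g q.1 (@frame R n M A i rho k q.1) q.2).
  apply: (@tdiff_sum p (fun k q => tcoord i q.1 q.2 0 k *
    g q.1 (@frame R n M A i rho k q.1) q.2)) => k.
  apply: tdiffM; first exact: tdiff_comp_fibre.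
  by apply: tdiff_g1; exact: (frame_smooth hM co).
apply: (@tdiff_near p _ _ [set q : 'rV[R]_(n + n) | N (lsubmx q)] _ _ _ d).
- by apply: open_lsubmx; exact: cutoff_open co.
- by rewrite /= /tch row_mxKl.
move=> q Nq; have [z [v [iz qE]]] := tdomP hM (cutoff_sub co Nq).
rewrite qE /= /tch row_mxKl in Nq; rewrite qE !(tloc_chart hM) //=.
transitivity (g z v (\sum_k tcoord i z v 0 k *: @frame R n M A i rho k z)); last first.
  by rewrite -(frame_expand v co iz Nq).
by rewrite g_sumr; apply: eq_bigr => k _; rewrite (g_sym hs).
Qed.

(** * The functions [a (|u|^2) g(Y, Z) + b (|u|^2) g(Y, u) g(Z, u)] *)

Definition Qform (a b : R) x u v w : R := a * g x v w + b * g x v u * g x w u.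

Definition Qfun (a b : R -> R) Y Z (p : TM) : R :=
  Qform (a (g p.1 p.2 p.2)) (b (g p.1 p.2 p.2)) p.1 p.2 (Y p.1) (Z p.1).

Lemma Qfun_tdiff p a b Y Z : smooth_on setT a -> smooth_on setT b ->
  smooth_vfield A Y -> smooth_vfield A Z -> tdiff p (Qfun a b Y Z).
Proof.
move=> sa sb sY sZ.
have dg := tdiff_g2 p.
apply: (@tdiffD p (fun q => a (g q.1 q.2 q.2) * g q.1 (Y q.1) (Z q.1))
  (fun q => b (g q.1 q.2 q.2) * g q.1 (Y q.1) q.2 * g q.1 (Z q.1) q.2)).
  apply: (@tdiffM p (fun q => a (g q.1 q.2 q.2)) (fun q => g q.1 (Y q.1) (Z q.1))).
    exact: (tdiff_comp sa dg).
  by apply: (@tdiff_fst p (fun z => g z (Y z) (Z z))); exact: (g_smooth hs).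
apply: (@tdiffM p (fun q => b (g q.1 q.2 q.2) * g q.1 (Y q.1) q.2)
  (fun q => g q.1 (Z q.1) q.2)); last exact: tdiff_g1.
apply: (@tdiffM p (fun q => b (g q.1 q.2 q.2)) (fun q => g q.1 (Y q.1) q.2)).
  exact: (tdiff_comp sb dg).
exact: tdiff_g1.
Qed.

(** Restricting to a section [S] parallel in the direction [X], the functions of
    [g (S, S)] become stationary and only the fields are differentiated. *)
Lemma vderiv_Qfun_h a b X Y Z x u : smooth_on setT a -> smooth_on setT b ->
  smooth_vfield A X -> smooth_vfield A Y -> smooth_vfield A Z ->
  vderiv TA (x, u) (hlift A nabla (x, u) (X x)) (Qfun a b Y Z)
  = Qform (a (g x u u)) (b (g x u u)) x u (nabla X Y x) (Z x)
    + Qform (a (g x u u)) (b (g x u u)) x u (Y x) (nabla X Z x).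
Proof.
move=> sa sb sX sY sZ.
have [S [sS Sx pS ->]] := hlift_tmap hM hn x u (X x).
have nS : nabla X S x = 0 by exact: pS.
have dQ := Qfun_tdiff (x, S x) sa sb sY sZ.
rewrite -Sx; apply: etrans (vderiv_hlift hM (X x) sS dQ) _.
have sm X' Y' : smooth_vfield A X' -> smooth_vfield A Y' ->
  smooth_fun A (fun z => g z (X' z) (Y' z)) by exact: (g_smooth hs).
pose f1 z := a (g z (S z) (S z)); pose f2 z := g z (Y z) (Z z).
pose f3 z := b (g z (S z) (S z)); pose f4 z := g z (Y z) (S z); pose f5 z := g z (Z z) (S z).
have s1 : smooth_fun A f1 by apply: (smooth_fun_comp hM sa); exact: sm.
have s2 : smooth_fun A f2 by exact: sm.
have s3 : smooth_fun A f3 by apply: (smooth_fun_comp hM sb); exact: sm.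
have s4 : smooth_fun A f4 by exact: sm.
have s5 : smooth_fun A f5 by exact: sm.
have s34 := smooth_funM hM s3 s4.
rewrite -[LHS]/(vderiv A x (X x) (fun z => f1 z * f2 z + f3 z * f4 z * f5 z)).
rewrite (vderivD hM x (X x) (smooth_funM hM s1 s2) (smooth_funM hM s34 s5)).
rewrite (vderivM hM x (X x) s1 s2) (vderivM hM x (X x) s34 s5) (vderivM hM x (X x) s3 s4).
have gr v : g x v 0 = 0 by rewrite (g_sym hs) (g0l hs).
have v0 : vderiv A x (X x) (fun z => g z (S z) (S z)) = 0.
  by rewrite (lc_metric hLC) // nS (g0l hs) gr addr0.
have -> : vderiv A x (X x) f1 = 0.
  by rewrite (vderiv_comp hM x (X x) sa (sm _ _ sS sS)) v0 mul0r.
have -> : vderiv A x (X x) f3 = 0.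
  by rewrite (vderiv_comp hM x (X x) sb (sm _ _ sS sS)) v0 mul0r.
rewrite !(lc_metric hLC) // nS !gr /f1 /f2 /f3 /f4 /f5 /Qform.
by ring.
Qed.

(** On the line [u + h v] all the scalar products are polynomials in [h]. *)
Lemma vderiv_Qfun_v a b Y Z x u v : smooth_on setT a -> smooth_on setT b ->
  vderiv TA (x, u) (vlift A (x, u) v) (Qfun a b Y Z)
  = 2 * g x v u * ('D_1 a (g x u u) * g x (Y x) (Z x)
      + 'D_1 b (g x u u) * g x (Y x) u * g x (Z x) u)
    + b (g x u u) * (g x (Y x) v * g x (Z x) u + g x (Y x) u * g x (Z x) v).
Proof.
move=> sa sb; rewrite (vderiv_vlift hM).
have da (s : R) : is_derive s (1 : R) a ('D_1 a s).
  by apply: derivableP; apply: diff_derivable; exact: (smooth_differentiable sa).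
have db (s : R) : is_derive s (1 : R) b ('D_1 b s).
  by apply: derivableP; apply: diff_derivable; exact: (smooth_differentiable sb).
pose T (h : R) := (g x v v * h + 2 * g x v u) * h + g x u u.
pose f (h : R) := a (T h) * g x (Y x) (Z x)
  + b (T h) * (g x (Y x) v * h + g x (Y x) u) * (g x (Z x) v * h + g x (Z x) u).
have -> : 'D_v (fun w => Qfun a b Y Z (x, w)) u = 'D_1 f 0.
  apply: (f_equal (fun k : R -> R => lim (k h @[h --> (0 : R)^']))).
  apply/funext => h /=; congr (_ *: (_ - _)); rewrite /Qfun /Qform /f /T /=.
    have -> : h *: 1 + 0 = h :> R by rewrite addr0; exact: mulr1.
    rewrite !(gDl hs) !(gDr hs) !(gZl hs) !(gZr hs) (g_sym hs x u v).
    have -> : h * (h * g x v v) + h * g x v u + (h * g x v u + g x u u)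
      = (g x v v * h + 2 * g x v u) * h + g x u u by ring.
    by ring.
  by rewrite !mulr0 !add0r.
have did : is_derive (0 : R) (1 : R) (fun h : R => h) 1 by exact: is_derive_id.
have dc (q : R) : is_derive (0 : R) (1 : R) (fun h : R => q) 0 by exact: is_derive_cst.
have lin (p q : R) : is_derive (0 : R) (1 : R) (fun h : R => p * h + q) p.
  apply: is_derive_eq (is_deriveD (is_deriveZ p did) (dc q)) _.
  by rewrite addr0; exact: mulr1.
have T0 : T 0 = g x u u by rewrite /T mulr0 add0r.
have dT : is_derive (0 : R) (1 : R) T (2 * g x v u).
  pose l (h : R) := g x v v * h + 2 * g x v u.
  have dl : is_derive (0 : R) (1 : R) l (g x v v) by exact: lin.
  apply: is_derive_eq (is_deriveD (is_deriveM dl did) (dc (g x u u))) _.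
  rewrite /l /GRing.scale /=; ring.
have daT : is_derive (0 : R) (1 : R) (fun h => a (T h)) ('D_1 a (g x u u) * (2 * g x v u)).
  by apply: (@is_derive1_comp _ a T 0); rewrite T0.
have dbT : is_derive (0 : R) (1 : R) (fun h => b (T h)) ('D_1 b (g x u u) * (2 * g x v u)).
  by apply: (@is_derive1_comp _ b T 0); rewrite T0.
have dY := lin (g x (Y x) v) (g x (Y x) u).
have dZ := lin (g x (Z x) v) (g x (Z x) u).
have dYZ := is_deriveD (is_deriveM daT (dc (g x (Y x) (Z x))))
  (is_deriveM (is_deriveM dbT dY) dZ).
have [_ E] := dYZ; apply: etrans E _.
rewrite fctE T0 !mulr0 !add0r /GRing.scale /=.
by ring.
Qed.

End TangentFunctions.

(** * The linear system for the coefficients *)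

Section CoefficientIdentities.
Variables (R : realType) (c : gnat_coef R) (t : R).
Hypothesis al0 : alpha c t != 0.
Hypothesis ph0 : phi c t != 0.

Local Notation a1 := (alpha1 c t).
Local Notation a2 := (alpha2 c t).
Local Notation a13 := (alpha1 c t + alpha3 c t).
Local Notation b1 := (beta1 c t).
Local Notation b2 := (beta2 c t).
Local Notation b13 := (beta1 c t + beta3 c t).
Local Notation da1 := (dRplus (alpha1 c) t).
Local Notation da2 := (dRplus (alpha2 c) t).
Local Notation da13 := (dRplus (fun s => alpha1 c s + alpha3 c s) t).
Local Notation db1 := (dRplus (beta1 c) t).
Local Notation db2 := (dRplus (beta2 c) t).
Local Notation db13 := (dRplus (fun s => beta1 c s + beta3 c s) t).

(** The form [a g (P, w) + b g (P, u) g (w, u)], where [P] is the combination of the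
    eight tensors with coefficients [f], is a combination of seven scalars: by the
    Bianchi identity and the pair symmetry the third tensor depends on the first two,
    and these have the same scalar product with [u]. These are its coefficients. *)
Definition Qcoef (a b : R) (f : seq R) : seq R :=
  [:: a * (f`_0 + f`_2); a * (f`_1 - f`_2); a * f`_3 + b * (f`_0 + f`_1 + t * f`_3);
      a * f`_4; a * f`_5; (a + t * b) * f`_6; a * f`_7 + b * (f`_4 + f`_5 + t * f`_7)].

(** The linear equation satisfied by the horizontal part [f] and the vertical part [f']
    of a covariant derivative: [h] and [h'] are the coefficients of the metric on the
    pairs formed with a fixed kind of lift, [s] is the value given by the Koszul
    formula. *)
Definition solves (h h' : R * R) (f f' : seq R) (s : seq R) : Prop :=
  forall k, (k < 7)%N ->
    nth 0 (Qcoef h.1 h.2 f) k + nth 0 (Qcoef h'.1 h'.2 f') k = nth 0 s k.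

Local Ltac solve_coef :=
  move: al0 ph0;
  rewrite /solves /Qcoef /fcoefA /fcoefB /fcoefC /fcoefD /fcoefE /fcoefF
    /psi_lambda /psi_theta /psi_omega /alpha /phi /phi1 /phi2 /phi3;
  move: da1 da2 da13 db1 db2 db13 a1 a2 (alpha3 c t) b1 b2 (beta3 c t)
    => e1 e2 e3 e4 e5 e6 x1 x2 x3 y1 y2 y3 ? ?;
  do 7 (case; first by move=> _ /=; field; do ?[assumption|apply/andP; split]).

Lemma solves_AB_h : solves (a13, b13) (a2, b2) (fcoefA c t) (fcoefB c t)
  [:: - a2; 0; 0; 0; 0; 0; 0].
Proof. by solve_coef. Qed.

Lemma solves_AB_v : solves (a2, b2) (a1, b1) (fcoefA c t) (fcoefB c t)
  [:: - (a1 / 2); a1 / 2; 0; - (b13 / 2); - (b13 / 2); - da13; - db13].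
Proof. by solve_coef. Qed.

Lemma solves_CD_h : solves (a13, b13) (a2, b2) (fcoefC c t) (fcoefD c t)
  [:: 0; - (a1 / 2); 0; b13 / 2; da13; b13 / 2; db13].
Proof. by solve_coef. Qed.

Lemma solves_CD_v : solves (a2, b2) (a1, b1) (fcoefC c t) (fcoefD c t)
  [:: 0; 0; 0; 0; da2 - b2 / 2; b2 / 2 - da2; 0].
Proof. by solve_coef. Qed.

Lemma solves_EF_h : solves (a13, b13) (a2, b2) (fcoefE c t) (fcoefF c t)
  [:: 0; 0; 0; da2 + b2 / 2; da2 + b2 / 2; b2; 2 * db2].
Proof. by solve_coef. Qed.

Lemma solves_EF_v : solves (a2, b2) (a1, b1) (fcoefE c t) (fcoefF c t)
  [:: 0; 0; 0; da1; da1; b1 - da1; db1].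
Proof. by solve_coef. Qed.

End CoefficientIdentities.

(** * The Koszul formula on lifts *)

Section Koszul.
Variables (R : realType) (n : nat) (M : topologicalType) (A : atlas R n M).
Variables (g : tensor02 R n M) (nabla : vfield R n M -> vfield R n M -> vfield R n M).
Hypothesis hg : sym_tensor02 A g.
Hypothesis hLC : levi_civita A g nabla.

Lemma koszul U V W p : smooth_vfield A U -> smooth_vfield A V -> smooth_vfield A W ->
  2 * g p (nabla U V p) (W p) =
    vderiv A p (U p) (fun q => g q (V q) (W q))
    + vderiv A p (V p) (fun q => g q (W q) (U q))
    - vderiv A p (W p) (fun q => g q (U q) (V q))
    + g p (lie_bracket A U V p) (W p) - g p (lie_bracket A U W p) (V p)
    - g p (lie_bracket A V W p) (U p).
Proof.
move=> sU sV sW.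
rewrite (lc_metric hLC p sU sV sW) (lc_metric hLC p sV sW sU) (lc_metric hLC p sW sU sV).
rewrite (lc_torsion hLC sU sV) (lc_torsion hLC sU sW) (lc_torsion hLC sV sW).
rewrite !(gDl hg) !(gNl hg).
rewrite (g_sym hg p (V p) (nabla U W p)) (g_sym hg p (W p) (nabla V U p)).
rewrite (g_sym hg p (U p) (nabla W V p)).
by ring.
Qed.

End Koszul.

Section NaturalMetric.
Variables (R : realType) (n : nat) (M : topologicalType) (A : atlas R n M).
Hypothesis hM : smooth_manifold A.
Variables (g : tensor02 R n M) (nabla : vfield R n M -> vfield R n M -> vfield R n M).
Hypothesis hg : riemannian A g.
Hypothesis hLC : levi_civita A g nabla.
Variables (c : gnat_coef R) (G : tensor02 R (n + n) (M * 'rV[R]_n)%type).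
Hypothesis hG : g_natural A g nabla c G.
Implicit Types (X Y Z : vfield R n M) (x z : M) (u v w : 'rV[R]_n).

Local Notation TM := (M * 'rV[R]_n)%type.
Local Notation TA := (tangent_atlas A).
Let hs : sym_tensor02 A g := proj1 hg.
Let hn := lc_affine hLC.
Let hGs : sym_tensor02 TA G. Proof. by case: hG. Qed.

Local Notation a13 := (fun s => alpha1 c s + alpha3 c s).
Local Notation b13 := (fun s => beta1 c s + beta3 c s).
Local Notation h := (hlift A nabla).
Local Notation vl := (vlift A).
Local Notation Xh X := (hlift_vfield A nabla X).
Local Notation Xv X := (vlift_vfield A X).
Local Notation Qf := (Qfun g).
Local Notation tt x u := (g x u u).

Lemma a13_smooth : smooth_Rplus a13.
Proof. by case: hG => _ [? ? ?] _ _ _; exact: smooth_RplusD. Qed.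
Lemma b13_smooth : smooth_Rplus b13.
Proof. by case: hG => _ _ [? ? ?] _ _; exact: smooth_RplusD. Qed.
Lemma a1_smooth : smooth_Rplus (alpha1 c). Proof. by case: hG => _ [? ? ?]. Qed.
Lemma a2_smooth : smooth_Rplus (alpha2 c). Proof. by case: hG => _ [? ? ?]. Qed.
Lemma b1_smooth : smooth_Rplus (beta1 c). Proof. by case: hG => _ _ [? ? ?]. Qed.
Lemma b2_smooth : smooth_Rplus (beta2 c). Proof. by case: hG => _ _ [? ? ?]. Qed.

Definition Qat (a b : R -> R) x u v w := Qform g (a (tt x u)) (b (tt x u)) x u v w.

Lemma G_hh x u v w : G (x, u) (h (x, u) v) (h (x, u) w) = Qat a13 b13 x u v w.
Proof. by case: hG => _ _ _ _ /(_ x u v w)[]. Qed.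
Lemma G_hv x u v w : G (x, u) (h (x, u) v) (vl (x, u) w) = Qat (alpha2 c) (beta2 c) x u v w.
Proof. by case: hG => _ _ _ _ /(_ x u v w)[]. Qed.
Lemma G_vh x u v w : G (x, u) (vl (x, u) v) (h (x, u) w) = Qat (alpha2 c) (beta2 c) x u v w.
Proof. by case: hG => _ _ _ _ /(_ x u v w)[]. Qed.
Lemma G_vv x u v w : G (x, u) (vl (x, u) v) (vl (x, u) w) = Qat (alpha1 c) (beta1 c) x u v w.
Proof. by case: hG => _ _ _ _ /(_ x u v w)[]. Qed.

Lemma G_vhv_h x u v w w' a :
  G (x, u) (vl (x, u) v + h (x, u) w + vl (x, u) w') (h (x, u) a)
  = Qat (alpha2 c) (beta2 c) x u v a
    + (Qat a13 b13 x u w a + Qat (alpha2 c) (beta2 c) x u w' a).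
Proof.
rewrite (gDl hGs) (gDl hGs) -addrA.
exact: f_equal2 (G_vh x u v a) (f_equal2 +%R (G_hh x u w a) (G_vh x u w' a)).
Qed.

Lemma G_vhv_v x u v w w' a :
  G (x, u) (vl (x, u) v + h (x, u) w + vl (x, u) w') (vl (x, u) a)
  = Qat (alpha1 c) (beta1 c) x u v a
    + (Qat (alpha2 c) (beta2 c) x u w a + Qat (alpha1 c) (beta1 c) x u w' a).
Proof.
rewrite (gDl hGs) (gDl hGs) -addrA.
exact: f_equal2 (G_vv x u v a) (f_equal2 +%R (G_hv x u w a) (G_vv x u w' a)).
Qed.

Lemma G_fun_hh Y Z : (fun q => G q (Xh Y q) (Xh Z q)) = Qf a13 b13 Y Z.
Proof. by apply/funext => -[z w]; exact: G_hh. Qed.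
Lemma G_fun_hv Y Z : (fun q => G q (Xh Y q) (Xv Z q)) = Qf (alpha2 c) (beta2 c) Y Z.
Proof. by apply/funext => -[z w]; exact: G_hv. Qed.
Lemma G_fun_vh Y Z : (fun q => G q (Xv Y q) (Xh Z q)) = Qf (alpha2 c) (beta2 c) Y Z.
Proof. by apply/funext => -[z w]; exact: G_vh. Qed.
Lemma G_fun_vv Y Z : (fun q => G q (Xv Y q) (Xv Z q)) = Qf (alpha1 c) (beta1 c) Y Z.
Proof. by apply/funext => -[z w]; exact: G_vv. Qed.

Lemma Qfun_ext a b (a' b' : R -> R) Y Z : (forall s, 0 <= s -> a' s = a s) ->
  (forall s, 0 <= s -> b' s = b s) -> Qf a b Y Z = Qf a' b' Y Z.
Proof.
move=> Ha Hb; apply/funext => -[z w].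
by rewrite /Qfun Ha ?Hb //; exact: (g_ge0 hg).
Qed.

Lemma vderiv_Q_h a b X Y Z x u : smooth_Rplus a -> smooth_Rplus b ->
  smooth_vfield A X -> smooth_vfield A Y -> smooth_vfield A Z ->
  vderiv TA (x, u) (Xh X (x, u)) (Qf a b Y Z)
  = Qat a b x u (nabla X Y x) (Z x) + Qat a b x u (Y x) (nabla X Z x).
Proof.
move=> [a' sa Ha] [b' sb Hb] sX sY sZ; rewrite (Qfun_ext _ _ Ha Hb).
rewrite -[Xh X (x, u)]/(h (x, u) (X x)) (vderiv_Qfun_h hM hg hLC) //.
by rewrite /Qat Ha ?Hb //; exact: (g_ge0 hg).
Qed.

(** Derivative, in the vertical direction [v], of
    [a (|u|^2) g (w, w') + b (|u|^2) g (w, u) g (w', u)]. *)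
Definition dQat (a b : R -> R) x u v w w' : R :=
  2 * g x v u * (dRplus a (tt x u) * g x w w'
    + dRplus b (tt x u) * g x w u * g x w' u)
  + b (tt x u) * (g x w v * g x w' u + g x w u * g x w' v).

Lemma vderiv_Q_v a b V Y Z x u : smooth_Rplus a -> smooth_Rplus b ->
  vderiv TA (x, u) (Xv V (x, u)) (Qf a b Y Z) = dQat a b x u (V x) (Y x) (Z x).
Proof.
move=> [a' sa Ha] [b' sb Hb]; rewrite (Qfun_ext _ _ Ha Hb).
rewrite -[Xv V (x, u)]/(vl (x, u) (V x)) (vderiv_Qfun_v hM hg) //.
have t0 : 0 <= tt x u by exact: (g_ge0 hg).
rewrite /dQat -(Hb _ t0).
have da : differentiable a' (tt x u) by exact: (smooth_differentiable sa).
have db : differentiable b' (tt x u) by exact: (smooth_differentiable sb).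
by rewrite (dRplusE da Ha t0) (dRplusE db Hb t0).
Qed.

Lemma bracket_hh_at X Y x u : smooth_vfield A X -> smooth_vfield A Y ->
  lie_bracket TA (Xh X) (Xh Y) (x, u)
  = h (x, u) (nabla X Y x - nabla Y X x)
    - vl (x, u) (curvature_at A nabla x (X x) (Y x) u).
Proof.
move=> sX sY; have [rho [N [co Nx]]] := cutoff_exists hM (dom_at hM x).
rewrite (bracket_hh hM hn u co Nx sX sY) (curvature_atE hM hLC co) //.
by rewrite (lc_torsion hLC).
Qed.

Lemma bracket_hv_at X Y x u : smooth_vfield A X -> smooth_vfield A Y ->
  lie_bracket TA (Xh X) (Xv Y) (x, u) = vl (x, u) (nabla X Y x).
Proof.
move=> sX sY; have [rho [N [co Nx]]] := cutoff_exists hM (dom_at hM x).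
exact: (bracket_hv hM hn u co Nx sX sY).
Qed.

Lemma bracket_vv_at X Y x u : smooth_vfield A X -> smooth_vfield A Y ->
  lie_bracket TA (Xv X) (Xv Y) (x, u) = 0.
Proof.
by move=> sX sY; exact: bracket_vv.
Qed.

Lemma bracket_vh_at X Y x u : smooth_vfield A X -> smooth_vfield A Y ->
  lie_bracket TA (Xv X) (Xh Y) (x, u) = - vl (x, u) (nabla Y X x).
Proof. by move=> sX sY; rewrite -bracket_hv_at // /lie_bracket opprB. Qed.

Lemma QatDl a b x u v v' w : Qat a b x u (v + v') w = Qat a b x u v w + Qat a b x u v' w.
Proof. by rewrite /Qat /Qform !(gDl hs); ring. Qed.
Lemma QatNl a b x u v w : Qat a b x u (- v) w = - Qat a b x u v w.
Proof. by rewrite /Qat /Qform !(gNl hs); ring. Qed.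
Lemma QatC a b x u v w : Qat a b x u v w = Qat a b x u w v.
Proof. by rewrite /Qat /Qform (g_sym hs x v w); ring. Qed.

Local Notation Rm := (Riem A g nabla).

(** The terms with [b] disappear since [R (v, w) u] is orthogonal to [u]. *)
Lemma Qat_curv a b x u v w w' :
  Qat a b x u (curvature_at A nabla x v w u) w' = a (tt x u) * Rm x v w u w'.
Proof.
rewrite /Qat /Qform.
have -> : g x (curvature_at A nabla x v w u) u = 0.
  have := Riem_anti34 hM hs hLC x v w u u; rewrite /Riem => /eqP.
  by rewrite -addr_eq0 -mulr2n mulrn_eq0 /= => /eqP.
by rewrite mulr0 mul0r addr0.
Qed.

Lemma Riem_bianchi_u x u v w w' :
  Rm x v w u w' = Rm x v u w w' - Rm x w u v w'.
Proof.
have := Riem_bianchi hM hs hLC x v w u w'.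
by rewrite (Riem_anti12 hM hs hLC x u v); lra.
Qed.

Section LeviCivita.
Variable nb : vfield R (n + n) TM -> vfield R (n + n) TM -> vfield R (n + n) TM.
Hypothesis hnb : levi_civita TA G nb.
Variables (x : M) (u : 'rV[R]_n).

Local Notation p := ((x, u) : TM).
Let smh W (sW : smooth_vfield A W) := hlift_smooth hM hn sW.
Let smv W (sW : smooth_vfield A W) := vlift_smooth hM sW.
Local Notation Q1 := (Qat a13 b13 x u).
Local Notation Q2 := (Qat (alpha2 c) (beta2 c) x u).
Local Notation Q3 := (Qat (alpha1 c) (beta1 c) x u).
Local Notation dQ1 := (dQat a13 b13 x u).
Local Notation dQ2 := (dQat (alpha2 c) (beta2 c) x u).
Local Notation dQ3 := (dQat (alpha1 c) (beta1 c) x u).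
Local Notation t := (tt x u).

Section Brackets.
Variables (X Y : vfield R n M) (w : 'rV[R]_n).
Hypotheses (sX : smooth_vfield A X) (sY : smooth_vfield A Y).

Lemma G_bracket_hh_h : G p (lie_bracket TA (Xh X) (Xh Y) p) (h p w)
  = Q1 (nabla X Y x) w - Q1 (nabla Y X x) w - alpha2 c t * Rm x (X x) (Y x) u w.
Proof.
rewrite (bracket_hh_at x u sX sY) (gDl hGs) (gNl hGs) G_hh G_vh Qat_curv.
by rewrite QatDl QatNl.
Qed.

Lemma G_bracket_hh_v : G p (lie_bracket TA (Xh X) (Xh Y) p) (vl p w)
  = Q2 (nabla X Y x) w - Q2 (nabla Y X x) w - alpha1 c t * Rm x (X x) (Y x) u w.
Proof.
rewrite (bracket_hh_at x u sX sY) (gDl hGs) (gNl hGs) G_hv G_vv Qat_curv.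
by rewrite QatDl QatNl.
Qed.

Lemma G_bracket_hv_h : G p (lie_bracket TA (Xh X) (Xv Y) p) (h p w) = Q2 (nabla X Y x) w.
Proof. by rewrite (bracket_hv_at x u sX sY) G_vh. Qed.

Lemma G_bracket_hv_v : G p (lie_bracket TA (Xh X) (Xv Y) p) (vl p w) = Q3 (nabla X Y x) w.
Proof. by rewrite (bracket_hv_at x u sX sY) G_vv. Qed.

Lemma G_bracket_vh_h : G p (lie_bracket TA (Xv X) (Xh Y) p) (h p w) = - Q2 (nabla Y X x) w.
Proof. by rewrite (bracket_vh_at x u sX sY) (gNl hGs) G_vh. Qed.

Lemma G_bracket_vh_v : G p (lie_bracket TA (Xv X) (Xh Y) p) (vl p w) = - Q3 (nabla Y X x) w.
Proof. by rewrite (bracket_vh_at x u sX sY) (gNl hGs) G_vv. Qed.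

Lemma G_bracket_vv a : G p (lie_bracket TA (Xv X) (Xv Y) p) a = 0.
Proof. by rewrite (bracket_vv_at x u sX sY) (g0l hGs). Qed.

End Brackets.

Section Derivatives.
Variables (X Y Z : vfield R n M).
Hypotheses (sX : smooth_vfield A X) (sY : smooth_vfield A Y) (sZ : smooth_vfield A Z).

Lemma vderiv_G_h_hh : vderiv TA p (Xh X p) (fun q => G q (Xh Y q) (Xh Z q))
  = Q1 (nabla X Y x) (Z x) + Q1 (nabla X Z x) (Y x).
Proof.
by rewrite G_fun_hh (vderiv_Q_h x u a13_smooth b13_smooth sX sY sZ) (QatC _ _ _ _ (Y x)).
Qed.
Lemma vderiv_G_h_hv : vderiv TA p (Xh X p) (fun q => G q (Xh Y q) (Xv Z q))
  = Q2 (nabla X Y x) (Z x) + Q2 (nabla X Z x) (Y x).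
Proof.
by rewrite G_fun_hv (vderiv_Q_h x u a2_smooth b2_smooth sX sY sZ) (QatC _ _ _ _ (Y x)).
Qed.
Lemma vderiv_G_h_vh : vderiv TA p (Xh X p) (fun q => G q (Xv Y q) (Xh Z q))
  = Q2 (nabla X Y x) (Z x) + Q2 (nabla X Z x) (Y x).
Proof.
by rewrite G_fun_vh (vderiv_Q_h x u a2_smooth b2_smooth sX sY sZ) (QatC _ _ _ _ (Y x)).
Qed.
Lemma vderiv_G_h_vv : vderiv TA p (Xh X p) (fun q => G q (Xv Y q) (Xv Z q))
  = Q3 (nabla X Y x) (Z x) + Q3 (nabla X Z x) (Y x).
Proof.
by rewrite G_fun_vv (vderiv_Q_h x u a1_smooth b1_smooth sX sY sZ) (QatC _ _ _ _ (Y x)).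
Qed.
Lemma vderiv_G_v_hh : vderiv TA p (Xv X p) (fun q => G q (Xh Y q) (Xh Z q))
  = dQ1 (X x) (Y x) (Z x).
Proof. by rewrite G_fun_hh (vderiv_Q_v _ _ _ _ _ a13_smooth b13_smooth). Qed.
Lemma vderiv_G_v_hv : vderiv TA p (Xv X p) (fun q => G q (Xh Y q) (Xv Z q))
  = dQ2 (X x) (Y x) (Z x).
Proof. by rewrite G_fun_hv (vderiv_Q_v _ _ _ _ _ a2_smooth b2_smooth). Qed.
Lemma vderiv_G_v_vh : vderiv TA p (Xv X p) (fun q => G q (Xv Y q) (Xh Z q))
  = dQ2 (X x) (Y x) (Z x).
Proof. by rewrite G_fun_vh (vderiv_Q_v _ _ _ _ _ a2_smooth b2_smooth). Qed.
Lemma vderiv_G_v_vv : vderiv TA p (Xv X p) (fun q => G q (Xv Y q) (Xv Z q))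
  = dQ3 (X x) (Y x) (Z x).
Proof. by rewrite G_fun_vv (vderiv_Q_v _ _ _ _ _ a1_smooth b1_smooth). Qed.

End Derivatives.

Lemma koszul_terms (l t1 t2 t3 t4 t5 t6 s1 s2 s3 s4 s5 s6 : R) :
  l = t1 + t2 - t3 + t4 - t5 - t6 -> t1 = s1 -> t2 = s2 -> t3 = s3 ->
  t4 = s4 -> t5 = s5 -> t6 = s6 -> l = s1 + s2 - s3 + s4 - s5 - s6.
Proof. by move=> -> -> -> -> -> -> ->. Qed.

Variables (X Y Z : vfield R n M).
Hypotheses (sX : smooth_vfield A X) (sY : smooth_vfield A Y) (sZ : smooth_vfield A Z).
Local Notation w := (Z x).

(** The covariant derivatives of [Z] cancel; the three curvature terms, which come from
    the brackets, are combined by the Bianchi identity and the pair symmetry. *)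
Lemma nb_hh_h : 2 * G p (nb (Xh X) (Xh Y) p) (h p w)
  = 2 * Q1 (nabla X Y x) w - 2 * alpha2 c t * Rm x (X x) u (Y x) w.
Proof.
have K := koszul_terms (koszul hGs hnb p (smh sX) (smh sY) (smh sZ))
  (vderiv_G_h_hh sX sY sZ) (vderiv_G_h_hh sY sZ sX) (vderiv_G_h_hh sZ sX sY)
  (G_bracket_hh_h w sX sY) (G_bracket_hh_h (Y x) sX sZ) (G_bracket_hh_h (X x) sY sZ).
apply: etrans K _.
rewrite Riem_bianchi_u (Riem_pair hM hs hLC x (X x) w) (Riem_pair hM hs hLC x (Y x) w).
rewrite (Riem_anti12 hM hs hLC x u (X x)) (Riem_anti12 hM hs hLC x u (Y x)).
by ring.
Qed.

Lemma nb_hh_v : 2 * G p (nb (Xh X) (Xh Y) p) (vl p w)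
  = 2 * Q2 (nabla X Y x) w - dQ1 w (X x) (Y x) - alpha1 c t * Rm x (X x) (Y x) u w.
Proof.
have K := koszul_terms (koszul hGs hnb p (smh sX) (smh sY) (smv sZ))
  (vderiv_G_h_hv sX sY sZ) (vderiv_G_h_vh sY sZ sX) (vderiv_G_v_hh Z X Y)
  (G_bracket_hh_v w sX sY) (G_bracket_hv_h (Y x) sX sZ) (G_bracket_hv_h (X x) sY sZ).
apply: etrans K _; ring.
Qed.

Lemma nb_hv_h : 2 * G p (nb (Xh X) (Xv Y) p) (h p w)
  = 2 * Q2 (nabla X Y x) w + dQ1 (Y x) w (X x) + alpha1 c t * Rm x (X x) w u (Y x).
Proof.
have K := koszul_terms (koszul hGs hnb p (smh sX) (smv sY) (smh sZ))
  (vderiv_G_h_vh sX sY sZ) (vderiv_G_v_hh Y Z X) (vderiv_G_h_hv sZ sX sY)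
  (G_bracket_hv_h w sX sY) (G_bracket_hh_v (Y x) sX sZ) (G_bracket_vh_h (X x) sY sZ).
apply: etrans K _; ring.
Qed.

Lemma nb_hv_v : 2 * G p (nb (Xh X) (Xv Y) p) (vl p w)
  = 2 * Q3 (nabla X Y x) w + dQ2 (Y x) w (X x) - dQ2 w (X x) (Y x).
Proof.
have K := koszul_terms (koszul hGs hnb p (smh sX) (smv sY) (smv sZ))
  (vderiv_G_h_vv sX sY sZ) (vderiv_G_v_vh Y Z X) (vderiv_G_v_hv Z X Y)
  (G_bracket_hv_v w sX sY) (G_bracket_hv_v (Y x) sX sZ) (G_bracket_vv sY sZ (h p (X x))).
apply: etrans K _; ring.
Qed.

Lemma nb_vv_h : 2 * G p (nb (Xv X) (Xv Y) p) (h p w)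
  = dQ2 (X x) (Y x) w + dQ2 (Y x) w (X x).
Proof.
have K := koszul_terms (koszul hGs hnb p (smv sX) (smv sY) (smh sZ))
  (vderiv_G_v_vh X Y Z) (vderiv_G_v_hv Y Z X) (vderiv_G_h_vv sZ sX sY)
  (G_bracket_vv sX sY (h p w)) (G_bracket_vh_v (Y x) sX sZ) (G_bracket_vh_v (X x) sY sZ).
apply: etrans K _; ring.
Qed.

Lemma nb_vv_v : 2 * G p (nb (Xv X) (Xv Y) p) (vl p w)
  = dQ3 (X x) (Y x) w + dQ3 (Y x) w (X x) - dQ3 w (X x) (Y x).
Proof.
have K := koszul_terms (koszul hGs hnb p (smv sX) (smv sY) (smv sZ))
  (vderiv_G_v_vv X Y Z) (vderiv_G_v_vv Y Z X) (vderiv_G_v_vv Z X Y)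
  (G_bracket_vv sX sY (vl p w)) (G_bracket_vv sX sZ (vl p (Y x))) (G_bracket_vv sY sZ (vl p (X x))).
apply: etrans K _; ring.
Qed.

End LeviCivita.

(** * Nondegeneracy *)

Section Nondegenerate.
Hypothesis hGnd : nondegenerate_metric G.
Variables (x : M) (u : 'rV[R]_n).
Local Notation p := ((x, u) : TM).
Local Notation t := (tt x u).

Lemma tangent_split (a : 'rV[R]_(n + n)) : exists v w, a = h p v + vl p w.
Proof.
have [rho [N [co Nx]]] := cutoff_exists hM (dom_at hM x).
exists (lsubmx a), (rsubmx a + @Gam R n M A nabla (at_pt A x) rho
  (chart (at_pt A x) x) (lsubmx a) u).
rewrite (hliftE hM hn co Nx) (vliftE hM) add_row_mx addr0 addrC addrK.
by rewrite hsubmxK.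
Qed.

Lemma lift_inj v w : h p v + vl p w = 0 -> v = 0 /\ w = 0.
Proof.
have [rho [N [co Nx]]] := cutoff_exists hM (dom_at hM x).
rewrite (hliftE hM hn co Nx) (vliftE hM) add_row_mx addr0 -row_mx0.
move=> /eq_row_mx[v0 w0]; split=> //; move: w0; rewrite v0.
have -> : @Gam R n M A nabla (at_pt A x) rho (chart (at_pt A x) x) 0 u = 0 by exact: bil0l.
by rewrite oppr0 add0r.
Qed.

Lemma G_eq (a b : 'rV[R]_(n + n)) : (forall w, G p a (h p w) = G p b (h p w)) ->
  (forall w, G p a (vl p w) = G p b (vl p w)) -> a = b.
Proof.
move=> Hh Hv; apply/eqP; rewrite -subr_eq0; apply/eqP; apply: (hGnd (x := p)) => d.
have [v [w ->]] := tangent_split d.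
rewrite (gDl hGs) (gNl hGs) !(gDr hGs) Hh Hv.
exact: subrr.
Qed.

(** On the plane spanned by the two lifts of [w] the metric is [g (w, _)] times the
    matrix [m], with no further term; a vector of the kernel of [m] would give a
    tangent vector orthogonal to everything. *)
Lemma det_neq0 (m11 m12 m22 : R) (w : 'rV[R]_n) : w != 0 ->
  (forall w', Qat a13 b13 x u w w' = m11 * g x w w') ->
  (forall w', Qat (alpha2 c) (beta2 c) x u w w' = m12 * g x w w') ->
  (forall w', Qat (alpha1 c) (beta1 c) x u w w' = m22 * g x w w') ->
  m22 * m11 - m12 ^+ 2 != 0.
Proof.
move=> w0 H11 H12 H22; apply/eqP => det0.
have lin1 (r : R) : h p (r *: w) = r *: h p w.
  have L := hlift_linear hM hn x u r w 0.
  have h0 : h p 0 = 0.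
    have := hlift_linear hM hn x u 1 0 0; rewrite !scale1r addr0 => /eqP.
    by rewrite -subr_eq0 opprD addrA subrr add0r oppr_eq0 => /eqP.
  by move: L; rewrite h0 !addr0.
have lin2 (r : R) : vl p (r *: w) = r *: vl p w.
  by rewrite !(vliftE hM) scale_row_mx scaler0.
have key (r s : R) : r * m11 + s * m12 = 0 -> r * m12 + s * m22 = 0 -> r = 0 /\ s = 0.
  move=> e1 e2.
  have : h p (r *: w) + vl p (s *: w) = 0.
    apply: G_eq => w'; rewrite (g0l hGs) (gDl hGs) lin1 lin2 !(gZl hGs).
      by rewrite G_hh G_vh H11 H12 !mulrA -mulrDl e1 mul0r.
    by rewrite G_hv G_vv H12 H22 !mulrA -mulrDl e2 mul0r.
  move=> /lift_inj[/eqP + /eqP]; rewrite !scaler_eq0 (negbTE w0) !orbF.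
  by move=> /eqP -> /eqP ->.
(* the rows of the adjugate matrix are in the kernel of a singular matrix *)
have [m220 m120] : m22 = 0 /\ - m12 = 0.
  by apply: key; [rewrite -det0; ring|ring].
have [_ /eqP] : m12 = 0 /\ - m11 = 0.
  by apply: key; [ring|rewrite -oppr0 -det0; ring].
rewrite oppr_eq0 => /eqP m110.
have [/eqP] : 1 = 0 :> R /\ 0 = 0 :> R.
  move/eqP: m120; rewrite oppr_eq0 => /eqP m120.
  by apply: key; [rewrite m110|rewrite m120]; ring.
by rewrite oner_eq0.
Qed.

(** The lifts of [u] itself; at [u = 0] the two determinants coincide. *)
Lemma phi_neq0 : alpha c t != 0 -> phi c t != 0.
Proof.
have [u0|u0] := eqVneq u 0.
  by rewrite u0 (g0l hs) /alpha /phi /phi1 /phi2 /phi3 !mul0r !addr0.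
move=> _; rewrite /phi.
apply: (@det_neq0 _ _ _ u) => // w'; rewrite /Qat /Qform (g_sym hs x w' u) /phi1 /phi2 /phi3; ring.
Qed.

(** The lifts of a nonzero vector orthogonal to [u]. In dimension 1 there is none, but
    the functions [beta] vanish and any vector will do. *)
Lemma alpha_neq0 : (0 < n)%N -> alpha c t != 0.
Proof.
move=> n0; rewrite /alpha.
have [n1|n1] := eqVneq n 1%N.
  have t0 : 0 <= t by exact: (g_ge0 hg).
  case: hG => _ _ _ /(_ n1 t t0)[e1 e2 e3] _.
  pose w : 'rV[R]_n := delta_mx 0 (Ordinal n0).
  have w0 : w != 0.
    apply/eqP => /rowP/(_ (Ordinal n0)); rewrite !mxE !eqxx => /eqP.
    by rewrite oner_eq0.
  apply: (@det_neq0 _ _ _ w w0) => w'; rewrite /Qat /Qform ?e1 ?e2 ?e3; ring.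
have n2 : (1 < n)%N by rewrite ltn_neqAle eq_sym n1.
pose i0 := Ordinal n0; pose i1 := Ordinal n2.
have [w [w0 wu]] : exists w, w != 0 /\ g x w u = 0.
  pose e0 : 'rV[R]_n := delta_mx 0 i0; pose e1 : 'rV[R]_n := delta_mx 0 i1.
  have [g0|g0] := eqVneq (g x e0 u) 0.
    exists e0; split=> //; apply/eqP => /rowP/(_ i0); rewrite !mxE !eqxx => /eqP.
    by rewrite oner_eq0.
  (* nonzero, since its component along [e1] is *)
  exists (g x e0 u *: e1 - g x e1 u *: e0); split; last first.
    by rewrite (gDl hs) (gNl hs) !(gZl hs) mulrC subrr.
  apply/eqP => /rowP/(_ i1); rewrite !mxE !eqxx /= mulr0 subr0 mulr1 => /eqP.
  by apply/negP.
by apply: (@det_neq0 _ _ _ w w0) => w'; rewrite /Qat /Qform wu; ring.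
Qed.

End Nondegenerate.

(** * The tensors *)

Section Tensors.
Variables (x : M) (u : 'rV[R]_n).
Local Notation t := (tt x u).

(** The seven scalars of which [Qcoef] lists the coefficients. *)
Definition invariants v w w' : seq R :=
  [:: Rm x v u w w'; Rm x w u v w'; Rm x v u w u * g x w' u;
      g x v u * g x w w'; g x w u * g x v w'; g x v w * g x w' u;
      g x v u * g x w u * g x w' u].

Lemma g_Tcomb f v w w' : let F := f t in
  g x (Tcomb A g nabla f x u v w) w' =
    F`_0 * Rm x v u w w' + F`_1 * Rm x w u v w' + F`_2 * Rm x v w u w'
    + F`_3 * (Rm x v u w u * g x w' u) + F`_4 * (g x v u * g x w w')
    + F`_5 * (g x w u * g x v w') + F`_6 * (g x v w * g x w' u)
    + F`_7 * (g x v u * g x w u * g x w' u).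
Proof.
rewrite /Tcomb /Tseq /= !big_ord_recl big_ord0 /= !(gDl hs) !(gZl hs) (g0l hs).
rewrite (g_sym hs x w' u) /Riem.
by ring.
Qed.

Lemma Qform_Tcomb a b f v w w' :
  Qform g a b x u (Tcomb A g nabla f x u v w) w' =
  \sum_(k < 7) nth 0 (Qcoef t a b (f t)) k * nth 0 (invariants v w w') k.
Proof.
rewrite /Qform !g_Tcomb !big_ord_recl big_ord0 /=.
(* eliminate the third tensor, then the scalar product of the second one with [u] *)
rewrite (Riem_bianchi_u x u v w w') (Riem_bianchi_u x u v w u).
rewrite (Riem_pair hM hs hLC x w u v u).
by ring.
Qed.

Lemma solves_sum (m m' : R * R) f f' s v w w' :
  solves t m m' (f t) (f' t) s ->
  Qform g m.1 m.2 x u (Tcomb A g nabla f x u v w) w'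
  + Qform g m'.1 m'.2 x u (Tcomb A g nabla f' x u v w) w'
  = \sum_(k < 7) nth 0 s k * nth 0 (invariants v w w') k.
Proof.
move=> H; rewrite !Qform_Tcomb -big_split; apply: eq_bigr => k _ /=.
by rewrite -mulrDl H.
Qed.

End Tensors.
(** * The Levi-Civita connection of a natural metric *)

Section Formulas.
Hypothesis hGnd : nondegenerate_metric G.
Variable nb : vfield R (n + n) TM -> vfield R (n + n) TM -> vfield R (n + n) TM.
Hypothesis hnb : levi_civita TA G nb.
Variables (x : M) (u : 'rV[R]_n).
Hypothesis n_gt0 : (0 < n)%N.
Variables (X Y : vfield R n M).
Hypotheses (sX : smooth_vfield A X) (sY : smooth_vfield A Y).
Local Notation p := ((x, u) : TM).
Local Notation t := (tt x u).
Local Notation P f := (Tcomb A g nabla f x u).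

Let al0 : alpha c t != 0 := alpha_neq0 hGnd x u n_gt0.
Let ph0 : phi c t != 0 := phi_neq0 hGnd al0.
Let two0 : (2 : R) != 0. Proof. by rewrite pnatr_eq0. Qed.

Lemma formula_hh : nb (Xh X) (Xh Y) p = h p (nabla X Y x)
  + h p (P (fcoefA c) (X x) (Y x)) + vl p (P (fcoefB c) (X x) (Y x)).
Proof.
apply: (G_eq hGnd) => w; have [Z sZ <-] := extend_vector hM x w;
  apply: (mulfI two0).
  apply: etrans (nb_hh_h hnb x u sX sY sZ) _.
  rewrite !(gDl hGs) !G_hh G_vh -[in RHS]addrA.
  rewrite (solves_sum _ _ _ (solves_AB_h al0 ph0)) !big_ord_recl big_ord0 /=.
  by ring.
apply: etrans (nb_hh_v hnb x u sX sY sZ) _.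
rewrite !(gDl hGs) !G_hv G_vv -[in RHS]addrA.
rewrite (solves_sum _ _ _ (solves_AB_v al0 ph0)) !big_ord_recl big_ord0 /=.
rewrite Riem_bianchi_u /dQat (g_sym hs x (Y x) (Z x)) (g_sym hs x (X x) (Z x)).
by field.
Qed.

Lemma formula_hv : nb (Xh X) (Xv Y) p = vl p (nabla X Y x)
  + h p (P (fcoefC c) (X x) (Y x)) + vl p (P (fcoefD c) (X x) (Y x)).
Proof.
set PC := P (fcoefC c) _ _; set PD := P (fcoefD c) _ _.
apply: (G_eq hGnd) => w; have [Z sZ <-] := extend_vector hM x w;
  apply: (mulfI two0).
  apply: etrans (nb_hv_h hnb x u sX sY sZ) _.
  rewrite (G_vhv_h x u (nabla X Y x) PC PD (Z x)).
  rewrite (solves_sum _ _ _ (solves_CD_h al0 ph0)) !big_ord_recl big_ord0 /=.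
  rewrite (Riem_pair hM hs hLC x (X x) (Z x)) (Riem_anti12 hM hs hLC x u (Y x)).
  rewrite /dQat (g_sym hs x (Z x) (X x)) (g_sym hs x (Z x) (Y x)).
  by field.
apply: etrans (nb_hv_v hnb x u sX sY sZ) _.
rewrite (G_vhv_v x u (nabla X Y x) PC PD (Z x)).
rewrite (solves_sum _ _ _ (solves_CD_v al0 ph0)) !big_ord_recl big_ord0 /=.
rewrite /dQat (g_sym hs x (Z x) (X x)) (g_sym hs x (Z x) (Y x)).
by field.
Qed.

Lemma formula_vv : nb (Xv X) (Xv Y) p =
  h p (P (fcoefE c) (Y x) (X x)) + vl p (P (fcoefF c) (Y x) (X x)).
Proof.
apply: (G_eq hGnd) => w; have [Z sZ <-] := extend_vector hM x w;
  apply: (mulfI two0).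
  apply: etrans (nb_vv_h hnb x u sX sY sZ) _.
  rewrite (gDl hGs) G_hh G_vh.
  rewrite (solves_sum _ _ _ (solves_EF_h al0 ph0)) !big_ord_recl big_ord0 /=.
  rewrite /dQat (g_sym hs x (Z x) (X x)) (g_sym hs x (Z x) (Y x)) (g_sym hs x (Y x) (X x)).
  by field.
apply: etrans (nb_vv_v hnb x u sX sY sZ) _.
rewrite (gDl hGs) G_hv G_vv.
rewrite (solves_sum _ _ _ (solves_EF_v al0 ph0)) !big_ord_recl big_ord0 /=.
rewrite /dQat (g_sym hs x (Z x) (X x)) (g_sym hs x (Z x) (Y x)) (g_sym hs x (Y x) (X x)).
by field.
Qed.

End Formulas.

(** The torsion of the connection is zero: this follows from [formula_hv] and the
    bracket of a horizontal and a vertical lift. *)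
Lemma formula_vh nb x u X Y : nondegenerate_metric G -> levi_civita TA G nb ->
  (0 < n)%N -> smooth_vfield A X -> smooth_vfield A Y ->
  nb (Xv X) (Xh Y) (x, u) =
    h (x, u) (Tcomb A g nabla (fcoefC c) x u (Y x) (X x))
    + vl (x, u) (Tcomb A g nabla (fcoefD c) x u (Y x) (X x)).
Proof.
move=> hGnd hnb n0 sX sY.
have T : nb (Xh Y) (Xv X) (x, u) - nb (Xv X) (Xh Y) (x, u) = vl (x, u) (nabla Y X x).
  rewrite -bracket_hv_at //; case: hnb => _ H _.
  by apply: H; [exact: (hlift_smooth hM hn)|exact: (vlift_smooth hM)].
rewrite -[LHS](subKr (nb (Xh Y) (Xv X) (x, u))) T (formula_hv hGnd hnb) //.
have gen (a b d : 'rV[R]_(n + n)) : a + b + d - a = b + d.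
  by rewrite addrAC [a + b]addrC addrK.
exact: gen.
Qed.

End NaturalMetric.

Unset Implicit Arguments.

Theorem proposition3p1 (R : realType) (n : nat) (M : topologicalType)
    (A : atlas R n M) (g : tensor02 R n M)
    (nabla : vfield R n M -> vfield R n M -> vfield R n M)
    (c : gnat_coef R) (G : tensor02 R (n + n) (M * 'rV[R]_n)%type)
    (nablabar : vfield R (n + n) (M * 'rV[R]_n)%type ->
                vfield R (n + n) (M * 'rV[R]_n)%type ->
                vfield R (n + n) (M * 'rV[R]_n)%type)
    (hM : smooth_manifold A) (hg : riemannian A g)
    (hnabla : levi_civita A g nabla)
    (hG : g_natural A g nabla c G) (hGnd : nondegenerate_metric G)
    (hnablabar : levi_civita (tangent_atlas A) G nablabar)
    (x : M) (u : 'rV[R]_n) (X Y : vfield R n M)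
    (hX : smooth_vfield A X) (hY : smooth_vfield A Y) :
  let h := hlift A nabla (x, u) in
  let v := vlift A (x, u) in
  let Xh := hlift_vfield A nabla X in
  let Yh := hlift_vfield A nabla Y in
  let Xv := vlift_vfield A X in
  let Yv := vlift_vfield A Y in
  let P f := Tcomb A g nabla f x u in
  [/\ nablabar Xh Yh (x, u) = h (nabla X Y x)
        + h (P (fcoefA c) (X x) (Y x)) + v (P (fcoefB c) (X x) (Y x)),
      nablabar Xh Yv (x, u) = v (nabla X Y x)
        + h (P (fcoefC c) (X x) (Y x)) + v (P (fcoefD c) (X x) (Y x)),
      nablabar Xv Yh (x, u) =
        h (P (fcoefC c) (Y x) (X x)) + v (P (fcoefD c) (Y x) (X x))
    & nablabar Xv Yv (x, u) =
        h (P (fcoefE c) (Y x) (X x)) + v (P (fcoefF c) (Y x) (X x))].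
Proof.
move=> h v Xh Yh Xv Yv P.
have [n0|n_gt0] := posnP n.
  by subst n; split; apply/rowP => -[].
have hLC := hnabla.
split.
- exact: (formula_hh hM hg hLC hG hGnd hnablabar x u n_gt0 hX hY).
- exact: (formula_hv hM hg hLC hG hGnd hnablabar x u n_gt0 hX hY).
- exact: (formula_vh hM hg hLC hG x u hGnd hnablabar n_gt0 hX hY).
- exact: (formula_vv hM hg hLC hG hGnd hnablabar x u n_gt0 hX hY).
Qed.
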